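(* Let $f(z)=z+a_2z^2+a_3z^3+\cdots$ be analytic and univalent in the unit disk $\mathbb{D}=\{z:|z|<1\}$ with $a_2=0$, and let $f^{-1}(w)=w+A_2w^2+A_3w^3+A_4w^4+A_5w^5+\cdots$ be the expansion of its inverse function near $w=0$. Set $H_2(3)(f^{-1})=A_3A_5-A_4^2$. Then $$|H_2(3)(f^{-1})|\le \frac{\sqrt{3}}{6\sqrt{7}}+2\sqrt{3}=3.57321\ldots.$$ *)

(* Defs.v *)
From Stdlib Require Import Reals.
From Coquelicot Require Import Coquelicot.
Open Scope R_scope.

Definition in_unit_disk (z : C) : Prop := Cmod z < 1.

Definition pseries_sum (a : nat -> C) (z l : C) : Prop :=
  is_series (fun n : nat => (a n * z ^ n)%C) l.

Definition analytic_in_disk (a : nat -> C) : Prop :=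
  forall z : C, in_unit_disk z -> exists l : C, pseries_sum a z l.

Definition univalent_in_disk (a : nat -> C) : Prop :=
  forall z w fz fw : C, in_unit_disk z -> in_unit_disk w ->
    pseries_sum a z fz -> pseries_sum a w fw -> fz = fw -> z = w.

Definition is_inverse_expansion (a A : nat -> C) : Prop :=
  exists r : R, 0 < r /\
    forall w : C, Cmod w < r ->
      exists gw : C, pseries_sum A w gw /\ in_unit_disk gw /\ pseries_sum a gw w.

(* Main.v *)
(* The reciprocal of f is 1/z + b1 z + b2 z^2 + b3 z^3 + O(z^4) with b1 = -a3,
   b2 = -a4, b3 = a3^2 - a5, and inverting the series gives
   A3 A5 - A4^2 = -(a3 b3 + 2 a3^3 + a4^2). The area theorem
   |b1|^2 + 2 |b2|^2 + 3 |b3|^2 <= 1 then bounds the modulus by 5/2.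

   The area theorem is obtained without the Jordan curve theorem or a change of
   variables. Give the plane the metric with density tau / (tau + |w|^2)^2, of
   total mass at most PI. Counting pairs (p, w) with |f(p) - w| < delta in two
   ways (Tonelli) and letting delta -> 0 shows that the image of a disc under the
   injective map f has mass at most PI. In the logarithmic coordinates
   z = exp (s + i t), Green's formula turns this mass into a boundary integral;
   subtracting the argument principle and letting tau -> 0 yields
   0 <= - RInt Re (F' conj F) on each circle, where F = 1/f and F' = dF/ds.
   Expanding F, the mean value property kills the cross terms, the tail O(z^4)
   contributes with the right sign, and the radius tends to 1. *)
Require Import Defs.
From Stdlib Require Reals Lra Lia Psatz Classical.
From Coquelicot Require Coquelicot.
From HB Require structures.
From mathcomp Require all_boot order all_algebra all_classical all_reals.
From mathcomp Require ereal topology normedtype sequences landau derive realfun numfun.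
From mathcomp Require measure lebesgue_measure measurable_realfun.
From mathcomp Require lebesgue_integral ftc Rstruct Rstruct_topology lra.

(** Classically the area theorem measures the set omitted by F = 1/f, which presupposes that image
    circles are Jordan curves. With a finite mass on the plane, an upper bound on what f covers is
    enough: inversion has Jacobian 1 / |w|^4, the limit of (tau + |w|^2)^-2, so the uncovered mass
    divided by [tau] tends to the area omitted by F, and it is nonnegative as soon as the covered
    mass is at most [PI].

    The covered mass is bounded by packing. The points p whose image is within delta of a given w
    lie in one disc of radius about delta / |f'(p)|. The weight |f'|^2 cancels the size of that
    disc, so each w receives about delta^2 times the area of the unit disc times the density at w,
    whatever f is. Only this inequality is proved, so the image of f itself is never measured, and
    the area of the unit disc cancels from the two counts.

    As for the determinant: with b3 = a3^2 - a5 one has A3 = -a3, A4 = -a4 and A5 = 2 a3^2 + b3, so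
    it is a polynomial in exactly the three quantities that the area theorem controls. *)

Module Riemann.
Import Stdlib.Reals.Reals Stdlib.micromega.Lra Stdlib.micromega.Psatz.
Import Coquelicot.Coquelicot.
Local Open Scope R_scope.

(** * Riemann integrals with a parameter, and the area of a disc *)

Lemma continuity_2d_pt_section_r (f : R -> R -> R) (x y : R) :
  continuity_2d_pt f x y -> continuous (f x) y.
Proof.
  intros H. apply continuity_pt_filterlim, continuity_pt_locally.
  intros eps. destruct (H eps) as [d Hd]. exists d. intros v Hv.
  apply Hd; [|exact Hv].
  replace (x - x) with 0 by ring. rewrite Rabs_R0. apply cond_pos.
Qed.

Lemma ex_RInt_everywhere_continuous (f : R -> R) (a b : R) :
  (forall x, continuous f x) -> ex_RInt f a b.
Proof. intros H. apply (ex_RInt_continuous (V := R_CompleteNormedModule)). intros; apply H. Qed.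

Lemma continuous_RInt_param (f : R -> R -> R) (c d x : R) :
  (forall u, continuity_2d_pt f x u) -> locally x (fun t => forall u, continuous (f t) u) -> c <= d ->
  continuous (fun t => RInt (f t) c d) x.
Proof.
  intros H Hloc Hcd. apply continuity_pt_filterlim, continuity_pt_locally.
  intros eps.
  (* The [+ 1] covers the degenerate interval [c = d]. *)
  assert (He : 0 < eps / (d - c + 1)).
  { apply Rdiv_lt_0_compat. apply cond_pos. lra. }
  destruct (uniform_continuity_2d_1d' f c d x (fun t _ => H t) (mkposreal _ He))
    as [del Hdel].
  generalize (filter_and _ _ Hloc (locally_ball x del)). apply filter_imp.
  intros t [Ht Hb]. assert (Hb' : Rabs (t - x) < del) by exact Hb.
  assert (Hx := locally_singleton _ _ Hloc). simpl in Hx.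
  assert (E1 : ex_RInt (f t) c d) by (apply ex_RInt_everywhere_continuous; exact Ht).
  assert (E2 : ex_RInt (f x) c d) by (apply ex_RInt_everywhere_continuous; exact Hx).
  change (Rabs (RInt (f t) c d - RInt (f x) c d) < eps).
  rewrite <- (RInt_minus (V := R_CompleteNormedModule)) by assumption.
  apply Rle_lt_trans with ((d - c) * (eps / (d - c + 1))).
  - apply (abs_RInt_le_const (fun u => minus (f t u) (f x u))); auto.
    + exact (ex_RInt_minus (V := R_NormedModule) (f t) (f x) c d E1 E2).
    + intros u Hu. apply Rlt_le. apply Rabs_def2 in Hb'.
      generalize (cond_pos del); intros.
      apply (Hdel u x u t); try lra.
      replace (u - u) with 0 by ring. rewrite Rabs_R0. assumption.
  - generalize (cond_pos eps). intros.
    replace ((d - c) * (eps / (d - c + 1))) with (eps * ((d - c) / (d - c + 1))) by (field; lra).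
    rewrite <- (Rmult_1_r eps) at 2. apply Rmult_lt_compat_l; auto.
    apply Rmult_lt_reg_r with (d - c + 1). lra. unfold Rdiv. rewrite Rmult_assoc, Rinv_l; lra.
Qed.

Lemma continuous_RInt_param_everywhere (f : R -> R -> R) (c d x : R) :
  (forall t u, continuity_2d_pt f t u) -> c <= d ->
  continuous (fun t => RInt (f t) c d) x.
Proof.
  intros H Hcd. apply continuous_RInt_param; auto.
  apply filter_forall. intros t u. apply continuity_2d_pt_section_r, H.
Qed.

(** Left unevaluated: the double count uses only its positivity and the scaling by [r ^ 2], since
    the same factor stands on both sides. *)
Definition unit_disc_area : R := RInt (fun x => 2 * sqrt (1 ^ 2 - x ^ 2)) (-1) 1.

Lemma continuous_chord (r a x : R) :
  continuous (fun x => 2 * sqrt (r ^ 2 - (x - a) ^ 2)) x.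
Proof.
  apply (continuous_scal_r (V := R_NormedModule) 2 (fun x => sqrt (r ^ 2 - (x - a) ^ 2))).
  apply continuous_sqrt_comp.
  apply (ex_derive_continuous (V := R_NormedModule) (fun x => r ^ 2 - (x - a) ^ 2)).
  auto_derive. exact I.
Qed.

Lemma unit_disc_area_pos : 0 < unit_disc_area.
Proof.
  apply RInt_gt_0; [lra| |].
  - intros x Hx. apply Rmult_lt_0_compat; [lra|]. apply sqrt_lt_R0. nra.
  - intros x _. generalize (continuous_chord 1 0 x). apply continuous_ext.
    intros y. now rewrite Rminus_0_r.
Qed.

Lemma RInt_chord (r a : R) : 0 < r ->
  RInt (fun x => 2 * sqrt (r ^ 2 - (x - a) ^ 2)) (a - r) (a + r) = unit_disc_area * r ^ 2.
Proof.
  intros Hr.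
  assert (E := RInt_comp_lin (V := R_CompleteNormedModule)
    (fun x => 2 * sqrt (r ^ 2 - (x - a) ^ 2)) r a (-1) 1).
  replace (r * -1 + a) with (a - r) in E by ring.
  replace (r * 1 + a) with (a + r) in E by ring.
  rewrite <- E; [|apply ex_RInt_everywhere_continuous; intros; apply continuous_chord].
  transitivity (r ^ 2 * unit_disc_area); [|exact (Rmult_comm _ _)].
  assert (Ex : ex_RInt (fun x => 2 * sqrt (1 ^ 2 - x ^ 2)) (-1) 1).
  { apply ex_RInt_everywhere_continuous. intros x.
    generalize (continuous_chord 1 0 x). apply continuous_ext.
    intros y. now rewrite Rminus_0_r. }
  etransitivity; [|exact (RInt_scal (V := R_CompleteNormedModule) _ _ _ (r ^ 2) Ex)].
  apply RInt_ext. intros x _. unfold scal; simpl; unfold mult; simpl.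
  replace (r * (r * 1) - (r * x + a - a) * ((r * x + a - a) * 1))
    with (r ^ 2 * (1 * (1 * 1) - x * (x * 1))) by ring.
  rewrite sqrt_mult_alt by (apply pow2_ge_0). rewrite sqrt_pow2 by lra. ring.
Qed.

Lemma continuous_epsilon (f : R -> R) (x e : R) : continuous f x -> 0 < e ->
  exists d, 0 < d /\ forall y, Rabs (y - x) < d -> Rabs (f y - f x) < e.
Proof.
  intros H He.
  apply continuity_pt_filterlim in H.
  destruct (proj1 (continuity_pt_locally f x) H (mkposreal e He)) as [d Hd].
  exists d. split; [apply cond_pos|exact Hd].
Qed.

Lemma is_derive_RInt_epsilon (f : R -> R) (a x e : R) :
  (forall x, continuous f x) -> 0 < e ->
  exists d, 0 < d /\ forall h, h <> 0 -> Rabs h < d ->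
    Rabs ((RInt f a (x + h) - RInt f a x) / h - f x) < e.
Proof.
  intros H He.
  assert (D : is_derive (RInt f a) x (f x)).
  { apply (is_derive_RInt f (RInt f a) a x); [|apply H].
    apply filter_forall. intros t. apply (RInt_correct (V := R_CompleteNormedModule)).
    apply ex_RInt_everywhere_continuous, H. }
  apply is_derive_Reals in D. destruct (D e He) as [d Hd].
  exists d. split; [apply cond_pos|exact Hd].
Qed.

End Riemann.

Module Lebesgue.
Import HB.structures all_boot order all_algebra all_classical all_reals.
Import ereal topology normedtype sequences landau derive realfun numfun measure.
Import lebesgue_measure measurable_realfun lebesgue_integral ftc Rstruct Rstruct_topology.
Import mathcomp.algebra_tactics.lra.
Import Order.TTheory GRing.Theory Num.Theory numFieldNormedType.Exports.
Set Implicit Arguments.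
Unset Strict Implicit.
Unset Printing Implicit Defensive.
Local Open Scope classical_set_scope.
Local Open Scope ring_scope.

(** * Double counting by Tonelli's theorem *)

Section double_counting.
Context d1 d2 (T1 : measurableType d1) (T2 : measurableType d2) (R : realType).
Variable m1 : {sigma_finite_measure set T1 -> \bar R}.
Variable m2 : {sigma_finite_measure set T2 -> \bar R}.

(** The weight [J p] is integrated over the incidences in [D] with [p] in [P], in both orders. A
    fixed [p] contributes at least [k * J p]. For a fixed [w] the weight is at most [j] on a slice
    of measure at most [m], hence contributes at most [k' * chi w]. Upper bounds on slices thus play
    the part of a change of variables. *)
Lemma double_counting (P : set T1) (B : set T2) (D : set (T1 * T2))
    (J : T1 -> R) (chi : T2 -> R) (k k' : R) :
  measurable P -> measurable B -> measurable D ->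
  measurable_fun setT J -> measurable_fun setT chi ->
  (forall p, 0 <= J p) -> (forall w, 0 <= chi w) -> 0 <= k ->
  (forall p, P p -> (k%:E <= m2 (xsection D p))%E) ->
  (forall p w, P p -> D (p, w) -> B w) ->
  (forall w, B w -> exists j m : R, [/\ 0 <= j, j * m <= k' * chi w,
     (m1 (ysection D w `&` P) <= m%:E)%E &
     forall p, P p -> D (p, w) -> J p <= j]) ->
  (k%:E * \int[m1]_(p in P) (J p)%:E <= \int[m2]_(w in B) (k' * chi w)%:E)%E.
Proof.
move=> mP mB mD mJ mchi J0 chi0 k0 HP HB HW.
pose F (z : T1 * T2) : \bar R :=
  (J z.1 * \1_P z.1 * \1_D z)%:E.
have mF : measurable_fun setT F.
  apply/measurable_EFinP; apply: measurable_funM.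
    apply: measurable_funM.
      exact: (measurableT_comp mJ measurable_fst).
    have mI : measurable_fun setT (\1_P : T1 -> R) by exact: measurable_indic.
    exact: (measurableT_comp mI measurable_fst).
  exact: measurable_indic.
have F0 z : (0 <= F z)%E by rewrite lee_fin !mulr_ge0.
have E1 := @fubini_tonelli1 _ _ _ _ _ m1 m2 F mF F0.
have E2 := @fubini_tonelli2 _ _ _ _ _ m1 m2 F mF F0.
apply: (@le_trans _ _ (\int[m1]_p fubini_F m2 F p)%E).
  rewrite -ge0_integralZl//; last 2 first.
  - by apply/measurable_EFinP; exact: measurable_funTS.
  - by move=> p _; rewrite lee_fin.
  rewrite integral_mkcond; apply: ge0_le_integral => //.
  - by move=> p _; rewrite patchE; case: ifPn => // _; rewrite mule_ge0// lee_fin.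
  - apply/(measurable_restrictT _ _).1 => //.
    by apply/measurable_funeM/measurable_EFinP; exact: measurable_funTS.
  - exact: measurable_fun_fubini_tonelli_F.
  move=> p _; rewrite patchE; case: ifPn => [|_]; last first.
    by apply: integral_ge0 => w _; exact: F0.
  rewrite inE => Pp; rewrite /fubini_F /F/=.
  have -> : (\int[m2]_y (J p * \1_P p * \1_D (p, y))%:E =
             (J p)%:E * m2 (xsection D p))%E.
    rewrite -[xsection D p]setIT -integral_indic//; last first.
      exact: measurable_xsection.
    rewrite -ge0_integralZl//.
    + apply: eq_integral => w _; rewrite -EFinM; congr (_%:E).
      rewrite [\1_P p]indicE mem_set// mulr1; congr (_ * _).
      by rewrite !indicE mem_xsection.
    + apply/measurable_EFinP; apply: measurable_indic; exact: measurable_xsection.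
    + by rewrite lee_fin.
  by rewrite muleC; apply: lee_wpmul2l; [rewrite lee_fin|exact: HP].
rewrite -E1 E2 [leRHS]integral_mkcond.
apply: ge0_le_integral => //.
- by move=> w _; apply: integral_ge0 => p _; exact: F0.
- exact: measurable_fun_fubini_tonelli_G.
- apply/(measurable_restrictT _ _).1 => //.
  by apply/measurable_EFinP; apply: measurable_funM => //; exact: measurable_funTS.
move=> w _; rewrite patchE; case: ifPn => [|]; last first.
  rewrite notin_setE => nB; rewrite /fubini_G integral0_eq// => p _.
  rewrite /F/=; rewrite !indicE; case: (boolP (p \in P)) => [|_]; last by rewrite mulr0 mul0r.
  rewrite inE => Pp; case: (boolP ((p, w) \in D)) => [|_]; last by rewrite mulr0.
  by rewrite inE => /(HB _ _ Pp).
rewrite inE => Bw; have [j [m [j0 jm Hm Hj]]] := HW w Bw.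
apply: (@le_trans _ _ (j%:E * m1 (ysection D w `&` P))%E); last first.
  apply: (@le_trans _ _ (j%:E * m%:E)%E); last by rewrite -EFinM lee_fin.
  by apply: lee_wpmul2l; rewrite ?lee_fin.
have mDP : measurable (ysection D w `&` P).
  by apply: measurableI => //; exact: measurable_ysection.
rewrite -[ysection D w `&` P]setIT -integral_indic// -ge0_integralZl//; last first.
  by apply/measurable_EFinP; exact: measurable_indic.
apply: ge0_le_integral => //.
- exact: (measurableT_comp mF (measurable_pair2 w)).
- by apply/measurable_funeM/measurable_EFinP; exact: measurable_indic.
move=> p _; rewrite /F/= -EFinM lee_fin.
rewrite [X in _ <= j * X]indicE in_setI mem_ysection !indicE.
case: (boolP (p \in P)) => [|_]; last by rewrite mulr0 mul0r andbF mulr0.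
rewrite inE => Pp; case: (boolP ((p, w) \in D)) => [|_]; last by rewrite !mulr0.
by rewrite inE => Dpw; rewrite !mulr1; exact: Hj.
Qed.

End double_counting.

(** * Lebesgue measure on the plane *)

Section plane.
Context {R : realType}.

Local Notation mu := (@lebesgue_measure R).

(* A constant of its own: the library's canonical sigma-finite structure on
   [m1 \x m2] is shadowed by the one for probability measures. *)
Definition plane_measure : set (measurableTypeR R * measurableTypeR R) -> \bar R :=
  (mu \x mu)%E.

HB.instance Definition _ := Measure.on plane_measure.

Lemma plane_measure_sigma_finite : sigma_finite setT plane_measure.
Proof.
have /sigma_finiteP[F [TF ndF Foo]] := sigma_finiteT mu.
exists (fun n => F n `*` F n).
  rewrite -setXTT TF predeqE => -[x y]; split.
    move=> [/= [n _ Fnx] [k _ Gky]]; exists (maxn n k) => //; split.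
    - by move: x Fnx; exact/subsetPset/ndF/leq_maxl.
    - by move: y Gky; exact/subsetPset/ndF/leq_maxr.
  by move=> [n _ []/= ? ?]; split; exists n.
move=> k; have [? ?] := Foo k; split; first exact: measurableX.
by rewrite /plane_measure product_measure1E// lte_mul_pinfty// ge0_fin_numE.
Qed.

HB.instance Definition _ :=
  Measure_isSigmaFinite.Build _ _ _ plane_measure plane_measure_sigma_finite.

Local Notation pi2 := plane_measure.

(** The sigma-algebra here is the product one, generated by rectangles. Open sets belong to it
    because each is a countable union of boxes with rational corners. *)
Lemma continuous_plane_measurable (f : R * R -> R) :
  continuous f -> measurable_fun [set: measurableTypeR R * measurableTypeR R] f.
Proof.
move=> cf.
apply: (measurability _ (RGenOpens.measurableE R)).
move=> _ [_ [a [b ->] <-]]; rewrite setTI.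
set U := f @^-1` _.
have oU : open U by move/continuousP: cf; apply; exact: interval_open.
pose box (k : (rat * rat) * (rat * rat)) : set (R * R) :=
  `]ratr k.1.1, ratr k.1.2[%classic `*` `]ratr k.2.1, ratr k.2.2[%classic.
have -> : U = \bigcup_(k in [set k | box k `<=` U]) box k.
  apply/seteqP; split; last by move=> p [k /= kU]; exact: kU.
  move=> [x y] Up.
  have : nbhs (x, y) U by apply: open_nbhs_nbhs.
  rewrite -nbhs_ballE => -[e /= e0 eU].
  have lt1 (t : R) : t - e < t by rewrite ltrBlDr ltrDl.
  have lt2 (t : R) : t < t + e by rewrite ltrDl.
  have [a1] := rat_in_itvoo (lt1 x); rewrite in_itv/= => /andP[a1l a1r].
  have [b1] := rat_in_itvoo (lt2 x); rewrite in_itv/= => /andP[b1l b1r].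
  have [a2] := rat_in_itvoo (lt1 y); rewrite in_itv/= => /andP[a2l a2r].
  have [b2] := rat_in_itvoo (lt2 y); rewrite in_itv/= => /andP[b2l b2r].
  exists ((a1, b1), (a2, b2)) => /=; last first.
    by split => /=; rewrite in_itv/=; apply/andP; split.
  move=> [u v] [/=]; rewrite !in_itv/= => /andP[ul ur] /andP[vl vr].
  apply: eU; split => /=; rewrite /ball/= ltr_distlC; apply/andP; split.
  - exact: lt_trans ul.
  - exact: lt_trans b1r.
  - exact: lt_trans vl.
  - exact: lt_trans b2r.
rewrite bigcup_mkcond; apply: countable_bigcupT_measurable => // k.
case: ifP => // _.
by apply: measurableX; exact: measurable_itv.
Qed.

Lemma plane_integral_rect (J : R * R -> R) (a b c d : R) :
  continuous J -> (forall p, 0 <= J p) ->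
  (\int[pi2]_(p in `[a, b] `*` `[c, d]) (J p)%:E =
   \int[mu]_(x in `[a, b]) \int[mu]_(y in `[c, d]) (J (x, y))%:E)%E.
Proof.
move=> cJ J0.
have mJ := continuous_plane_measurable cJ.
rewrite integral_mkcond /plane_measure fubini_tonelli1; last 2 first.
- apply/(measurable_restrictT _ _).1; first by apply: measurableX; exact: measurable_itv.
  by apply/measurable_EFinP; exact: measurable_funTS.
- by move=> p; rewrite patchE; case: ifPn => // _; rewrite lee_fin.
rewrite [RHS]integral_mkcond; apply: eq_integral => x _.
rewrite /fubini_F [RHS]patchE; case: ifPn => [|].
  rewrite inE/= => xab; rewrite [RHS]integral_mkcond; apply: eq_integral => y _.
  rewrite !patchE; congr (if _ then _ else _).
  by apply/idP/idP; rewrite !inE/=; [case|split].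
rewrite notin_setE/= => xab; apply: integral0_eq => y _.
by rewrite patchE; case: ifPn => //; rewrite inE/= => -[].
Qed.

End plane.

(** * Areas of discs; compactness and separation *)

Section discs.
Context {R : realType}.
Local Notation mu := (@lebesgue_measure R).
Local Notation pi2 := (@plane_measure R).

Definition open_disc (a : R * R) (r : R) : set (R * R) :=
  [set w | (w.1 - a.1) ^+ 2 + (w.2 - a.2) ^+ 2 < r ^+ 2].

Lemma continuous_sqdist (T : topologicalType) (f g h k : T -> R) :
  continuous f -> continuous g -> continuous h -> continuous k ->
  continuous (fun x => (f x - g x) ^+ 2 + (h x - k x) ^+ 2).
Proof.
move=> cf cg ch ck x; apply: cvgD.
- apply: (@continuous_comp _ _ _ (fun x => f x - g x) (fun y => y ^+ 2)).
    by apply: cvgB; [exact: cf|exact: cg].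
  exact: exprn_continuous.
- apply: (@continuous_comp _ _ _ (fun x => h x - k x) (fun y => y ^+ 2)).
    by apply: cvgB; [exact: ch|exact: ck].
  exact: exprn_continuous.
Qed.

Lemma continuous_fst : continuous (fst : R * R -> R).
Proof. by move=> p; exact: cvg_fst. Qed.

Lemma continuous_snd : continuous (snd : R * R -> R).
Proof. by move=> p; exact: cvg_snd. Qed.

Lemma measurable_disc (a : R * R) (r : R) :
  measurable (open_disc a r : set (measurableTypeR R * measurableTypeR R)).
Proof.
have -> : open_disc a r = (fun w : R * R =>
    (w.1 - a.1) ^+ 2 + (w.2 - a.2) ^+ 2) @^-1` `]-oo, r ^+ 2[%classic.
  by apply/seteqP; split=> w /=; rewrite in_itv.
rewrite -[X in measurable X]setTI.
apply: continuous_plane_measurable; [|exact: measurableT|exact: measurable_itv].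
apply: continuous_sqdist.
- exact: continuous_fst.
- by move=> ?; exact: cvg_cst.
- exact: continuous_snd.
- by move=> ?; exact: cvg_cst.
Qed.

Lemma disc_measure (a : R * R) (r : R) : 0 < r ->
  pi2 (open_disc a r) =
  (\int[mu]_(x in `[(a.1 - r)%R, (a.1 + r)%R]) (2 * Num.sqrt (r ^+ 2 - (x - a.1) ^+ 2))%:E)%E.
Proof.
move=> r0; rewrite /plane_measure /product_measure1 [RHS]integral_mkcond.
apply: eq_integral => x _ /=.
(* Valid for every [x]: beyond the ends of the diameter the square root of a negative number is 0,
   and both sets are empty. *)
have E : xsection (open_disc a r) x =
    `]a.2 - Num.sqrt (r ^+ 2 - (x - a.1) ^+ 2),
      a.2 + Num.sqrt (r ^+ 2 - (x - a.1) ^+ 2)[%classic.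
  apply/seteqP; split => y; rewrite /xsection/= inE /open_disc/= in_itv/=.
    rewrite -ltrBrDl => H.
    rewrite -ltr_distl -sqrtr_sqr ltr_sqrt//.
    by apply: le_lt_trans H; exact: sqr_ge0.
  rewrite -ltr_distl -ltrBrDl => H.
  have s0 : 0 < r ^+ 2 - (x - a.1) ^+ 2.
    by rewrite -sqrtr_gt0; apply: le_lt_trans H.
  by rewrite -real_normK ?num_real// -[ltRHS]sqr_sqrtr ?(ltW s0)// ltr_pXn2r// ?nnegrE// sqrtr_ge0.
rewrite E lebesgue_measure_itv/= lte_fin.
have -> : ((if (a.2 - Num.sqrt (r ^+ 2 - (x - a.1) ^+ 2) <
    a.2 + Num.sqrt (r ^+ 2 - (x - a.1) ^+ 2))%R then
    (a.2 + Num.sqrt (r ^+ 2 - (x - a.1) ^+ 2))%:E -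
    (a.2 - Num.sqrt (r ^+ 2 - (x - a.1) ^+ 2))%:E else 0) =
   (2 * Num.sqrt (r ^+ 2 - (x - a.1) ^+ 2))%:E)%E.
  set s := Num.sqrt _.
  have s0 : 0 <= s by exact: sqrtr_ge0.
  case: ifPn => H.
    rewrite -EFinB; congr (_%:E); lra.
  have -> : s = 0; last by rewrite mulr0.
  apply/eqP; rewrite eq_le s0 andbT; move: H; rewrite -leNgt.
  by move=> H; lra.
rewrite patchE; case: ifPn => //.
rewrite notin_setE/= in_itv/= => /negP; rewrite -ler_distlC -ltNge => H.
rewrite ler0_sqrtr ?mulr0// subr_le0 -real_normK ?num_real//.
rewrite -[leRHS]real_normK ?num_real// distrC ler_pXn2r ?nnegrE// gtr0_norm//.
exact: ltW.
Qed.

(** The image of [K] is closed and misses 0, hence misses a ball around 0. Unlike an attained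
    minimum, this argument includes the empty [K]. *)
Lemma compact_pos_lbound (T : topologicalType) (K : set T) (g : T -> R) :
  compact K -> continuous g -> (forall x, K x -> 0 < g x) ->
  exists2 m, 0 < m & forall x, K x -> m <= g x.
Proof.
move=> cK cg gpos.
have cgK : compact (g @` K).
  by apply: continuous_compact => //; exact: continuous_subspaceT.
have clgK : closed (g @` K) by apply: compact_closed cgK; exact: Rhausdorff.
have : nbhs (0 : R) (~` (g @` K)).
  apply: open_nbhs_nbhs; split; first exact: closed_openC.
  by move=> [x Kx gx]; have := gpos x Kx; rewrite gx ltxx.
rewrite -nbhs_ballE => -[e /= e0 eU]; exists e => // x Kx.
rewrite leNgt; apply/negP => gxe.
apply: (eU (g x)); last by exists x.
by rewrite /ball/= sub0r normrN gtr0_norm ?gpos.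
Qed.

(** Pairs of points at squared distance at least [e] form a compact set, on which the squared
    distance of the images is continuous and, by injectivity, positive. In contrapositive form,
    points with close images are close; this is how injectivity enters the packing. *)
Lemma injective_separated (q1 q2 : R * R -> R) (a b c d e : R) :
  continuous q1 -> continuous q2 -> 0 < e ->
  (forall p p', (`[a, b] `*` `[c, d]) p -> (`[a, b] `*` `[c, d]) p' ->
    q1 p = q1 p' -> q2 p = q2 p' -> p = p') ->
  exists2 m, 0 < m & forall p p',
    (`[a, b] `*` `[c, d]) p -> (`[a, b] `*` `[c, d]) p' ->
    e <= (p.1 - p'.1) ^+ 2 + (p.2 - p'.2) ^+ 2 ->
    m <= (q1 p - q1 p') ^+ 2 + (q2 p - q2 p') ^+ 2.
Proof.
move=> c1 c2 e0 inj.
pose Q : set (R * R) := `[a, b] `*` `[c, d].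
have cQ : compact Q by apply: compact_setX; exact: segment_compact.
have cf1 : continuous (fun z : (R * R) * (R * R) => z.1) by move=> ?; exact: cvg_fst.
have cf2 : continuous (fun z : (R * R) * (R * R) => z.2) by move=> ?; exact: cvg_snd.
have cc (f : R * R -> R) : continuous f ->
    continuous (fun z : (R * R) * (R * R) => f z.1) /\
    continuous (fun z : (R * R) * (R * R) => f z.2).
  move=> cf; split => z; apply: continuous_comp; try exact: cf.
  - exact: cf1.
  - exact: cf2.
pose dd := fun z : (R * R) * (R * R) => (z.1.1 - z.2.1) ^+ 2 + (z.1.2 - z.2.2) ^+ 2.
have cdd : continuous dd.
  by apply: continuous_sqdist; [exact: (cc _ continuous_fst).1|
    exact: (cc _ continuous_fst).2|exact: (cc _ continuous_snd).1|
    exact: (cc _ continuous_snd).2].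
pose K := (Q `*` Q) `&` (dd @^-1` [set x | e <= x]).
have cK : compact K.
  apply: compact_closedI; first exact: compact_setX.
  by move/continuous_closedP: cdd; apply; exact: closed_ge.
have [||m m0 Hm] := @compact_pos_lbound _ K
  (fun z => (q1 z.1 - q1 z.2) ^+ 2 + (q2 z.1 - q2 z.2) ^+ 2) cK.
- by apply: continuous_sqdist; [exact: (cc _ c1).1|exact: (cc _ c1).2|
    exact: (cc _ c2).1|exact: (cc _ c2).2].
- move=> [p p'] [[/= Qp Qp']] /= epp'.
  rewrite lt_neqAle addr_ge0 ?sqr_ge0// andbT eq_sym; apply/eqP => /eqP.
  rewrite paddr_eq0 ?sqr_ge0// !sqrf_eq0 !subr_eq0 => /andP[/eqP h1 /eqP h2].
  have E := inj p p' Qp Qp' h1 h2; move: epp'.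
  by rewrite /dd/= E !subrr expr0n/= addr0 leNgt e0.
exists m => // p p' Qp Qp' epp'; by apply: (Hm (p, p')); split.
Qed.

End discs.

(** * Continuity and the fundamental theorem of calculus in epsilon-delta form *)

Section epsilon_delta.
Context {R : realType}.
Local Notation mu := (@lebesgue_measure R).

Lemma continuous_eps (f : R -> R) (x : R) :
  (forall e : R, 0 < e -> exists2 d : R, 0 < d &
    forall y, `|y - x| < d -> `|f y - f x| < e) ->
  {for x, continuous f}.
Proof.
move=> H; apply/cvgrPdist_lt => e /H [d d0 Hd].
exists d => // y /= xy; rewrite distrC; apply: Hd.
by rewrite distrC.
Qed.

Lemma continuous_plane_eps (f : R * R -> R) :
  (forall x y (e : R), 0 < e -> exists2 d : R, 0 < d &
    forall u v, `|u - x| < d -> `|v - y| < d -> `|f (u, v) - f (x, y)| < e) ->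
  continuous f.
Proof.
move=> H [x y]; apply/cvgrPdist_lt => e /(H x y) [d d0 Hd].
exists (ball x d, ball y d) => /=; first by split; exact: nbhsx_ballx.
move=> [u v] [/= bu bv].
by rewrite distrC; apply: Hd; rewrite distrC.
Qed.

Lemma continuous_FTC2_eps (f F : R -> R) (a b : R) : a < b ->
  (forall x (e : R), 0 < e -> exists2 d : R, 0 < d &
    forall y, `|y - x| < d -> `|f y - f x| < e) ->
  (forall x (e : R), 0 < e -> exists2 d : R, 0 < d &
    forall h : R, h != 0 -> `|h| < d -> `|(F (x + h) - F x) / h - f x| < e) ->
  (\int[mu]_(x in `[a, b]) (f x)%:E = (F b - F a)%:E)%E.
Proof.
move=> ab cf dF.
have idF (x : R) : is_derive x (1 : R) F (f x).
  suff H : h^-1 *: (F (h *: 1 + x) - F x) @[h --> 0^'] --> f x.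
    by split; [apply/cvg_ex; exists (f x)|exact/cvg_lim].
  apply/cvgrPdist_lt => e /(dF x) [d d0 Hd].
  exists d => // h /=; rewrite sub0r normrN => hd h0.
  rewrite distrC; have := Hd h h0 hd.
  rewrite [h *: 1]mulr1 [h + x]addrC.
  by rewrite [_ / h]mulrC.
have dF' (x : R) : derivable F x 1 by case: (idF x).
rewrite (@continuous_FTC2 _ f F a b ab).
- by rewrite EFinB.
- by apply: continuous_subspaceT => x; apply: continuous_eps => e; exact: cf.
- split => //.
  + apply: cvg_at_right_filter; apply: differentiable_continuous.
    exact/derivable1_diffP.
  + apply: cvg_at_left_filter; apply: differentiable_continuous.
    exact/derivable1_diffP.
- by move=> x _; rewrite derive1E; case: (idF x).
Qed.

End epsilon_delta.

(** * The packing inequality for a map of the plane *)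

Section packing.
Context {R : realType}.
Local Notation mu := (@lebesgue_measure R).
Local Notation T := (measurableTypeR R * measurableTypeR R)%type.
Local Notation pi2 := (@plane_measure R).

(** The incidences are the pairs of a point [p] and a point [w] at distance less than [delta] from
    its image. A slice at [p] is a disc of radius [delta]; a slice at [w] is assumed to fit in a
    disc of radius [r]. Both areas carry the factor [kappa], which cancels at the end. The margin
    [delta] in the bound on [q1], [q2] keeps all such [w] in the box. *)
Lemma plane_double_counting (kappa : R) (q1 q2 J chi g : R * R -> R)
    (a b c d N delta k' : R) :
  0 < kappa ->
  (forall w r, 0 < r -> pi2 (open_disc w r) = (kappa * r ^+ 2)%:E) ->
  continuous q1 -> continuous q2 -> continuous J -> continuous chi ->
  continuous g -> (forall p, 0 <= J p) -> (forall w, 0 <= chi w) ->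
  0 < delta -> 0 <= k' ->
  (forall p, (`[a, b] `*` `[c, d]) p -> g p <= 0 -> J p = 0) ->
  (forall p, (`[a, b] `*` `[c, d]) p ->
     `|q1 p| <= N - delta /\ `|q2 p| <= N - delta) ->
  (forall w, (`[- N, N] `*` `[- N, N]) w -> exists j r p1, [/\ 0 <= j, 0 < r,
     j * r ^+ 2 <= k' * chi w & forall p, (`[a, b] `*` `[c, d]) p -> 0 < g p ->
     open_disc (q1 p, q2 p) delta w -> open_disc p1 r p /\ J p <= j]) ->
  ((delta ^+ 2)%:E *
     \int[mu]_(x in `[a, b]) \int[mu]_(y in `[c, d]) (J (x, y))%:E <=
   k'%:E *
     \int[mu]_(x in `[(- N)%R, N]) \int[mu]_(y in `[(- N)%R, N]) (chi (x, y))%:E)%E.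
Proof.
move=> kap0 Hkap cq1 cq2 cJ cchi cg J0 chi0 delta0 k'0 Jg qN HW.
set Q : set T := `[a, b] `*` `[c, d] in Jg qN HW *.
set B : set T := `[- N, N] `*` `[- N, N] in HW *.
have mQ : measurable Q by apply: measurableX; exact: measurable_itv.
have mB : measurable B by apply: measurableX; exact: measurable_itv.
have mg := continuous_plane_measurable cg.
have mq1 := continuous_plane_measurable cq1.
have mq2 := continuous_plane_measurable cq2.
have mJ := continuous_plane_measurable cJ.
have mchi := continuous_plane_measurable cchi.
(* The local hypothesis controls only points with [0 < g p]; restricting to them keeps the integral,
   because [J] vanishes on the rest of the rectangle. *)
pose P : set T := Q `&` (g @^-1` `]0, +oo[%classic).
have mP : measurable P.
  apply: measurableI => //; rewrite -[X in measurable X]setTI.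
  by apply: mg; [exact: measurableT|exact: measurable_itv].
pose D : set (T * T) := [set z | open_disc (q1 z.1, q2 z.1) delta z.2].
have mD : measurable D.
  have -> : D = (fun z : T * T =>
      (z.2.1 - q1 z.1) ^+ 2 + (z.2.2 - q2 z.1) ^+ 2) @^-1` `]-oo, delta ^+ 2[%classic.
    by apply/seteqP; split => z; rewrite /D /open_disc/= in_itv.
  rewrite -[X in measurable X]setTI.
  have m11 : measurable_fun setT (fun z : T * T => q1 z.1).
    exact: (measurableT_comp mq1 measurable_fst).
  have m12 : measurable_fun setT (fun z : T * T => q2 z.1).
    exact: (measurableT_comp mq2 measurable_fst).
  have m21 : measurable_fun setT (fun z : T * T => z.2.1).
    exact: (measurableT_comp measurable_fst measurable_snd).
  have m22 : measurable_fun setT (fun z : T * T => z.2.2).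
    exact: (measurableT_comp measurable_snd measurable_snd).
  have mm : measurable_fun setT (fun z : T * T =>
      (z.2.1 - q1 z.1) ^+ 2 + (z.2.2 - q2 z.1) ^+ 2).
    by apply: measurable_funD; apply: measurable_funX; apply: measurable_funB.
  by apply: mm; [exact: measurableT|exact: measurable_itv].
have k0 : 0 <= kappa * delta ^+ 2 by rewrite mulr_ge0 ?sqr_ge0// ltW.
have H : ((kappa * delta ^+ 2)%:E * \int[pi2]_(p in P) (J p)%:E <=
  \int[pi2]_(w in B) (kappa * k' * chi w)%:E)%E.
  apply: (@double_counting _ _ T T R pi2 pi2 P B D J chi _ _
    mP mB mD mJ mchi J0 chi0 k0).
  - move=> p Pp; rewrite -(Hkap (q1 p, q2 p))//.
    rewrite (_ : xsection D p = open_disc (q1 p, q2 p) delta)//.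
    by apply/seteqP; split => w; rewrite /xsection/= inE.
  - move=> p [u v] [Qp _]; rewrite /D/= /open_disc/= => Hd.
    have [h1 h2] := qN p Qp.
    have e1 : `|u - q1 p| < delta.
      rewrite -(@ltr_pXn2r _ 2) ?nnegrE ?(ltW delta0)// real_normK ?num_real//.
      by apply: le_lt_trans Hd; rewrite lerDl sqr_ge0.
    have e2 : `|v - q2 p| < delta.
      rewrite -(@ltr_pXn2r _ 2) ?nnegrE ?(ltW delta0)// real_normK ?num_real//.
      by apply: le_lt_trans Hd; rewrite lerDr sqr_ge0.
    move: h1 h2 e1 e2; rewrite !ler_norml !ltr_norml => /andP[? ?] /andP[? ?] /andP[? ?] /andP[? ?].
    by split; rewrite /= in_itv/=; apply/andP; split; lra.
  - move=> w Bw; have [j [r [p1 [j0 r0 jr Hp]]]] := HW w Bw.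
    exists j, (kappa * r ^+ 2); split => //.
    + by rewrite mulrCA -[leRHS]mulrA ler_pM2l.
    + rewrite -(Hkap p1 r r0); apply: le_measure; rewrite ?inE//.
      * by apply: measurableI => //; exact: measurable_ysection.
      * exact: measurable_disc.
      * move=> p [] ; rewrite /ysection/= inE => Dp [Qp].
        rewrite /= in_itv/= andbT => gp.
        exact: (Hp p Qp gp Dp).1.
    + move=> p [Qp]; rewrite /= in_itv/= andbT => gp Dp.
      exact: (Hp p Qp gp Dp).2.
have EP : (\int[pi2]_(p in P) (J p)%:E = \int[pi2]_(p in Q) (J p)%:E)%E.
  rewrite integral_mkcond [RHS]integral_mkcond; apply: eq_integral => p _.
  rewrite !patchE; case: (boolP (p \in Q)) => pQ; last first.
    case: ifPn => //; rewrite inE => -[Qp _].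
    by move: pQ; rewrite notin_setE.
  case: ifPn => //; rewrite notin_setE => nP; rewrite Jg//.
  + by rewrite inE in pQ.
  + rewrite leNgt; apply/negP => gp; apply: nP; split; first by rewrite inE in pQ.
    by rewrite /= in_itv/= andbT.
move: H; rewrite EP.
have -> : (\int[pi2]_(w in B) (kappa * k' * chi w)%:E =
  (kappa * k')%:E * \int[pi2]_(w in B) (chi w)%:E)%E.
  rewrite -ge0_integralZl//.
  + by apply/measurable_EFinP; exact: measurable_funTS.
  + by move=> w _; rewrite lee_fin.
  + by rewrite lee_fin mulr_ge0// ltW.
rewrite !plane_integral_rect// !EFinM -!muleA.
by rewrite lee_pmul2l// lte_fin.
Qed.

End packing.

Import Stdlib.Reals.Reals Riemann.

(** * Translation into Riemann integrals *)

Section stdlib_reals.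
Local Notation RR := (Rdefinitions.R).
Local Notation mu := (@lebesgue_measure RR).
Local Notation pi2 := (@plane_measure RR).
Local Notation RInt := (@Coquelicot.RInt.RInt Coquelicot.Hierarchy.R_CompleteNormedModule).
Local Notation cont := (@Coquelicot.Continuity.continuous Coquelicot.Hierarchy.R_UniformSpace Coquelicot.Hierarchy.R_UniformSpace).
Local Notation cont2 := Coquelicot.Continuity.continuity_2d_pt.

(** The Riemann primitive of [f] is an antiderivative, so the fundamental theorem for the Lebesgue
    integral yields its increment. *)
Lemma lebesgue_RInt (f : RR -> RR) (a b : RR) : Rlt a b ->
  (forall x, cont f x) ->
  (\int[mu]_(x in `[a, b]) (f x)%:E = (RInt f a b)%:E)%E.
Proof.
move=> /RltP ab cf.
rewrite (@continuous_FTC2_eps _ f (fun t => RInt f a t) a b ab).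
- by rewrite Coquelicot.RInt.RInt_point; congr (_%:E); exact: subr0.
- move=> x e /RltP e0; have [d [d0 Hd]] := continuous_epsilon f x e (cf x) e0.
  exists d; first exact/RltP.
  by move=> y /RltP yx; apply/RltP; exact: (Hd y yx).
- move=> x e /RltP e0; have [d [d0 Hd]] := is_derive_RInt_epsilon f a x e cf e0.
  exists d; first exact/RltP.
  by move=> h /eqP h0 /RltP hd; apply/RltP; exact: (Hd h h0 hd).
Qed.

Lemma continuous_plane_of_2d (f : RR -> RR -> RR) :
  (forall x y, cont2 f x y) -> continuous (fun p : RR * RR => f p.1 p.2).
Proof.
move=> cf; apply: continuous_plane_eps => x y e /RltP e0.
have [d Hd] := cf x y (mkposreal e e0).
exists (pos d); first by apply/RltP; case: d {Hd}.
by move=> u v /RltP ux /RltP vy; apply/RltP; exact: (Hd u v ux vy).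
Qed.

Lemma iterated_RInt (f : RR -> RR -> RR) (a b c d : RR) :
  Rlt a b -> Rlt c d -> (forall x y, cont2 f x y) ->
  (\int[mu]_(x in `[a, b]) \int[mu]_(y in `[c, d]) (f x y)%:E =
   (RInt (fun x => RInt (f x) c d) a b)%:E)%E.
Proof.
move=> ab cd cf.
rewrite -lebesgue_RInt//; last first.
  by move=> x; apply: continuous_RInt_param_everywhere => //; exact: Rlt_le.
apply: eq_integral => x _; apply: lebesgue_RInt => // y.
exact: continuity_2d_pt_section_r.
Qed.

Lemma injective_separated_R (q1 q2 : RR -> RR -> RR) (a b c d e : RR) :
  (forall x y, cont2 q1 x y) -> (forall x y, cont2 q2 x y) -> Rlt 0 e ->
  (forall x y u v, Rle a x /\ Rle x b -> Rle c y /\ Rle y d ->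
     Rle a u /\ Rle u b -> Rle c v /\ Rle v d ->
     q1 x y = q1 u v -> q2 x y = q2 u v -> x = u /\ y = v) ->
  exists m : RR, Rlt 0 m /\
    forall x y u v, Rle a x /\ Rle x b -> Rle c y /\ Rle y d ->
     Rle a u /\ Rle u b -> Rle c v /\ Rle v d ->
     Rle e ((x - u) ^ 2 + (y - v) ^ 2)%coqR ->
     Rle m ((q1 x y - q1 u v) ^ 2 + (q2 x y - q2 u v) ^ 2)%coqR.
Proof.
move=> c1 c2 /RltP e0 inj.
have I (s t z : RR) : (z \in `[s, t]) = true -> Rle s z /\ Rle z t.
  by rewrite in_itv/= => /andP[/RleP ? /RleP ?].
have I' (s t z : RR) : Rle s z /\ Rle z t -> z \in `[s, t].
  by move=> [/RleP h1 /RleP h2]; rewrite in_itv/= h1 h2.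
have [|m m0 Hm] := injective_separated (a := a) (b := b) (c := c) (d := d)
  (continuous_plane_of_2d c1) (continuous_plane_of_2d c2) e0.
  move=> [x y] [u v] [/= /I h1 /I h2] [/= /I h3 /I h4] E1 E2.
  by have [-> ->] := inj _ _ _ _ h1 h2 h3 h4 E1 E2.
exists m; split; first exact/RltP.
move=> x y u v /I' h1 /I' h2 /I' h3 /I' h4; rewrite !RpowE => /RleP H; apply/RleP.
exact: (Hm (x, y) (u, v) (conj h1 h2) (conj h3 h4)).
Qed.

Lemma disc_measure_R (w : RR * RR) (r : RR) : 0 < r ->
  pi2 (open_disc w r) = (unit_disc_area * r ^+ 2)%:E.
Proof.
move=> r0; rewrite disc_measure//.
have <- : RInt (fun x => Rmult 2 (sqrt (r ^ 2 - (x - w.1) ^ 2)%coqR))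
    (w.1 - r)%coqR (w.1 + r)%coqR = unit_disc_area * r ^+ 2.
  by rewrite -RpowE; apply: RInt_chord; exact/RltP.
rewrite -lebesgue_RInt.
- by apply: eq_integral => x _; rewrite -RsqrtE !RpowE.
- by apply/RltP; rewrite ltrD2l gtrN.
- by move=> x; exact: continuous_chord.
Qed.

Lemma plane_double_counting_R (q1 q2 J chi g : RR -> RR -> RR)
    (a b c d N delta k : RR) :
  (forall x y, cont2 q1 x y) -> (forall x y, cont2 q2 x y) ->
  (forall x y, cont2 J x y) -> (forall x y, cont2 chi x y) ->
  (forall x y, cont2 g x y) ->
  (forall x y, Rle 0 (J x y)) -> (forall x y, Rle 0 (chi x y)) ->
  Rlt a b -> Rlt c d -> Rlt 0 delta -> Rlt 0 N -> Rle 0 k ->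
  (forall x y, Rle a x /\ Rle x b -> Rle c y /\ Rle y d ->
     Rle (g x y) 0 -> J x y = 0%coqR) ->
  (forall x y, Rle a x /\ Rle x b -> Rle c y /\ Rle y d ->
     Rle (Rabs (q1 x y)) (N - delta)%coqR /\ Rle (Rabs (q2 x y)) (N - delta)%coqR) ->
  (forall u v : RR, exists j r x1 y1 : RR, Rle 0 j /\ Rlt 0 r /\
     Rle (j * r ^ 2)%coqR (k * chi u v)%coqR /\
     forall x y, Rle a x /\ Rle x b -> Rle c y /\ Rle y d -> Rlt 0 (g x y) ->
       Rlt ((u - q1 x y) ^ 2 + (v - q2 x y) ^ 2)%coqR (delta ^ 2)%coqR ->
       Rlt ((x - x1) ^ 2 + (y - y1) ^ 2)%coqR (r ^ 2)%coqR /\ Rle (J x y) j) ->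
  Rle (delta ^ 2 * RInt (fun x => RInt (J x) c d) a b)%coqR
      (k * RInt (fun u => RInt (chi u) (- N)%coqR N) (- N)%coqR N)%coqR.
Proof.
move=> c1 c2 cJ cchi cg J0 chi0 ab cd delta0 N0 k0 Jg qN HW.
have I (s t z : RR) : (z \in `[s, t]) = true -> Rle s z /\ Rle z t.
  by rewrite in_itv/= => /andP[/RleP ? /RleP ?].
have NN : Rlt (- N)%coqR N by Stdlib.micromega.Lra.lra.
rewrite RpowE; have := @plane_double_counting _ unit_disc_area (fun p => q1 p.1 p.2)
  (fun p => q2 p.1 p.2) (fun p => J p.1 p.2) (fun p => chi p.1 p.2)
  (fun p => g p.1 p.2) a b c d N delta k.
rewrite /= (iterated_RInt ab cd cJ) (iterated_RInt NN NN cchi).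
rewrite -!EFinM lee_fin => H; apply/RleP; apply: H.
- exact/RltP/unit_disc_area_pos.
- exact: disc_measure_R.
- exact: continuous_plane_of_2d.
- exact: continuous_plane_of_2d.
- exact: continuous_plane_of_2d.
- exact: continuous_plane_of_2d.
- exact: continuous_plane_of_2d.
- by move=> p; exact/RleP.
- by move=> p; exact/RleP.
- exact/RltP.
- exact/RleP.
- by move=> [x y] [/= /I hx /I hy] /RleP; exact: Jg.
- move=> [x y] [/= /I hx /I hy]; have [/RleP h1 /RleP h2] := qN _ _ hx hy.
  by split.
- move=> [u v] _; have [j [r [x1 [y1 [j0 [r0 [jr Hp]]]]]]] := HW u v.
  exists j, r, (x1, y1); split.
  + exact/RleP.
  + exact/RltP.
  + by apply/RleP; rewrite -RpowE.
  + move=> [x y] [/= /I hx /I hy] /RltP gp; rewrite /open_disc/= -!RpowE => /RltP Hd.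
    have [/RltP h1 /RleP h2] := Hp _ _ hx hy gp Hd.
    by split => //; rewrite -!RpowE.
Qed.
End stdlib_reals.

End Lebesgue.

(** * Complex differentiation with explicit constants *)

Import Stdlib.Reals.Reals Stdlib.micromega.Lra Stdlib.micromega.Lia.
Import Stdlib.micromega.Psatz Stdlib.Logic.Classical.
Import Coquelicot.Coquelicot Riemann.
Open Scope R_scope.

(* The quadratic remainder (rather than o(h)) lets explicit constants compose in
   sums, products and inverses. *)
Definition cderiv (f : C -> C) (z l : C) : Prop :=
  exists K d : R, 0 <= K /\ 0 < d <= 1 /\ forall h : C, Cmod h < d ->
    Cmod (f (z + h) - f z - l * h)%C <= K * Cmod h ^ 2.

(** The form in which limits are taken below: a fixed quantity bounded by [K * t] for all small [t].
    It serves the radius of the packing discs, the truncation level and the uniqueness of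
    derivatives alike. *)
Lemma nonpos_of_small_linear_bound (x K d : R) : 0 <= K -> 0 < d ->
  (forall t, 0 < t < d -> x <= K * t) -> x <= 0.
Proof.
  intros HK Hd H. apply Rnot_lt_le. intros Hx.
  assert (P : 0 < x / (K + 1)) by (apply Rdiv_lt_0_compat; lra).
  assert (P2 : 0 < Rmin d (x / (K + 1))) by now apply Rmin_glb_lt.
  assert (Q1 := Rmin_l d (x / (K + 1))). assert (Q2 := Rmin_r d (x / (K + 1))).
  set (t := Rmin d (x / (K + 1)) / 2).
  assert (T := H t ltac:(unfold t; lra)).
  assert ((K + 1) * t < (K + 1) * (x / (K + 1))) by (apply Rmult_lt_compat_l; unfold t; lra).
  replace ((K + 1) * (x / (K + 1))) with x in * by (field; lra).
  unfold t in *. lra.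
Qed.

Lemma Cmod_minus_triangle (x y : C) : Cmod (x - y) <= Cmod x + Cmod y.
Proof.
  unfold Cminus. rewrite <- (Cmod_opp y). apply Cmod_triangle.
Qed.

Lemma Cmod_rev_triangle (x y : C) : Cmod x - Cmod y <= Cmod (x - y).
Proof.
  generalize (Cmod_triangle (x - y) y). replace (x - y + y)%C with x by ring. lra.
Qed.

Lemma cderiv_ext_disk (f g : C -> C) (z l : C) :
  (forall x, Cmod x < 1 -> f x = g x) -> Cmod z < 1 -> cderiv f z l -> cderiv g z l.
Proof.
  intros E Hz (K & d & HK & Hd & H).
  exists K, (Rmin d (1 - Cmod z)). split; [exact HK|].
  assert (H1 := Rmin_l d (1 - Cmod z)). assert (H2 := Rmin_r d (1 - Cmod z)).
  split.
  - split; [|lra]. apply Rmin_glb_lt; lra.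
  - intros h Hh. rewrite <- !E; [apply H; lra| exact Hz |].
    eapply Rle_lt_trans; [apply Cmod_triangle|]. lra.
Qed.

Lemma cderiv_const (c z : C) : cderiv (fun _ => c) z 0.
Proof.
  exists 0, 1. repeat split; try lra. intros h _.
  replace (c - c - 0 * h)%C with (RtoC 0) by ring. rewrite Cmod_0. lra.
Qed.

Lemma cderiv_id (z : C) : cderiv (fun x => x) z 1.
Proof.
  exists 0, 1. repeat split; try lra. intros h _.
  replace (z + h - z - 1 * h)%C with (RtoC 0) by ring. rewrite Cmod_0. lra.
Qed.

Lemma cderiv_plus (f g : C -> C) (z l m : C) :
  cderiv f z l -> cderiv g z m -> cderiv (fun x => f x + g x)%C z (l + m)%C.
Proof.
  intros (K & d & HK & Hd & H) (K' & d' & HK' & Hd' & H').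
  exists (K + K'), (Rmin d d'). split; [lra|].
  assert (H1 := Rmin_l d d'). assert (H2 := Rmin_r d d').
  split; [split; [apply Rmin_glb_lt; lra|lra]|].
  intros h Hh.
  replace (f (z + h) + g (z + h) - (f z + g z) - (l + m) * h)%C
    with ((f (z + h) - f z - l * h) + (g (z + h) - g z - m * h))%C by ring.
  eapply Rle_trans; [apply Cmod_triangle|].
  generalize (H h ltac:(lra)) (H' h ltac:(lra)). nra.
Qed.

Lemma cderiv_mult (f g : C -> C) (z l m : C) :
  cderiv f z l -> cderiv g z m ->
  cderiv (fun x => f x * g x)%C z (l * g z + f z * m)%C.
Proof.
  intros (K & d & HK & Hd & H) (K' & d' & HK' & Hd' & H').
  (* As [Cmod h < 1], [B] bounds [g] at [z + h] and [B'] bounds the linear part [f z + l * h]. *)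
  set (B := Cmod (g z) + Cmod m + K'). set (B' := Cmod (f z) + Cmod l).
  assert (P1 := Cmod_ge_0 (g z)). assert (P2 := Cmod_ge_0 (f z)).
  assert (P3 := Cmod_ge_0 l). assert (P4 := Cmod_ge_0 m).
  exists (K * B + B' * K' + Cmod l * Cmod m), (Rmin d d'). split.
  { assert (0 <= K * B) by (apply Rmult_le_pos; unfold B; lra).
    assert (0 <= B' * K') by (apply Rmult_le_pos; unfold B'; lra).
    assert (0 <= Cmod l * Cmod m) by (apply Rmult_le_pos; lra). lra. }
  assert (H1 := Rmin_l d d'). assert (H2 := Rmin_r d d').
  split; [split; [apply Rmin_glb_lt; lra|lra]|].
  intros h Hh. assert (Ph := Cmod_ge_0 h).
  set (e1 := (f (z + h) - f z - l * h)%C).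
  set (e2 := (g (z + h) - g z - m * h)%C).
  assert (He1 : Cmod e1 <= K * Cmod h ^ 2) by (apply H; lra).
  assert (He2 : Cmod e2 <= K' * Cmod h ^ 2) by (apply H'; lra).
  replace (f (z + h) * g (z + h) - f z * g z - (l * g z + f z * m) * h)%C
    with (e1 * (g z + m * h + e2) + (f z + l * h) * e2 + l * m * (h * h))%C
    by (unfold e1, e2; ring).
  eapply Rle_trans; [apply Cmod_triangle|].
  assert (T1 : Cmod (l * m * (h * h)) = Cmod l * Cmod m * Cmod h ^ 2)
    by (rewrite !Cmod_mult; ring).
  assert (T2 : Cmod ((f z + l * h) * e2) <= B' * K' * Cmod h ^ 2).
  { rewrite Cmod_mult, Rmult_assoc. apply Rmult_le_compat; auto using Cmod_ge_0.
    eapply Rle_trans; [apply Cmod_triangle|]. rewrite Cmod_mult. unfold B'. nra. }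
  assert (T3 : Cmod (e1 * (g z + m * h + e2)) <= K * B * Cmod h ^ 2).
  { rewrite Cmod_mult. replace (K * B * Cmod h ^ 2) with (K * Cmod h ^ 2 * B) by ring.
    apply Rmult_le_compat; auto using Cmod_ge_0.
    eapply Rle_trans; [apply Cmod_triangle|].
    generalize (Cmod_triangle (g z) (m * h)). rewrite Cmod_mult. unfold B.
    assert (Cmod h ^ 2 <= 1) by nra. nra. }
  generalize (Cmod_triangle (e1 * (g z + m * h + e2)) ((f z + l * h) * e2)). lra.
Qed.

Lemma cderiv_continuous_bound (f : C -> C) (z l : C) : cderiv f z l ->
  exists K d : R, 0 <= K /\ 0 < d <= 1 /\ forall h : C, Cmod h < d ->
    Cmod (f (z + h) - f z)%C <= K * Cmod h.
Proof.
  intros (K & d & HK & Hd & H). assert (P3 := Cmod_ge_0 l).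
  exists (K + Cmod l), d. repeat split; try lra.
  intros h Hh. assert (Ph := Cmod_ge_0 h).
  replace (f (z + h) - f z)%C with ((f (z + h) - f z - l * h) + l * h)%C by ring.
  eapply Rle_trans; [apply Cmod_triangle|]. rewrite Cmod_mult.
  generalize (H h Hh). assert (Cmod h ^ 2 <= Cmod h) by nra. nra.
Qed.

Lemma cderiv_inv (f : C -> C) (z l : C) : f z <> 0 ->
  cderiv f z l -> cderiv (fun x => / f x)%C z (- l / (f z * f z))%C.
Proof.
  intros Hz Hf. destruct (cderiv_continuous_bound f z l Hf) as (M & d' & HM & Hd' & H').
  destruct Hf as (K & d & HK & Hd & H).
  assert (Pz : 0 < Cmod (f z)) by (apply Cmod_gt_0; exact Hz).
  assert (P3 := Cmod_ge_0 l).
  set (a := Cmod (f z)) in *.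
  (* The last radius keeps the modulus of [f (z + h)] above [a / 2], so that the denominator of the
     remainder is at least [a ^ 3 / 2]. *)
  exists ((K * a + Cmod l * M) * 2 / a ^ 3), (Rmin (Rmin d d') (a / (2 * (M + 1)))).
  assert (Ppos : 0 < a ^ 3) by (apply pow_lt; lra).
  assert (Pq : 0 < a / (2 * (M + 1))) by (apply Rdiv_lt_0_compat; lra).
  split.
  { apply Rmult_le_pos; [|left; apply Rinv_0_lt_compat; lra].
    assert (0 <= K * a) by nra. assert (0 <= Cmod l * M) by nra. lra. }
  assert (H1 := Rmin_l (Rmin d d') (a / (2 * (M + 1)))).
  assert (H2 := Rmin_r (Rmin d d') (a / (2 * (M + 1)))).
  assert (H3 := Rmin_l d d'). assert (H4 := Rmin_r d d').
  split; [split; [repeat apply Rmin_glb_lt; lra|lra]|].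
  intros h Hh. assert (Ph := Cmod_ge_0 h).
  assert (HF : Cmod (f (z + h)%C - f z) <= M * Cmod h) by (apply H'; lra).
  assert (Hsm : M * Cmod h <= a / 2).
  { assert (Cmod h * (2 * (M + 1)) <= a).
    { apply Rle_trans with (a / (2 * (M + 1)) * (2 * (M + 1))).
      - apply Rmult_le_compat_r; lra.
      - right. field. lra. }
    nra. }
  assert (HFa : a / 2 <= Cmod (f (z + h)%C)).
  { generalize (Cmod_rev_triangle (f z) (f z - f (z + h)%C)%C).
    replace (f z - (f z - f (z + h)))%C with (f (z + h)%C) by ring.
    replace (f z - f (z + h))%C with (- (f (z + h) - f z))%C by ring.
    rewrite Cmod_opp. fold a. lra. }
  assert (HFn : f (z + h)%C <> 0) by (apply Cmod_gt_0; lra).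
  set (F := f (z + h)%C) in *. set (e := (F - f z - l * h)%C).
  assert (He : Cmod e <= K * Cmod h ^ 2) by (apply H; lra).
  replace (/ F - / f z - - l / (f z * f z) * h)%C
    with ((l * h * (F - f z) - e * f z) / (f z * f z * F))%C
    by (unfold e; field; split; assumption).
  rewrite Cmod_div by (repeat apply Cmult_neq_0; assumption).
  rewrite !Cmod_mult. fold a.
  assert (Hnum : Cmod (l * h * (F - f z) - e * f z) <= (K * a + Cmod l * M) * Cmod h ^ 2).
  { eapply Rle_trans; [apply Cmod_minus_triangle|]. rewrite !Cmod_mult. fold a.
    assert (Cmod l * Cmod h * Cmod (F - f z) <= Cmod l * Cmod h * (M * Cmod h)).
    { apply Rmult_le_compat_l; [nra|exact HF]. }
    assert (Cmod e * a <= K * Cmod h ^ 2 * a) by (apply Rmult_le_compat_r; lra).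
    nra. }
  assert (HN := Cmod_ge_0 (l * h * (F - f z) - e * f z)).
  unfold Rdiv.
  apply Rle_trans with ((K * a + Cmod l * M) * Cmod h ^ 2 * / (a * a * (a / 2))).
  - apply Rmult_le_compat; auto.
    + left. apply Rinv_0_lt_compat. nra.
    + apply Rinv_le_contravar; nra.
  - right. field. lra.
Qed.

(** * Absolutely convergent complex series *)

Lemma is_series_C_iff (u : nat -> C) (l : C) :
  is_series (K := C_AbsRing) (V := C_NormedModule) u l <->
  is_series (fun n => fst (u n)) (fst l) /\ is_series (fun n => snd (u n)) (snd l).
Proof.
  assert (E : forall n, sum_n (G := C_NormedModule) u n =
    (sum_n (fun n => fst (u n)) n, sum_n (fun n => snd (u n)) n)).
  { induction n as [|n IH].
    - rewrite !sum_O. now destruct (u 0%nat).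
    - rewrite !sum_Sn, IH. reflexivity. }
  unfold is_series. split.
  - intros H. split; apply filterlim_locally; intros eps;
      assert (H' := proj1 (filterlim_locally _ _) H eps);
      revert H'; apply filter_imp; intros n; rewrite E; now intros [H1 H2].
  - intros [H1 H2]. apply filterlim_locally; intros eps.
    assert (H1' := proj1 (filterlim_locally _ _) H1 eps).
    assert (H2' := proj1 (filterlim_locally _ _) H2 eps).
    generalize (filter_and _ _ H1' H2'). apply filter_imp. intros n Hn. rewrite E.
    exact Hn.
Qed.

Definition csum (u : nat -> C) : C :=
  (Series (fun n => fst (u n)), Series (fun n => snd (u n))).

Definition abs_summable (u : nat -> C) : Prop := ex_series (fun n => Cmod (u n)).

Lemma Rabs_fst_le_Cmod (z : C) : Rabs (fst z) <= Cmod z.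
Proof. eapply Rle_trans; [apply Rmax_l|apply Rmax_Cmod]. Qed.

Lemma Rabs_snd_le_Cmod (z : C) : Rabs (snd z) <= Cmod z.
Proof. eapply Rle_trans; [apply Rmax_r|apply Rmax_Cmod]. Qed.

Lemma Cmod_le_sum (z : C) : Cmod z <= Rabs (fst z) + Rabs (snd z).
Proof.
  destruct z as [x y]. simpl.
  replace (x, y) with (RtoC x + Ci * RtoC y)%C
    by (unfold Cplus, Cmult, RtoC, Ci; simpl; f_equal; ring).
  eapply Rle_trans; [apply Cmod_triangle|].
  rewrite Cmod_mult, Cmod_Ci, !Cmod_R. lra.
Qed.

Lemma abs_summable_fst (u : nat -> C) :
  abs_summable u -> ex_series (fun n => Rabs (fst (u n))).
Proof.
  intros H. apply (ex_series_le (V := R_CompleteNormedModule) _ (fun n => Cmod (u n))); auto.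
  intros n. unfold norm; simpl. unfold abs; simpl. rewrite Rabs_Rabsolu. apply Rabs_fst_le_Cmod.
Qed.

Lemma abs_summable_snd (u : nat -> C) :
  abs_summable u -> ex_series (fun n => Rabs (snd (u n))).
Proof.
  intros H. apply (ex_series_le (V := R_CompleteNormedModule) _ (fun n => Cmod (u n))); auto.
  intros n. unfold norm; simpl. unfold abs; simpl. rewrite Rabs_Rabsolu. apply Rabs_snd_le_Cmod.
Qed.

Lemma csum_correct (u : nat -> C) : abs_summable u ->
  is_series (K := C_AbsRing) (V := C_NormedModule) u (csum u).
Proof.
  intros H. apply is_series_C_iff. split; apply Series_correct, ex_series_Rabs.
  - now apply abs_summable_fst.
  - now apply abs_summable_snd.
Qed.

Lemma csum_unique (u : nat -> C) (l : C) :
  is_series (K := C_AbsRing) (V := C_NormedModule) u l -> l = csum u.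
Proof.
  intros H. apply is_series_C_iff in H. destruct H as [H1 H2].
  unfold csum. rewrite (is_series_unique _ _ H1), (is_series_unique _ _ H2). now destruct l.
Qed.

Lemma csum_ext (u v : nat -> C) : (forall n, u n = v n) -> csum u = csum v.
Proof.
  intros H. unfold csum. f_equal; apply Series_ext; intros n; now rewrite H.
Qed.

Lemma abs_summable_scal (c : C) (u : nat -> C) :
  abs_summable u -> abs_summable (fun n => c * u n)%C.
Proof.
  intros H. unfold abs_summable.
  eapply ex_series_ext; [intros n; symmetry; apply Cmod_mult|].
  apply (ex_series_scal (V := R_NormedModule) (Cmod c) (fun n => Cmod (u n))). exact H.
Qed.

Lemma abs_summable_le (u : nat -> C) (b : nat -> R) :
  (forall n, Cmod (u n) <= b n) -> ex_series b -> abs_summable u.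
Proof.
  intros H Hb. apply (ex_series_le (V := R_CompleteNormedModule) _ b); auto.
  intros n. unfold norm; simpl. unfold abs; simpl.
  rewrite Rabs_pos_eq by apply Cmod_ge_0. apply H.
Qed.

Lemma csum_scal (c : C) (u : nat -> C) : abs_summable u ->
  csum (fun n => c * u n)%C = (c * csum u)%C.
Proof.
  intros H. symmetry. apply csum_unique.
  exact (is_series_scal_l (K := C_AbsRing) c u _ (csum_correct u H)).
Qed.

Lemma csum_minus (u v : nat -> C) : abs_summable u -> abs_summable v ->
  csum (fun n => u n - v n)%C = (csum u - csum v)%C.
Proof.
  intros Hu Hv. unfold csum, Cminus, Cplus, Copp. simpl.
  f_equal.
  - rewrite <- Series_opp, <- Series_plus; auto.
    + apply ex_series_Rabs, abs_summable_fst, Hu.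
    + apply (ex_series_opp (V := R_NormedModule)), ex_series_Rabs, abs_summable_fst, Hv.
  - rewrite <- Series_opp, <- Series_plus; auto.
    + apply ex_series_Rabs, abs_summable_snd, Hu.
    + apply (ex_series_opp (V := R_NormedModule)), ex_series_Rabs, abs_summable_snd, Hv.
Qed.

(** The factor 2 comes from bounding the two coordinates separately; it only enlarges constants
    whose size is immaterial. *)
Lemma Cmod_csum_le (u : nat -> C) (b : nat -> R) :
  (forall n, Cmod (u n) <= b n) -> ex_series b -> Cmod (csum u) <= 2 * Series b.
Proof.
  intros H Hb. assert (Hu := abs_summable_le u b H Hb).
  eapply Rle_trans; [apply Cmod_le_sum|]. unfold csum; simpl.
  assert (Rabs (Series (fun n => fst (u n))) <= Series b).
  { eapply Rle_trans; [apply Series_Rabs, abs_summable_fst, Hu|].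
    apply Series_le; auto. intros n. split; [apply Rabs_pos|].
    eapply Rle_trans; [apply Rabs_fst_le_Cmod|apply H]. }
  assert (Rabs (Series (fun n => snd (u n))) <= Series b).
  { eapply Rle_trans; [apply Series_Rabs, abs_summable_snd, Hu|].
    apply Series_le; auto. intros n. split; [apply Rabs_pos|].
    eapply Rle_trans; [apply Rabs_snd_le_Cmod|apply H]. }
  lra.
Qed.

Lemma csum_incr_1 (u : nat -> C) : abs_summable u ->
  csum u = (u 0%nat + csum (fun n => u (S n)))%C.
Proof.
  intros H. unfold csum, Cplus; simpl. f_equal.
  - apply Series_incr_1, ex_series_Rabs, abs_summable_fst, H.
  - apply Series_incr_1, ex_series_Rabs, abs_summable_snd, H.
Qed.

(** * Power series on the unit disc *)

Definition disk_seq (a : nat -> C) : Prop :=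
  forall r, 0 <= r < 1 -> exists M, forall n, Cmod (a n) * r ^ n <= M.

Definition ps (a : nat -> C) (z : C) : C := csum (fun n => a n * z ^ n)%C.

Definition cshift (a : nat -> C) (n : nat) : C := a (S n).

(** The coefficients of z f'(z), the derivative of f in the coordinate log z. *)
Definition nmul (a : nat -> C) (n : nat) : C := (RtoC (INR n) * a n)%C.

Definition cderive_seq (a : nat -> C) : nat -> C := cshift (nmul a).

Lemma disk_seq_summable (a : nat -> C) (r : R) : disk_seq a -> 0 <= r < 1 ->
  ex_series (fun n => Cmod (a n) * r ^ n).
Proof.
  intros H Hr. set (s := (1 + r) / 2). assert (Hs : r < s < 1) by (unfold s; lra).
  destruct (H s) as [M HM]; [lra|].
  apply (ex_series_le (V := R_CompleteNormedModule) _ (fun n => M * (r / s) ^ n)).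
  - intros n. unfold norm; simpl. unfold abs; simpl.
    assert (0 <= r ^ n) by (apply pow_le; lra).
    rewrite Rabs_pos_eq by (apply Rmult_le_pos; auto; apply Cmod_ge_0).
    replace (r ^ n) with (s ^ n * (r / s) ^ n)
      by (rewrite <- Rpow_mult_distr; f_equal; field; lra).
    rewrite <- Rmult_assoc. apply Rmult_le_compat_r; [|apply HM].
    apply pow_le. apply Rmult_le_pos; [lra|]. left. apply Rinv_0_lt_compat. lra.
  - apply (ex_series_scal (V := R_NormedModule) M (fun n => (r / s) ^ n)).
    apply ex_series_geom. rewrite Rabs_pos_eq.
    + apply Rmult_lt_reg_r with s; [lra|]. unfold Rdiv. rewrite Rmult_assoc, Rinv_l; lra.
    + apply Rmult_le_pos; [lra|]. left. apply Rinv_0_lt_compat. lra.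
Qed.

Lemma disk_seq_abs_summable (a : nat -> C) (z : C) : disk_seq a -> Cmod z < 1 ->
  abs_summable (fun n => a n * z ^ n)%C.
Proof.
  intros H Hz. apply abs_summable_le with (fun n => Cmod (a n) * Cmod z ^ n).
  - intros n. rewrite Cmod_mult, Cmod_pow. lra.
  - apply disk_seq_summable; auto. split; [apply Cmod_ge_0|exact Hz].
Qed.

Lemma disk_seq_shift (a : nat -> C) : disk_seq a -> disk_seq (cshift a).
Proof.
  intros H r Hr. set (s := (1 + r) / 2). assert (Hs : r < s < 1) by (unfold s; lra).
  destruct (H s) as [M HM]; [lra|]. exists (M / s). intros n. unfold cshift.
  apply Rmult_le_reg_r with s; [lra|].
  replace (M / s * s) with M by (field; lra).
  apply Rle_trans with (Cmod (a (S n)) * s ^ S n); [|apply HM].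
  simpl. rewrite Rmult_assoc. apply Rmult_le_compat_l; [apply Cmod_ge_0|].
  rewrite (Rmult_comm s). apply Rmult_le_compat_r; [lra|]. apply pow_incr. lra.
Qed.

(** Each of 1, q, ..., q^(n-1) is at least q^n, and their sum times 1 - q is 1 - q^n; this sharper
    bound is the one that goes through by induction. *)
Lemma linear_geom_bound (q : R) (n : nat) : 0 <= q < 1 -> INR n * (1 - q) * q ^ n <= 1.
Proof.
  intros Hq.
  assert (H : INR n * (1 - q) * q ^ n <= 1 - q ^ n).
  { induction n as [|n IH]; [simpl; lra|].
    rewrite S_INR. simpl pow.
    assert (0 <= q ^ n <= 1).
    { split; [apply pow_le; lra|]. rewrite <- (pow1 n). apply pow_incr. lra. }
    assert (q * (INR n * (1 - q) * q ^ n) <= q * (1 - q ^ n))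
      by (apply Rmult_le_compat_l; lra).
    assert (q * q ^ n <= 1) by nra.
    assert (q * q ^ n * (1 - q) <= 1 * (1 - q)) by (apply Rmult_le_compat_r; lra).
    lra. }
  assert (0 <= q ^ n) by (apply pow_le; lra). lra.
Qed.

Lemma disk_seq_nmul (a : nat -> C) : disk_seq a -> disk_seq (nmul a).
Proof.
  intros H r Hr. set (s := (1 + r) / 2). assert (Hs : r < s < 1) by (unfold s; lra).
  destruct (H s) as [M HM]; [lra|].
  assert (Hq : 0 <= r / s < 1).
  { split; [apply Rmult_le_pos; [lra|]; left; apply Rinv_0_lt_compat; lra|].
    apply Rmult_lt_reg_r with s; [lra|]. unfold Rdiv. rewrite Rmult_assoc, Rinv_l; lra. }
  exists (M / (1 - r / s)). intros n. unfold nmul.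
  rewrite Cmod_mult, Cmod_R, Rabs_pos_eq by apply pos_INR.
  replace (r ^ n) with (s ^ n * (r / s) ^ n)
    by (rewrite <- Rpow_mult_distr; f_equal; field; lra).
  apply Rmult_le_reg_r with (1 - r / s); [lra|].
  replace (M / (1 - r / s) * (1 - r / s)) with M
    by (unfold Rdiv at 1; rewrite Rmult_assoc, Rinv_l; lra).
  replace (INR n * Cmod (a n) * (s ^ n * (r / s) ^ n) * (1 - r / s))
    with (Cmod (a n) * s ^ n * (INR n * (1 - r / s) * (r / s) ^ n)) by ring.
  rewrite <- (Rmult_1_r M). apply Rmult_le_compat; auto.
  - apply Rmult_le_pos; [apply Cmod_ge_0|apply pow_le; lra].
  - apply Rmult_le_pos; [apply Rmult_le_pos; [apply pos_INR|lra]|apply pow_le; lra].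
  - now apply linear_geom_bound.
Qed.

Lemma disk_seq_derive (a : nat -> C) : disk_seq a -> disk_seq (cderive_seq a).
Proof. intros H. now apply disk_seq_shift, disk_seq_nmul. Qed.

Lemma ps_unfold (a : nat -> C) (z : C) : disk_seq a -> Cmod z < 1 ->
  ps a z = (a 0%nat + z * ps (cshift a) z)%C.
Proof.
  intros H Hz. unfold ps. rewrite csum_incr_1 by now apply disk_seq_abs_summable.
  f_equal; [simpl; ring|].
  rewrite <- csum_scal.
  - apply csum_ext. intros n. unfold cshift. simpl. ring.
  - apply disk_seq_abs_summable; auto. now apply disk_seq_shift.
Qed.

Lemma ps_bound (a : nat -> C) (r : R) : disk_seq a -> 0 <= r < 1 ->
  exists B, 0 <= B /\ forall z, Cmod z <= r -> Cmod (ps a z) <= B.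
Proof.
  intros H Hr. assert (Hs := disk_seq_summable a r H Hr).
  assert (Hb : forall z, Cmod z <= r ->
    Cmod (ps a z) <= 2 * Series (fun n => Cmod (a n) * r ^ n)).
  { intros z Hz. apply Cmod_csum_le; auto. intros n. rewrite Cmod_mult, Cmod_pow.
    apply Rmult_le_compat_l; [apply Cmod_ge_0|]. apply pow_incr.
    split; [apply Cmod_ge_0|exact Hz]. }
  exists (2 * Series (fun n => Cmod (a n) * r ^ n)). split; auto.
  eapply Rle_trans; [|apply (Hb 0%C); rewrite Cmod_0; lra]. apply Cmod_ge_0.
Qed.

(** Reindexed so that the series of f' can be combined term by term with that of f. The extra term
    at 0, where [pred 0 = 0], carries the factor [INR 0]. *)
Lemma ps_derive_eq (a : nat -> C) (z : C) : disk_seq a -> Cmod z < 1 ->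
  ps (cderive_seq a) z = csum (fun n => nmul a n * z ^ pred n)%C /\
  abs_summable (fun n => nmul a n * z ^ pred n)%C.
Proof.
  intros H Hz.
  assert (S' : abs_summable (fun n => nmul a n * z ^ pred n)%C).
  { apply (ex_series_incr_1 (V := R_NormedModule)).
    exact (disk_seq_abs_summable _ z (disk_seq_derive a H) Hz). }
  split; auto. rewrite csum_incr_1 by auto. unfold ps, cderive_seq, cshift, nmul.
  simpl pred. simpl INR at 2. ring.
Qed.

Definition pow_remainder (z w : C) (n : nat) : C :=
  (w ^ n - z ^ n - RtoC (INR n) * z ^ pred n * (w - z))%C.

(** The remainders satisfy R(n+1) = w R(n) + n z^(n-1) (w - z)^2, and n^2 + n <= (n+1)^2 closes the
    induction. The factor [r ^ 2] on the left avoids the exponent n - 2. *)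
Lemma pow_remainder_bound (z w : C) (r : R) (n : nat) :
  0 < r -> Cmod z <= r -> Cmod w <= r ->
  r ^ 2 * Cmod (pow_remainder z w n) <= INR n ^ 2 * r ^ n * Cmod (w - z) ^ 2.
Proof.
  intros Hr Hz Hw. induction n as [|n IH].
  - unfold pow_remainder. simpl.
    replace (1 - 1 - 0 * 1 * (w - z))%C with (RtoC 0) by ring. rewrite Cmod_0. lra.
  - assert (E : pow_remainder z w (S n) =
      (w * pow_remainder z w n + RtoC (INR n) * z ^ pred n * ((w - z) * (w - z)))%C).
    { unfold pow_remainder. rewrite S_INR. destruct n as [|n].
      - simpl. rewrite RtoC_plus. ring.
      - simpl pred. rewrite !RtoC_plus. simpl Cpow. ring. }
    rewrite E.
    assert (T := Cmod_triangle (w * pow_remainder z w n)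
      (RtoC (INR n) * z ^ pred n * ((w - z) * (w - z)))).
    rewrite !Cmod_mult, Cmod_pow, Cmod_R, Rabs_pos_eq in T by apply pos_INR.
    assert (Hn := pos_INR n). assert (P1 := Cmod_ge_0 (pow_remainder z w n)).
    assert (P2 := Cmod_ge_0 (w - z)). assert (P3 := Cmod_ge_0 w).
    assert (Hrn : 0 <= r ^ n) by (apply pow_le; lra).
    set (D := Cmod (w - z)) in *. set (E' := Cmod (pow_remainder z w n)) in *.
    assert (A1 : r ^ 2 * (Cmod w * E') <= r * (INR n ^ 2 * r ^ n * D ^ 2)).
    { replace (r ^ 2 * (Cmod w * E')) with (Cmod w * (r ^ 2 * E')) by ring.
      apply Rmult_le_compat; auto. apply Rmult_le_pos; [apply pow2_ge_0|exact P1]. }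
    assert (A2 : r ^ 2 * (INR n * Cmod z ^ pred n * (D * D)) <= INR n * (r * r ^ n) * D ^ 2).
    { destruct n as [|n]; [simpl; lra|]. simpl pred.
      assert (Cmod z ^ n <= r ^ n)
        by (apply pow_incr; split; [apply Cmod_ge_0|exact Hz]).
      replace (r ^ 2 * (INR (S n) * Cmod z ^ n * (D * D)))
        with (Cmod z ^ n * (INR (S n) * r ^ 2 * D ^ 2)) by ring.
      replace (INR (S n) * (r * r ^ S n) * D ^ 2)
        with (r ^ n * (INR (S n) * r ^ 2 * D ^ 2)) by (simpl; ring).
      apply Rmult_le_compat_r; auto.
      apply Rmult_le_pos; [apply Rmult_le_pos; [exact Hn|apply pow2_ge_0]|apply pow2_ge_0]. }
    rewrite S_INR. simpl (r ^ S n).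
    assert (A3 : 0 <= (INR n + 1) * (r * r ^ n) * D ^ 2).
    { apply Rmult_le_pos; [apply Rmult_le_pos; [lra|nra]|apply pow2_ge_0]. }
    apply Rle_trans with (r ^ 2 * (Cmod w * E' + INR n * Cmod z ^ pred n * (D * D))).
    + apply Rmult_le_compat_l; [apply pow2_ge_0|exact T].
    + rewrite Rmult_plus_distr_l. nra.
Qed.

(** The remainders of the single powers add up because multiplying the coefficients by n^2 keeps the
    radius of convergence. One [L] serves all pairs [z], [w] of the smaller disc; the packing
    argument rests on this uniformity. *)
Lemma ps_taylor (a : nat -> C) (r : R) : disk_seq a -> 0 < r < 1 ->
  exists L, 0 <= L /\ forall z w, Cmod z <= r -> Cmod w <= r ->
    Cmod (ps a w - ps a z - ps (cderive_seq a) z * (w - z)) <= L * Cmod (w - z) ^ 2.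
Proof.
  intros H Hr.
  set (b := fun n => Cmod (nmul (nmul a) n) * r ^ n).
  assert (Hb : ex_series b).
  { apply disk_seq_summable; [|lra]. now apply disk_seq_nmul, disk_seq_nmul. }
  assert (Hb0 : 0 <= Series b).
  { apply Rle_trans with (Series (fun n => 0 * b n)).
    { right. rewrite Series_scal_l. ring. }
    apply Series_le; auto.
    intros n. rewrite Rmult_0_l. split; [lra|]. apply Rmult_le_pos; [apply Cmod_ge_0|apply pow_le; lra]. }
  assert (Hr2 : 0 < r ^ 2) by (apply pow_lt; lra).
  exists (2 * (Series b / r ^ 2)). split.
  { apply Rmult_le_pos; [lra|]. apply Rmult_le_pos; auto. left. now apply Rinv_0_lt_compat. }
  intros z w Hz Hw.
  destruct (ps_derive_eq a z H) as [E HS]; [lra|].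
  assert (E' : (ps a w - ps a z - ps (cderive_seq a) z * (w - z))%C =
    csum (fun n => a n * pow_remainder z w n)%C).
  { rewrite E, Cmult_comm, <- csum_scal by auto. unfold ps.
    assert (S1 : abs_summable (fun n => a n * w ^ n)%C) by (apply disk_seq_abs_summable; auto; lra).
    assert (S2 : abs_summable (fun n => a n * z ^ n)%C) by (apply disk_seq_abs_summable; auto; lra).
    assert (S3 := abs_summable_scal (w - z)%C _ HS).
    rewrite <- (csum_minus _ _ S1 S2), <- csum_minus; auto.
    - apply csum_ext. intros n. unfold pow_remainder, nmul. ring.
    - apply abs_summable_le with (fun n => Cmod (a n * w ^ n)%C + Cmod (a n * z ^ n)%C).
      + intros n. apply Cmod_minus_triangle.
      + apply (ex_series_plus (V := R_NormedModule)); [exact S1|exact S2]. }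
  rewrite E'.
  assert (Hc : ex_series (fun n => Cmod (w - z) ^ 2 / r ^ 2 * b n)).
  { apply (ex_series_scal (V := R_NormedModule) (Cmod (w - z) ^ 2 / r ^ 2) b). exact Hb. }
  eapply Rle_trans; [apply (Cmod_csum_le _ _) with (2 := Hc)|].
  - intros n. rewrite Cmod_mult. unfold b, nmul. rewrite !Cmod_mult, Cmod_R.
    rewrite Rabs_pos_eq by apply pos_INR.
    generalize (pow_remainder_bound z w r n ltac:(lra) Hz Hw). intros B.
    apply Rmult_le_reg_r with (r ^ 2); auto.
    replace (Cmod (w - z) ^ 2 / r ^ 2 * (INR n * (INR n * Cmod (a n)) * r ^ n) * r ^ 2)
      with (Cmod (a n) * (INR n ^ 2 * r ^ n * Cmod (w - z) ^ 2)) by (field; lra).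
    replace (Cmod (a n) * Cmod (pow_remainder z w n) * r ^ 2)
      with (Cmod (a n) * (r ^ 2 * Cmod (pow_remainder z w n))) by ring.
    apply Rmult_le_compat_l; [apply Cmod_ge_0|exact B].
  - rewrite Series_scal_l. right. field. lra.
Qed.

Lemma ps_cderiv (a : nat -> C) (z : C) : disk_seq a -> Cmod z < 1 ->
  cderiv (ps a) z (ps (cderive_seq a) z).
Proof.
  intros H Hz. assert (P := Cmod_ge_0 z). set (r := (1 + Cmod z) / 2).
  destruct (ps_taylor a r H) as (L & HL & HT); [unfold r; lra|].
  exists L, (r - Cmod z). split; auto. split; [unfold r; lra|].
  intros h Hh. generalize (HT z (z + h)%C).
  replace (z + h - z)%C with h by ring. intros HT'. apply HT'; [unfold r; lra|].
  eapply Rle_trans; [apply Cmod_triangle|]. lra.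
Qed.

Lemma ps_lipschitz (a : nat -> C) (r : R) : disk_seq a -> 0 < r < 1 ->
  exists L, 0 <= L /\ forall z w, Cmod z <= r -> Cmod w <= r ->
    Cmod (ps a w - ps a z) <= L * Cmod (w - z).
Proof.
  intros H Hr. destruct (ps_taylor a r H Hr) as (L & HL & HT).
  destruct (ps_bound (cderive_seq a) r) as (B & HB & HB'); [now apply disk_seq_derive|lra|].
  exists (B + 2 * L). split; [lra|]. intros z w Hz Hw.
  replace (ps a w - ps a z)%C with
    ((ps a w - ps a z - ps (cderive_seq a) z * (w - z)) + ps (cderive_seq a) z * (w - z))%C by ring.
  eapply Rle_trans; [apply Cmod_triangle|]. rewrite Cmod_mult.
  generalize (HT z w Hz Hw) (HB' z Hz). intros T1 T2.
  assert (D := Cmod_ge_0 (w - z)). assert (D2 := Cmod_minus_triangle w z).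
  assert (Cmod (w - z) ^ 2 <= 2 * Cmod (w - z)) by nra. nra.
Qed.

Lemma ps_expand5 (a : nat -> C) (z : C) : disk_seq a -> Cmod z < 1 ->
  ps a z = (a 0%nat + z * (a 1%nat + z * (a 2%nat + z * (a 3%nat + z * (a 4%nat
    + z * ps (Nat.iter 5 cshift a) z)))))%C.
Proof.
  intros H0 Hz.
  assert (H1 := disk_seq_shift _ H0). assert (H2 := disk_seq_shift _ H1).
  assert (H3 := disk_seq_shift _ H2). assert (H4 := disk_seq_shift _ H3).
  rewrite (ps_unfold a), (ps_unfold (cshift a)), (ps_unfold (cshift (cshift a))),
    (ps_unfold (cshift (cshift (cshift a)))),
    (ps_unfold (cshift (cshift (cshift (cshift a))))) by assumption.
  reflexivity.
Qed.

(** The terms of the convergent series at the real point [r] tend to 0 and are therefore bounded. *)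
Lemma analytic_disk_seq (a : nat -> C) : analytic_in_disk a -> disk_seq a.
Proof.
  intros H r Hr.
  destruct (H (RtoC r)) as [l Hl]; [unfold in_unit_disk; rewrite Cmod_R, Rabs_pos_eq; lra|].
  apply is_series_C_iff in Hl. destruct Hl as [H1 H2].
  assert (L1 := ex_series_lim_0 _ (ex_intro _ _ H1)).
  assert (L2 := ex_series_lim_0 _ (ex_intro _ _ H2)).
  assert (B : forall u : nat -> R, is_lim_seq u 0 -> exists M, forall n, Rabs (u n) <= M).
  { intros u Hu. destruct (filterlim_bounded u) as [M HM]; [exists 0; exact Hu|].
    exists M. exact HM. }
  destruct (B _ L1) as [M1 HM1]. destruct (B _ L2) as [M2 HM2].
  exists (M1 + M2). intros n.
  replace (Cmod (a n) * r ^ n) with (Cmod (a n * RtoC r ^ n)).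
  - eapply Rle_trans; [apply Cmod_le_sum|]. generalize (HM1 n) (HM2 n). simpl. lra.
  - rewrite Cmod_mult, Cmod_pow, Cmod_R, Rabs_pos_eq; lra.
Qed.

Lemma ps_correct (a : nat -> C) (z : C) : disk_seq a -> Cmod z < 1 ->
  pseries_sum a z (ps a z).
Proof. intros H Hz. apply csum_correct. now apply disk_seq_abs_summable. Qed.

(** * Logarithmic polar coordinates and iterated derivatives *)

Definition polar (s t : R) : C := (exp s * cos t, exp s * sin t).

Lemma Cmod_polar (s t : R) : Cmod (polar s t) = exp s.
Proof.
  unfold Cmod, polar. simpl fst; simpl snd.
  replace ((exp s * cos t) ^ 2 + (exp s * sin t) ^ 2)
    with (exp s ^ 2 * (Rsqr (sin t) + Rsqr (cos t))) by (unfold Rsqr; ring).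
  rewrite sin2_cos2, Rmult_1_r. apply sqrt_pow2. left. apply exp_pos.
Qed.

Lemma Cmod_polar_lt1 (s t : R) : s < 0 -> Cmod (polar s t) < 1.
Proof. intros H. rewrite Cmod_polar, <- exp_0. now apply exp_increasing. Qed.

(* [g z = z f'(z)] is the derivative of [f] in the coordinate [log z]; in the
   variables [(s, t)] of [polar] both partial derivatives are read off from it. *)
Definition Dlog (f g : C -> C) : Prop :=
  forall z, Cmod z < 1 -> exists l, cderiv f z l /\ g z = (z * l)%C.

Lemma Dlog_const (c : C) : Dlog (fun _ => c) (fun _ => RtoC 0).
Proof. intros z _. exists (RtoC 0). split; [apply cderiv_const|ring]. Qed.

Lemma Dlog_id : Dlog (fun z => z) (fun z => z).
Proof. intros z _. exists (RtoC 1). split; [apply cderiv_id|ring]. Qed.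

Lemma Dlog_plus (f g f' g' : C -> C) : Dlog f f' -> Dlog g g' ->
  Dlog (fun z => f z + g z)%C (fun z => f' z + g' z)%C.
Proof.
  intros Hf Hg z Hz. destruct (Hf z Hz) as (l & H1 & E1). destruct (Hg z Hz) as (m & H2 & E2).
  exists (l + m)%C. split; [now apply cderiv_plus|]. rewrite E1, E2. ring.
Qed.

Lemma Dlog_mult (f g f' g' : C -> C) : Dlog f f' -> Dlog g g' ->
  Dlog (fun z => f z * g z)%C (fun z => f' z * g z + f z * g' z)%C.
Proof.
  intros Hf Hg z Hz. destruct (Hf z Hz) as (l & H1 & E1). destruct (Hg z Hz) as (m & H2 & E2).
  exists (l * g z + f z * m)%C. split; [now apply cderiv_mult|]. rewrite E1, E2. ring.
Qed.

Lemma Dlog_inv (f f' : C -> C) : (forall z, Cmod z < 1 -> f z <> 0) -> Dlog f f' ->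
  Dlog (fun z => / f z)%C (fun z => (- (1)) * (f' z * (/ f z * / f z)))%C.
Proof.
  intros Hn Hf z Hz. destruct (Hf z Hz) as (l & H1 & E1).
  exists (- l / (f z * f z))%C. split; [apply cderiv_inv; auto|].
  rewrite E1. field. now apply Hn.
Qed.

Lemma Dlog_ps (a : nat -> C) : disk_seq a -> Dlog (ps a) (fun z => z * ps (cderive_seq a) z)%C.
Proof. intros H z Hz. exists (ps (cderive_seq a) z). split; [now apply ps_cderiv|reflexivity]. Qed.

(** Differentiability [n] times with respect to log z. Continuity of one derivative is read off from
    the existence of the next, so level 2 already provides the C^1 regularity that Green's formula
    asks for. *)
Fixpoint holo (n : nat) (f : C -> C) : Prop :=
  match n with
  | O => True
  | S n => exists g, Dlog f g /\ holo n g
  end.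

Lemma holo_S (n : nat) (f : C -> C) : holo (S n) f -> holo n f.
Proof.
  revert f. induction n as [|n IH]; intros f H; [exact I|].
  destruct H as (g & Hg & H). exists g. split; auto.
Qed.

Lemma holo_const (n : nat) (c : C) : holo n (fun _ => c).
Proof.
  revert c. induction n as [|n IH]; intros c; [exact I|].
  exists (fun _ => RtoC 0). split; [apply Dlog_const|apply IH].
Qed.

Lemma holo_id (n : nat) : holo n (fun z => z).
Proof.
  induction n as [|n IH]; [exact I|]. exists (fun z => z). split; [apply Dlog_id|apply IH].
Qed.

Lemma holo_plus (n : nat) (f g : C -> C) :
  holo n f -> holo n g -> holo n (fun z => f z + g z)%C.
Proof.
  revert f g. induction n as [|n IH]; intros f g Hf Hg; [exact I|].
  destruct Hf as (f' & Df & Hf). destruct Hg as (g' & Dg & Hg).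
  exists (fun z => f' z + g' z)%C. split; [now apply Dlog_plus|now apply IH].
Qed.

Lemma holo_mult (n : nat) (f g : C -> C) :
  holo n f -> holo n g -> holo n (fun z => f z * g z)%C.
Proof.
  revert f g. induction n as [|n IH]; intros f g Hf Hg; [exact I|].
  assert (Hf1 := holo_S _ _ Hf). assert (Hg1 := holo_S _ _ Hg).
  destruct Hf as (f' & Df & Hf). destruct Hg as (g' & Dg & Hg).
  exists (fun z => f' z * g z + f z * g' z)%C. split; [now apply Dlog_mult|].
  apply holo_plus; now apply IH.
Qed.

Lemma holo_inv (n : nat) (f : C -> C) : (forall z, Cmod z < 1 -> f z <> 0) ->
  holo n f -> holo n (fun z => / f z)%C.
Proof.
  intros Hn. induction n as [|n IH]; intros Hf; [exact I|].
  assert (Hf1 := holo_S _ _ Hf). destruct Hf as (f' & Df & Hf).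
  eexists. split; [apply Dlog_inv; eauto|].
  apply holo_mult; [apply holo_const|]. apply holo_mult; [exact Hf|].
  apply holo_mult; apply IH; exact Hf1.
Qed.

Lemma holo_ps (n : nat) (a : nat -> C) : disk_seq a -> holo n (ps a).
Proof.
  revert a. induction n as [|n IH]; intros a H; [exact I|].
  eexists. split; [now apply Dlog_ps|].
  apply holo_mult; [apply holo_id|]. apply IH. now apply disk_seq_derive.
Qed.

Lemma is_derive_little_o (f : R -> R) (t d : R) :
  is_derive f t d <-> (forall e, 0 < e -> exists del, 0 < del /\
    forall h, Rabs h < del -> Rabs (f (t + h) - f t - d * h) <= e * Rabs h).
Proof.
  rewrite is_derive_Reals. split.
  - intros H e He. destruct (H e He) as [del Hdel]. exists del. split; [apply cond_pos|].
    intros h Hh. destruct (Req_dec h 0) as [->|Hn].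
    + rewrite Rplus_0_r, Rminus_diag, Rmult_0_r, Rminus_diag, Rabs_R0. lra.
    + assert (P := Rabs_pos_lt h Hn).
      replace (f (t + h) - f t - d * h) with (((f (t + h) - f t) / h - d) * h) by (field; auto).
      rewrite Rabs_mult. apply Rmult_le_compat_r; [lra|]. left. now apply Hdel.
  - intros H e He. destruct (H (e / 2)) as (del & Hd & Hdel); [lra|].
    exists (mkposreal del Hd). intros h Hn Hh. simpl in Hh.
    assert (P := Rabs_pos_lt h Hn).
    apply Rmult_lt_reg_r with (Rabs h); auto. rewrite <- Rabs_mult.
    replace (((f (t + h) - f t) / h - d) * h) with (f (t + h) - f t - d * h) by (field; auto).
    eapply Rle_lt_trans; [now apply Hdel|]. nra.
Qed.

Lemma is_derive_along_curve (f : C -> C) (E : R -> C) (t : R) (l d : C) :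
  is_derive (fun x => fst (E x)) t (fst d) -> is_derive (fun x => snd (E x)) t (snd d) ->
  cderiv f (E t) l ->
  is_derive (fun x => fst (f (E x))) t (fst (l * d)%C) /\
  is_derive (fun x => snd (f (E x))) t (snd (l * d)%C).
Proof.
  intros H1 H2 (K & r & HK & Hr & H).
  (* The error is the quadratic remainder of [f] at the increment of [E], plus [l] times the error
     of [E] itself. The constants make each of them at most [e / 2 * Rabs h]. *)
  assert (Main : forall e, 0 < e -> exists del, 0 < del /\
    forall h, Rabs h < del ->
    Cmod (f (E (t + h)%R) - f (E t) - l * d * RtoC h) <= e * Rabs h).
  { intros e He. rewrite is_derive_little_o in H1, H2.
    assert (Pl := Cmod_ge_0 l). assert (Pd := Cmod_ge_0 d).
    set (eta := Rmin 1 (e / (4 * (Cmod l + 1)))).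
    assert (Heta : 0 < eta) by (apply Rmin_glb_lt; [lra|apply Rdiv_lt_0_compat; lra]).
    assert (Heta1 : eta <= 1) by apply Rmin_l.
    assert (Heta2 : Cmod l * (2 * eta) <= e / 2).
    { assert (T : eta <= e / (4 * (Cmod l + 1))) by apply Rmin_r.
      apply Rmult_le_compat_r with (r := 4 * (Cmod l + 1)) in T; [|lra].
      replace (e / (4 * (Cmod l + 1)) * (4 * (Cmod l + 1))) with e in T by (field; lra). nra. }
    destruct (H1 eta Heta) as (d1 & Hd1 & D1). destruct (H2 eta Heta) as (d2 & Hd2 & D2).
    set (M := Cmod d + 2). assert (HM : 0 < M) by (unfold M; lra).
    assert (P3 : 0 < r / M) by (apply Rdiv_lt_0_compat; lra).
    assert (P4 : 0 < e / (2 * (K * M ^ 2 + 1))).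
    { apply Rdiv_lt_0_compat; [lra|]. assert (0 <= K * M ^ 2) by (apply Rmult_le_pos; nra). lra. }
    exists (Rmin (Rmin d1 d2) (Rmin (r / M) (e / (2 * (K * M ^ 2 + 1))))).
    split; [repeat apply Rmin_glb_lt; auto|].
    intros h Hh.
    assert (Hh1 : Rabs h < d1) by (eapply Rlt_le_trans; [exact Hh|]; eapply Rle_trans; [apply Rmin_l|apply Rmin_l]).
    assert (Hh2 : Rabs h < d2) by (eapply Rlt_le_trans; [exact Hh|]; eapply Rle_trans; [apply Rmin_l|apply Rmin_r]).
    assert (Hh3 : Rabs h < r / M) by (eapply Rlt_le_trans; [exact Hh|]; eapply Rle_trans; [apply Rmin_r|apply Rmin_l]).
    assert (Hh4 : Rabs h < e / (2 * (K * M ^ 2 + 1))) by (eapply Rlt_le_trans; [exact Hh|]; eapply Rle_trans; [apply Rmin_r|apply Rmin_r]).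
    assert (Ph := Rabs_pos h).
    set (De := (E (t + h)%R - E t)%C).
    assert (HDe : Cmod (De - d * RtoC h) <= 2 * eta * Rabs h).
    { eapply Rle_trans; [apply Cmod_le_sum|].
      generalize (D1 h Hh1) (D2 h Hh2). unfold De.
      destruct (E (t + h)%R) as [x1 y1]. destruct (E t) as [x0 y0]. destruct d as [a b].
      simpl. intros A1 A2.
      replace (x1 + - x0 + - (a * h - b * 0)) with (x1 - x0 - a * h) by ring.
      replace (y1 + - y0 + - (a * 0 + b * h)) with (y1 - y0 - b * h) by ring. lra. }
    assert (HDe2 : Cmod De <= M * Rabs h).
    { replace De with ((De - d * RtoC h) + d * RtoC h)%C by ring.
      eapply Rle_trans; [apply Cmod_triangle|]. rewrite Cmod_mult, Cmod_R. unfold M. nra. }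
    assert (HDe3 : Cmod De < r).
    { eapply Rle_lt_trans; [exact HDe2|].
      apply Rmult_lt_compat_l with (r := M) in Hh3; auto.
      replace (M * (r / M)) with r in Hh3 by (field; lra). exact Hh3. }
    assert (T := H De HDe3).
    replace (E t + De)%C with (E (t + h)%R) in T by (unfold De; ring).
    replace (f (E (t + h)%R) - f (E t) - l * d * RtoC h)%C
      with ((f (E (t + h)%R) - f (E t) - l * De) + l * (De - d * RtoC h))%C by ring.
    eapply Rle_trans; [apply Cmod_triangle|]. rewrite Cmod_mult.
    assert (T1 : Cmod l * Cmod (De - d * RtoC h) <= e / 2 * Rabs h).
    { eapply Rle_trans; [apply Rmult_le_compat_l; [exact Pl|exact HDe]|]. nra. }
    assert (T2 : K * Cmod De ^ 2 <= e / 2 * Rabs h).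
    { assert (Q := Cmod_ge_0 De).
      assert (Cmod De ^ 2 <= (M * Rabs h) ^ 2) by (apply pow_incr; lra).
      assert (Hq : (K * M ^ 2 + 1) * Rabs h <= e / 2).
      { assert (0 <= K * M ^ 2) by (apply Rmult_le_pos; nra).
        apply Rlt_le in Hh4.
        apply Rmult_le_compat_l with (r := K * M ^ 2 + 1) in Hh4; [|lra].
        replace ((K * M ^ 2 + 1) * (e / (2 * (K * M ^ 2 + 1)))) with (e / 2) in Hh4 by (field; lra).
        exact Hh4. }
      apply Rle_trans with (K * (M * Rabs h) ^ 2); [apply Rmult_le_compat_l; auto|].
      replace (K * (M * Rabs h) ^ 2) with (K * M ^ 2 * Rabs h * Rabs h) by ring.
      apply Rmult_le_compat_r; nra. }
    lra. }
  split; apply is_derive_little_o; intros e He; destruct (Main e He) as (del & Hdel & HM);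
    exists del; split; auto; intros h Hh; eapply Rle_trans; [|now apply HM| |now apply HM].
  - eapply Rle_trans; [|apply Rabs_fst_le_Cmod]. right. f_equal.
    simpl. destruct (f (E (t + h)%R)), (f (E t)), l, d; simpl; ring.
  - eapply Rle_trans; [|apply Rabs_snd_le_Cmod]. right. f_equal.
    simpl. destruct (f (E (t + h)%R)), (f (E t)), l, d; simpl; ring.
Qed.

(** The Cauchy-Riemann equations: the derivative along [s] is [g] and the one along [t] is [Ci * g],
    since [polar] itself is multiplied by 1 and by [Ci]. *)
Lemma Dlog_polar (f g : C -> C) (s t : R) : Dlog f g -> s < 0 ->
  (is_derive (fun x => fst (f (polar x t))) s (fst (g (polar s t))) /\
   is_derive (fun x => snd (f (polar x t))) s (snd (g (polar s t)))) /\
  (is_derive (fun y => fst (f (polar s y))) t (- snd (g (polar s t))) /\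
   is_derive (fun y => snd (f (polar s y))) t (fst (g (polar s t)))).
Proof.
  intros H Hs. destruct (H (polar s t)) as (l & Hl & ->); [now apply Cmod_polar_lt1|].
  split.
  - destruct (is_derive_along_curve f (fun x => polar x t) s l (polar s t)) as [A B]; auto.
    + unfold polar; simpl. auto_derive; [exact I|ring].
    + unfold polar; simpl. auto_derive; [exact I|ring].
    + rewrite Cmult_comm. split; assumption.
  - destruct (is_derive_along_curve f (fun y => polar s y) t l (Ci * polar s t)%C) as [A B]; auto.
    + unfold polar; simpl. auto_derive; [exact I|ring].
    + unfold polar; simpl. auto_derive; [exact I|ring].
    + replace (- snd (polar s t * l)%C) with (fst (l * (Ci * polar s t))%C)
        by (simpl; ring).
      replace (fst (polar s t * l)%C) with (snd (l * (Ci * polar s t))%C)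
        by (simpl; ring).
      split; assumption.
Qed.

Lemma continuity_2d_polar (s t : R) :
  continuity_2d_pt (fun x y => fst (polar x y)) s t /\
  continuity_2d_pt (fun x y => snd (polar x y)) s t.
Proof.
  unfold polar; simpl. split; apply continuity_2d_pt_mult.
  - apply (continuity_1d_2d_pt_comp exp (fun x _ => x)); [|apply continuity_2d_pt_id1].
    apply derivable_continuous, derivable_exp.
  - apply (continuity_1d_2d_pt_comp cos (fun _ y => y)); [|apply continuity_2d_pt_id2].
    apply continuity_cos.
  - apply (continuity_1d_2d_pt_comp exp (fun x _ => x)); [|apply continuity_2d_pt_id1].
    apply derivable_continuous, derivable_exp.
  - apply (continuity_1d_2d_pt_comp sin (fun _ y => y)); [|apply continuity_2d_pt_id2].
    apply continuity_sin.
Qed.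

Lemma Dlog_continuity_2d (f g : C -> C) (s t : R) : Dlog f g -> s < 0 ->
  continuity_2d_pt (fun x y => fst (f (polar x y))) s t /\
  continuity_2d_pt (fun x y => snd (f (polar x y))) s t.
Proof.
  intros H Hs. destruct (H (polar s t)) as (l & Hl & _); [now apply Cmod_polar_lt1|].
  destruct (cderiv_continuous_bound f _ l Hl) as (K & d & HK & Hd & HB).
  assert (Main : forall eps : posreal,
    locally_2d (fun x y => Cmod (f (polar x y) - f (polar s t)) < eps) s t).
  { intros eps. assert (He := cond_pos eps).
    set (e := Rmin d (eps / (K + 1)) / 2).
    assert (0 < eps / (K + 1)) by (apply Rdiv_lt_0_compat; lra).
    assert (He' : 0 < Rmin d (eps / (K + 1))) by (apply Rmin_glb_lt; lra).
    assert (Hep : 0 < e) by (unfold e; lra).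
    destruct (continuity_2d_polar s t) as [C1 C2].
    destruct (C1 (mkposreal e Hep)) as [d1 Hd1]. destruct (C2 (mkposreal e Hep)) as [d2 Hd2].
    simpl in Hd1, Hd2.
    assert (Hm : 0 < Rmin d1 d2) by (apply Rmin_glb_lt; apply cond_pos).
    exists (mkposreal _ Hm). simpl. intros u v Hu Hv.
    assert (A1 := Hd1 u v (Rlt_le_trans _ _ _ Hu (Rmin_l _ _)) (Rlt_le_trans _ _ _ Hv (Rmin_l _ _))).
    assert (A2 := Hd2 u v (Rlt_le_trans _ _ _ Hu (Rmin_r _ _)) (Rlt_le_trans _ _ _ Hv (Rmin_r _ _))).
    set (h := (polar u v - polar s t)%C).
    assert (Hh : Cmod h < Rmin d (eps / (K + 1))).
    { eapply Rle_lt_trans; [apply Cmod_le_sum|]. unfold h. simpl in *. unfold e in *. unfold Rminus in *. lra. }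
    assert (Hh1 := Rlt_le_trans _ _ _ Hh (Rmin_l _ _)).
    assert (Hh2 := Rlt_le_trans _ _ _ Hh (Rmin_r _ _)).
    replace (polar u v) with (polar s t + h)%C by (unfold h; ring).
    eapply Rle_lt_trans; [now apply HB|]. assert (P := Cmod_ge_0 h).
    apply Rmult_lt_compat_r with (r := K + 1) in Hh2; [|lra].
    replace (eps / (K + 1) * (K + 1)) with (pos eps) in Hh2 by (field; lra). nra. }
  split; intros eps; destruct (Main eps) as [del Hdel]; exists del; intros u v Hu Hv;
    (eapply Rle_lt_trans; [|now apply (Hdel u v)]).
  - eapply Rle_trans; [|apply Rabs_fst_le_Cmod]. right. reflexivity.
  - eapply Rle_trans; [|apply Rabs_snd_le_Cmod]. right. reflexivity.
Qed.

(** * Green's formula on an annulus and the mean value property *)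

Lemma locally_lt (s b : R) : s < b -> locally s (fun x => x < b).
Proof. intros H. exact (open_lt b s H). Qed.

Lemma continuous_RInt_param_left (f : R -> R -> R) (c d s : R) :
  (forall x y, x < 0 -> continuity_2d_pt f x y) -> s < 0 -> c <= d ->
  continuous (fun x => RInt (f x) c d) s.
Proof.
  intros H Hs Hcd. apply continuous_RInt_param; auto.
  generalize (locally_lt s 0 Hs). apply filter_imp. intros x Hx y.
  apply continuity_2d_pt_section_r. now apply H.
Qed.

Lemma is_derive_RInt_section (u D : R -> R -> R) (c d s : R) :
  (forall x y, x < 0 -> is_derive (fun x => u x y) x (D x y)) ->
  (forall x y, x < 0 -> continuity_2d_pt u x y) ->
  (forall x y, x < 0 -> continuity_2d_pt D x y) ->
  s < 0 -> is_derive (fun x => RInt (u x) c d) s (RInt (D s) c d).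
Proof.
  intros Hu Cu CD Hs.
  assert (E : RInt (D s) c d = RInt (fun t => Derive (fun x => u x t) s) c d).
  { apply RInt_ext. intros y _. symmetry. apply is_derive_unique. now apply Hu. }
  rewrite E. apply (is_derive_RInt_param u c d s).
  - generalize (locally_lt s 0 Hs). apply filter_imp. intros x Hx y _.
    exists (D x y). now apply Hu.
  - intros y _. apply continuity_2d_pt_ext_loc with D; [|now apply CD].
    assert (Hp : 0 < - s) by lra. exists (mkposreal _ Hp). simpl. intros x v Hx _.
    symmetry. apply is_derive_unique, Hu. apply Rabs_def2 in Hx. lra.
  - generalize (locally_lt s 0 Hs). apply filter_imp. intros x Hx.
    apply ex_RInt_everywhere_continuous. intros y.
    apply continuity_2d_pt_section_r. now apply Cu.
Qed.

(* The values of [v] on the two horizontal sides cancel by periodicity. *)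
Lemma green_strip (u v D E : R -> R -> R) (s0 s1 : R) :
  (forall x y, x < 0 -> is_derive (fun x => u x y) x (D x y)) ->
  (forall x y, x < 0 -> is_derive (fun y => v x y) y (E x y)) ->
  (forall x y, x < 0 -> continuity_2d_pt u x y) ->
  (forall x y, x < 0 -> continuity_2d_pt D x y) ->
  (forall x y, x < 0 -> continuity_2d_pt E x y) ->
  (forall x, x < 0 -> v x (2 * PI) = v x 0) -> s0 <= s1 -> s1 < 0 ->
  RInt (u s1) 0 (2 * PI) - RInt (u s0) 0 (2 * PI) =
  RInt (fun x => RInt (fun y => D x y - E x y) 0 (2 * PI)) s0 s1.
Proof.
  intros Hu Hv Cu CD CE Per H01 H1. assert (PI0 := PI_RGT_0).
  assert (Cs : forall f, (forall x y, x < 0 -> continuity_2d_pt f x y) ->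
    forall x, x < 0 -> ex_RInt (f x) 0 (2 * PI)).
  { intros f Cf x Hx. apply ex_RInt_everywhere_continuous. intros y.
    apply continuity_2d_pt_section_r. now apply Cf. }
  assert (CDE : forall x y, x < 0 -> continuity_2d_pt (fun x y => D x y - E x y) x y).
  { intros x y Hx. apply continuity_2d_pt_minus; auto. }
  assert (K : forall x, x < 0 ->
    RInt (fun y => D x y - E x y) 0 (2 * PI) = RInt (D x) 0 (2 * PI)).
  { intros x Hx.
    assert (R0 : RInt (E x) 0 (2 * PI) = 0).
    { apply (is_RInt_unique (V := R_CompleteNormedModule)).
      replace 0 with (minus (v x (2 * PI)) (v x 0)) at 2
        by (unfold minus, plus, opp; simpl; rewrite Per by auto; ring).
      apply (is_RInt_derive (v x) (E x)).
      - intros y _. now apply Hv.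
      - intros y _. apply continuity_2d_pt_section_r. now apply CE. }
    transitivity (minus (RInt (D x) 0 (2 * PI)) (RInt (E x) 0 (2 * PI))).
    - apply (RInt_minus (V := R_CompleteNormedModule)); now apply Cs.
    - rewrite R0. unfold minus, plus, opp; simpl. ring. }
  symmetry. apply (is_RInt_unique (V := R_CompleteNormedModule)).
  apply (is_RInt_derive (V := R_CompleteNormedModule) (fun x => RInt (u x) 0 (2 * PI))).
  - intros x Hx. rewrite Rmin_left, Rmax_right in Hx by lra.
    rewrite K by lra. apply is_derive_RInt_section; auto. lra.
  - intros x Hx. rewrite Rmin_left, Rmax_right in Hx by lra.
    apply (continuous_RInt_param_left (fun x y => D x y - E x y)); auto; lra.
Qed.

Lemma polar_2PI (s : R) : polar s (2 * PI) = polar s 0.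
Proof. unfold polar. now rewrite cos_2PI, sin_2PI, cos_0, sin_0. Qed.

(** Shrinks the inner circle of an annulus to the origin: its radius is [exp s0], and its
    contribution is of that order. *)
Lemma nonpos_of_small_exp_bound (x K d s : R) : 0 <= K -> 0 < d ->
  (forall s0, s0 < s -> exp s0 < d -> x <= K * exp s0) -> x <= 0.
Proof.
  intros HK Hd H.
  apply (nonpos_of_small_linear_bound x K (Rmin d (exp s))); auto.
  - apply Rmin_glb_lt; [auto|apply exp_pos].
  - intros t Ht. assert (Q1 := Rmin_l d (exp s)). assert (Q2 := Rmin_r d (exp s)).
    rewrite <- (exp_ln t) by lra. apply H.
    + rewrite <- (ln_exp s). apply ln_increasing; lra.
    + rewrite exp_ln; lra.
Qed.

Lemma RInt_Rabs_le (f : R -> R) (M : R) : (forall y, continuous f y) ->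
  (forall y, Rabs (f y) <= M) -> Rabs (RInt f 0 (2 * PI)) <= 2 * PI * M.
Proof.
  intros Cf HM. assert (PI0 := PI_RGT_0).
  replace (2 * PI * M) with ((2 * PI - 0) * M) by ring.
  apply abs_RInt_le_const; [lra|now apply ex_RInt_everywhere_continuous|].
  intros; apply HM.
Qed.

(** Green's formula for the real and imaginary parts of [H] has a vanishing integrand by the
    Cauchy-Riemann equations, so the circle integral is independent of the radius. As the radius
    tends to 0 it tends to the value at the origin. *)
Lemma mean_value_Re (H : C -> C) (s : R) : holo 2 H -> s < 0 ->
  RInt (fun t => fst (H (polar s t))) 0 (2 * PI) = 2 * PI * fst (H (RtoC 0)).
Proof.
  intros (g & DH & h & Dg & _) Hs. assert (PI0 := PI_RGT_0).
  set (I := fun s => RInt (fun t => fst (H (polar s t))) 0 (2 * PI)).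
  assert (Const : forall s0, s0 <= s -> I s = I s0).
  { intros s0 H0.
    assert (G := green_strip (fun x y => fst (H (polar x y))) (fun x y => snd (H (polar x y)))
      (fun x y => fst (g (polar x y))) (fun x y => fst (g (polar x y))) s0 s).
    apply Rminus_diag_uniq. unfold I. rewrite G; auto.
    - transitivity (RInt (fun _ => 0) s0 s).
      + apply RInt_ext. intros x _. transitivity (RInt (fun _ => 0) 0 (2 * PI)).
        * apply RInt_ext. intros. apply Rminus_diag.
        * rewrite RInt_const. unfold scal; simpl; unfold mult; simpl. ring.
      + rewrite RInt_const. unfold scal; simpl; unfold mult; simpl. ring.
    - intros x y Hx. now apply (Dlog_polar H g).
    - intros x y Hx. now apply (Dlog_polar H g).
    - intros x y Hx. now apply (Dlog_continuity_2d H g).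
    - intros x y Hx. now apply (Dlog_continuity_2d g h).
    - intros x y Hx. now apply (Dlog_continuity_2d g h).
    - intros x Hx. now rewrite polar_2PI. }
  destruct (DH (RtoC 0)) as (l & Hl & _); [rewrite Cmod_0; lra|].
  destruct (cderiv_continuous_bound H _ l Hl) as (K & d & HK & Hd & HB).
  assert (Bd : forall s0, s0 < 0 -> exp s0 < d ->
    Rabs (I s0 - 2 * PI * fst (H (RtoC 0))) <= 2 * PI * (K * exp s0)).
  { intros s0 H0 H0d.
    assert (CI : forall y, continuous (fun t => fst (H (polar s0 t))) y).
    { intros y. apply (continuity_2d_pt_section_r (fun x y => fst (H (polar x y)))).
      now apply (Dlog_continuity_2d H g). }
    assert (E : I s0 - 2 * PI * fst (H (RtoC 0)) =
      RInt (fun t => fst (H (polar s0 t)) - fst (H (RtoC 0))) 0 (2 * PI)).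
    { transitivity (minus (I s0) (RInt (fun _ => fst (H (RtoC 0))) 0 (2 * PI))).
      - rewrite RInt_const. unfold scal, minus, plus, opp; simpl; unfold mult; simpl. ring.
      - symmetry. apply (RInt_minus (V := R_CompleteNormedModule)).
        + now apply ex_RInt_everywhere_continuous.
        + apply ex_RInt_everywhere_continuous. intros y. apply continuous_const. }
    rewrite E. apply RInt_Rabs_le.
    - intros y. apply (continuous_minus (V := R_NormedModule)); [apply CI|apply continuous_const].
    - intros y. generalize (HB (polar s0 y)). rewrite Cplus_0_l, Cmod_polar. intros T.
      eapply Rle_trans; [|now apply T]. eapply Rle_trans; [|apply Rabs_fst_le_Cmod].
      right. reflexivity. }
  apply Rminus_diag_uniq, Rabs_eq_0, Rle_antisym; [|apply Rabs_pos].
  apply (nonpos_of_small_exp_bound _ (2 * PI * K) d s); try lra; [nra|].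
  intros s0 H0 H0d. change (Rabs (I s - 2 * PI * fst (H (RtoC 0))) <= 2 * PI * K * exp s0).
  assert (T := Bd s0 ltac:(lra) H0d). rewrite (Const s0) by lra. lra.
Qed.

(** * Energy on circles and area of the image *)

Lemma is_derive_quotient (N W : R -> R) (t dN dW : R) : W t <> 0 ->
  is_derive N t dN -> is_derive W t dW ->
  is_derive (fun x => N x / W x) t ((dN * W t - N t * dW) / W t ^ 2).
Proof. intros H H1 H2. now apply is_derive_div. Qed.

Lemma is_derive_bilinear (f1 g1 f2 g2 : R -> R) (t a1 b1 a2 b2 : R) :
  is_derive f1 t a1 -> is_derive g1 t b1 -> is_derive f2 t a2 -> is_derive g2 t b2 ->
  is_derive (fun x => f1 x * g1 x + f2 x * g2 x) t
    (a1 * g1 t + f1 t * b1 + (a2 * g2 t + f2 t * b2)).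
Proof.
  intros H1 H2 H3 H4.
  apply (is_derive_plus (V := R_NormedModule) (fun x => f1 x * g1 x) (fun x => f2 x * g2 x)).
  - apply (is_derive_mult f1 g1); auto. intros; apply Rmult_comm.
  - apply (is_derive_mult f2 g2); auto. intros; apply Rmult_comm.
Qed.

(** When [q'] is the derivative of [q] in [s], this is the derivative of log (b + c |q|^2) / (2 c),
    and for [c = 0] that of |q|^2 / (2 b). The case [b = tau], [c = 1] belongs to the spherical
    metric, and [b = 1], [c = 0] to the flat one. *)
Definition energy_density (b c : R) (q q' : C) : R :=
  (fst q * fst q' + snd q * snd q') / (b + c * (fst q * fst q + snd q * snd q)).

(** The Jacobian |q'|^2 times the density of the metric at [q]. *)
Definition area_density (b c : R) (q q' : C) : R :=
  (fst q' * fst q' + snd q' * snd q') * b / (b + c * (fst q * fst q + snd q * snd q)) ^ 2.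

Lemma density_denominator_pos (b c : R) (q : C) : 0 < b -> 0 <= c ->
  0 < b + c * (fst q * fst q + snd q * snd q).
Proof. intros Hb Hc. assert (0 <= fst q * fst q + snd q * snd q) by nra. nra. Qed.

Section energy.
Variables (H g h k : C -> C).
Hypothesis DH : Dlog H g.
Hypothesis Dg : Dlog g h.
Hypothesis Dh : Dlog h k.
Variables (b c : R).
Hypothesis Hb : 0 < b.
Hypothesis Hc : 0 <= c.

Lemma continuity_2d_density_denominator (s t : R) : s < 0 ->
  continuity_2d_pt (fun x y => b + c * (fst (H (polar x y)) * fst (H (polar x y))
    + snd (H (polar x y)) * snd (H (polar x y)))) s t.
Proof.
  intros Hs. destruct (Dlog_continuity_2d H g s t DH Hs) as [H1 H2].
  apply continuity_2d_pt_plus; [apply continuity_2d_pt_const|].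
  apply continuity_2d_pt_mult; [apply continuity_2d_pt_const|].
  apply continuity_2d_pt_plus; apply continuity_2d_pt_mult; assumption.
Qed.

Lemma continuity_2d_energy_density (s t : R) : s < 0 ->
  continuity_2d_pt (fun x y => energy_density b c (H (polar x y)) (g (polar x y))) s t.
Proof.
  intros Hs. unfold energy_density.
  destruct (Dlog_continuity_2d H g s t DH Hs) as [H1 H2].
  destruct (Dlog_continuity_2d g h s t Dg Hs) as [G1 G2].
  apply continuity_2d_pt_mult.
  - apply continuity_2d_pt_plus; apply continuity_2d_pt_mult; assumption.
  - apply continuity_2d_pt_inv.
    + now apply continuity_2d_density_denominator.
    + apply Rgt_not_eq. now apply density_denominator_pos.
Qed.

Lemma continuity_2d_area_density (s t : R) : s < 0 ->
  continuity_2d_pt (fun x y => area_density b c (H (polar x y)) (g (polar x y))) s t.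
Proof.
  intros Hs. unfold area_density.
  destruct (Dlog_continuity_2d g h s t Dg Hs) as [G1 G2].
  apply continuity_2d_pt_mult.
  - apply continuity_2d_pt_mult; [|apply continuity_2d_pt_const].
    apply continuity_2d_pt_plus; apply continuity_2d_pt_mult; assumption.
  - assert (CW := continuity_2d_density_denominator s t Hs).
    apply continuity_2d_pt_inv.
    + simpl. apply continuity_2d_pt_mult; auto.
      apply continuity_2d_pt_mult; auto. apply continuity_2d_pt_const.
    + apply pow_nonzero, Rgt_not_eq. now apply density_denominator_pos.
Qed.

(** Green's formula for the gradient of log (b + c |H|^2) / (2 c), whose Laplacian in [(s, t)] is
    twice the area density. The second derivatives [h] cancel because [H] is harmonic. *)
Lemma energy_increment (s0 s1 : R) : s0 <= s1 -> s1 < 0 ->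
  RInt (fun t => energy_density b c (H (polar s1 t)) (g (polar s1 t))) 0 (2 * PI) -
  RInt (fun t => energy_density b c (H (polar s0 t)) (g (polar s0 t))) 0 (2 * PI) =
  RInt (fun s => RInt (fun t => 2 * area_density b c (H (polar s t)) (g (polar s t)))
    0 (2 * PI)) s0 s1.
Proof.
  intros H01 H1.
  set (q1 := fun x y => fst (H (polar x y))). set (q2 := fun x y => snd (H (polar x y))).
  set (p1 := fun x y => fst (g (polar x y))). set (p2 := fun x y => snd (g (polar x y))).
  set (r1 := fun x y => fst (h (polar x y))). set (r2 := fun x y => snd (h (polar x y))).
  set (W := fun x y => b + c * (q1 x y * q1 x y + q2 x y * q2 x y)).
  assert (W0 : forall x y, W x y <> 0)
    by (intros x y; apply Rgt_not_eq, (density_denominator_pos b c (H (polar x y))); auto).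
  set (D := fun x y => ((p1 x y * p1 x y + q1 x y * r1 x y + (p2 x y * p2 x y + q2 x y * r2 x y)) * W x y
    - (q1 x y * p1 x y + q2 x y * p2 x y) * (c * (p1 x y * q1 x y + q1 x y * p1 x y + (p2 x y * q2 x y + q2 x y * p2 x y)))) / W x y ^ 2).
  set (E := fun x y => (((- p2 x y) * p2 x y + q1 x y * r1 x y + ((- p1 x y) * p1 x y + (- q2 x y) * (- r2 x y))) * W x y
    - (q1 x y * p2 x y + (- q2 x y) * p1 x y) * (c * ((- p2 x y) * q1 x y + q1 x y * (- p2 x y) + (p1 x y * q2 x y + q2 x y * p1 x y)))) / W x y ^ 2).
  assert (DW : forall (f1 f2 : R -> R) t a1 a2, is_derive f1 t a1 -> is_derive f2 t a2 ->
    is_derive (fun x => b + c * (f1 x * f1 x + f2 x * f2 x)) t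
      (c * (a1 * f1 t + f1 t * a1 + (a2 * f2 t + f2 t * a2)))).
  { intros f1 f2 t a1 a2 A1 A2.
    replace (c * _) with (plus 0 (scal c (a1 * f1 t + f1 t * a1 + (a2 * f2 t + f2 t * a2))))
      by (unfold plus, scal; simpl; unfold mult; simpl; ring).
    apply (is_derive_plus (V := R_NormedModule) (fun _ => b)); [exact (is_derive_const (V := R_NormedModule) b t)|].
    apply (is_derive_scal (fun x => f1 x * f1 x + f2 x * f2 x)).
    now apply is_derive_bilinear. }
  assert (CW : forall x y, x < 0 -> continuity_2d_pt W x y).
  { exact continuity_2d_density_denominator. }
  assert (CW2 : forall x y, x < 0 -> continuity_2d_pt (fun x y => / W x y ^ 2) x y).
  { intros x y Hx. apply continuity_2d_pt_inv; [|now apply pow_nonzero].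
    simpl. apply continuity_2d_pt_mult; auto.
    apply continuity_2d_pt_mult; auto. apply continuity_2d_pt_const. }
  rewrite (green_strip (fun x y => energy_density b c (H (polar x y)) (g (polar x y)))
    (fun x y => (q1 x y * p2 x y + (- q2 x y) * p1 x y) / W x y) D E s0 s1); auto.
  5, 6: (intros x y Hx; apply continuity_2d_pt_mult; [|now apply CW2];
    destruct (Dlog_continuity_2d H g x y DH Hx) as [A1 A2];
    destruct (Dlog_continuity_2d g h x y Dg Hx) as [B1 B2];
    destruct (Dlog_continuity_2d h k x y Dh Hx) as [C1 C2];
    repeat (apply continuity_2d_pt_minus || apply continuity_2d_pt_plus ||
      apply continuity_2d_pt_mult || apply continuity_2d_pt_opp || apply CW ||
      apply continuity_2d_pt_const); assumption).
  - apply RInt_ext. intros x _. apply RInt_ext. intros y _.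
    unfold D, E, area_density. fold (q1 x y) (q2 x y) (p1 x y) (p2 x y). fold (W x y).
    assert (N := W0 x y). match goal with |- ?l = ?r => change (@eq R l r) end.
    (* The numerator of [D - E] contains [W] minus [c] times the squared modulus of [H], which is
       the constant [b]. *)
    transitivity ((2 * (p1 x y * p1 x y + p2 x y * p2 x y) * (W x y -
      c * (q1 x y * q1 x y + q2 x y * q2 x y))) / W x y ^ 2).
    + field. exact N.
    + unfold W at 1. field. exact N.
  - intros x y Hx.
    destruct (Dlog_polar H g x y DH Hx) as [[A1 A2] _].
    destruct (Dlog_polar g h x y Dg Hx) as [[B1 B2] _].
    apply (is_derive_quotient (fun x => q1 x y * p1 x y + q2 x y * p2 x y) (fun x => W x y)).
    + apply W0.
    + apply (is_derive_bilinear (fun x => q1 x y) (fun x => p1 x y) (fun x => q2 x y) (fun x => p2 x y)); assumption.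
    + apply (DW (fun x => q1 x y) (fun x => q2 x y) x (p1 x y) (p2 x y)); assumption.
  - intros x y Hx.
    destruct (Dlog_polar H g x y DH Hx) as [_ [A1 A2]].
    destruct (Dlog_polar g h x y Dg Hx) as [_ [B1 B2]].
    apply (is_derive_quotient (fun y => q1 x y * p2 x y + (- q2 x y) * p1 x y) (fun y => W x y)).
    + apply W0.
    + apply (is_derive_bilinear (fun y => q1 x y) (fun y => p2 x y) (fun y => - q2 x y) (fun y => p1 x y)); try assumption.
      apply (is_derive_opp (V := R_NormedModule) (fun y => q2 x y)). assumption.
    + apply (DW (fun y => q1 x y) (fun y => q2 x y) y (- p2 x y) (p1 x y)); assumption.
  - intros x y Hx. now apply continuity_2d_energy_density.
  - intros x Hx. unfold W, q1, q2, p1, p2. now rewrite polar_2PI.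
Qed.

(** [g] is [z] times a derivative, so it vanishes at the origin and is of order [exp s] on the
    circle, while [H] stays bounded and the denominator is at least [b]. *)
Lemma energy_small : exists K d, 0 <= K /\ 0 < d /\ forall s, s < 0 -> exp s < d ->
  Rabs (RInt (fun t => energy_density b c (H (polar s t)) (g (polar s t))) 0 (2 * PI))
    <= K * exp s.
Proof.
  assert (PI0 := PI_RGT_0).
  destruct (DH (RtoC 0)) as (l & Hl & g0); [rewrite Cmod_0; lra|].
  destruct (Dg (RtoC 0)) as (m & Hm & _); [rewrite Cmod_0; lra|].
  destruct (cderiv_continuous_bound H _ l Hl) as (K & d & HK & Hd & HB).
  destruct (cderiv_continuous_bound g _ m Hm) as (K' & d' & HK' & Hd' & HB').
  assert (P0 := Cmod_ge_0 (H (RtoC 0))).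
  set (M := Cmod (H (RtoC 0)) + K).
  exists (2 * PI * (2 * M * K' / b)), (Rmin d d').
  assert (HM : 0 <= 2 * M * K' / b).
  { apply Rmult_le_pos; [|left; now apply Rinv_0_lt_compat].
    apply Rmult_le_pos; unfold M; lra. }
  split; [apply Rmult_le_pos; lra|]. split; [apply Rmin_glb_lt; lra|].
  intros s Hs He.
  assert (H1 := Rlt_le_trans _ _ _ He (Rmin_l d d')).
  assert (H2 := Rlt_le_trans _ _ _ He (Rmin_r d d')).
  rewrite Rmult_assoc. apply RInt_Rabs_le.
  { intros y. apply (continuity_2d_pt_section_r
      (fun x y => energy_density b c (H (polar x y)) (g (polar x y)))).
    now apply continuity_2d_energy_density. }
  intros y. generalize (HB (polar s y)) (HB' (polar s y)).
  rewrite !Cplus_0_l, Cmod_polar. intros T1 T2. specialize (T1 H1). specialize (T2 H2).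
  replace (g (RtoC 0)) with (RtoC 0) in T2 by (rewrite g0; ring).
  replace (g (polar s y) - 0)%C with (g (polar s y)) in T2 by ring.
  assert (Pe := exp_pos s).
  assert (T3 : Cmod (H (polar s y)) <= M).
  { replace (H (polar s y)) with ((H (polar s y) - H (RtoC 0)) + H (RtoC 0))%C by ring.
    eapply Rle_trans; [apply Cmod_triangle|]. unfold M. assert (exp s <= 1) by lra. nra. }
  unfold energy_density.
  assert (Q1 := Rabs_fst_le_Cmod (H (polar s y))). assert (Q2 := Rabs_snd_le_Cmod (H (polar s y))).
  assert (Q3 := Rabs_fst_le_Cmod (g (polar s y))). assert (Q4 := Rabs_snd_le_Cmod (g (polar s y))).
  assert (WP := density_denominator_pos b c (H (polar s y)) Hb Hc).
  assert (Wb : b <= b + c * (fst (H (polar s y)) * fst (H (polar s y)) + snd (H (polar s y)) * snd (H (polar s y)))).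
  { assert (0 <= fst (H (polar s y)) * fst (H (polar s y)) + snd (H (polar s y)) * snd (H (polar s y))) by nra. nra. }
  unfold Rdiv. rewrite Rabs_mult, (Rabs_pos_eq (/ _)) by (left; now apply Rinv_0_lt_compat).
  replace (2 * M * K' * / b * exp s) with (2 * (M * (K' * exp s)) * / b) by ring.
  apply Rmult_le_compat.
  - apply Rabs_pos.
  - left; now apply Rinv_0_lt_compat.
  - eapply Rle_trans; [apply Rabs_triang|]. rewrite !Rabs_mult.
    assert (Rabs (fst (H (polar s y))) * Rabs (fst (g (polar s y))) <= M * (K' * exp s))
      by (apply Rmult_le_compat; auto using Rabs_pos; lra).
    assert (Rabs (snd (H (polar s y))) * Rabs (snd (g (polar s y))) <= M * (K' * exp s))
      by (apply Rmult_le_compat; auto using Rabs_pos; lra).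
    lra.
  - now apply Rinv_le_contravar.
Qed.

(** The energy grows with the radius, the area density being nonnegative, and it starts from 0. In
    the flat case this gives the sign of the contribution of a tail. *)
Lemma energy_nonneg (s : R) : s < 0 ->
  0 <= RInt (fun t => energy_density b c (H (polar s t)) (g (polar s t))) 0 (2 * PI).
Proof.
  intros Hs. assert (PI0 := PI_RGT_0).
  destruct energy_small as (K & d & HK & Hd & HS).
  set (Y := RInt (fun t => energy_density b c (H (polar s t)) (g (polar s t))) 0 (2 * PI)) in *.
  apply Ropp_le_cancel. rewrite Ropp_0.
  apply (nonpos_of_small_exp_bound (- Y) K d s); auto. intros sm Hsm Hd'.
  assert (Inc := energy_increment sm s ltac:(lra) Hs). fold Y in Inc.
  assert (T := HS sm ltac:(lra) Hd').
  assert (CA : forall x y, x < 0 -> continuity_2d_pt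
    (fun x y => 2 * area_density b c (H (polar x y)) (g (polar x y))) x y).
  { intros x y Hx. apply continuity_2d_pt_mult; [apply continuity_2d_pt_const|].
    now apply continuity_2d_area_density. }
  assert (Pos : 0 <= RInt (fun s => RInt (fun t => 2 * area_density b c (H (polar s t)) (g (polar s t)))
    0 (2 * PI)) sm s).
  { apply RInt_ge_0; [lra| |].
    - apply (ex_RInt_continuous (V := R_CompleteNormedModule)). intros x Hx.
      rewrite Rmax_right in Hx by lra.
      apply (continuous_RInt_param_left
        (fun x y => 2 * area_density b c (H (polar x y)) (g (polar x y)))); auto; lra.
    - intros x Hx. apply RInt_ge_0; [lra| |].
      + apply ex_RInt_everywhere_continuous. intros y.
        apply (continuity_2d_pt_section_r
          (fun x y => 2 * area_density b c (H (polar x y)) (g (polar x y)))).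
        apply CA. lra.
      + intros y _. unfold area_density. apply Rmult_le_pos; [lra|].
        apply Rmult_le_pos; [apply Rmult_le_pos; [nra|lra]|].
        left. apply Rinv_0_lt_compat, pow_lt. now apply density_denominator_pos. }
  apply Rabs_le_between in T. lra.
Qed.

Lemma energy_upper (s A : R) : s < 0 ->
  (forall s0, s0 < s -> RInt (fun s => RInt (fun t =>
    area_density b c (H (polar s t)) (g (polar s t))) 0 (2 * PI)) s0 s <= A) ->
  RInt (fun t => energy_density b c (H (polar s t)) (g (polar s t))) 0 (2 * PI) <= 2 * A.
Proof.
  intros Hs HA. assert (PI0 := PI_RGT_0).
  destruct energy_small as (K & d & HK & Hd & HS).
  set (Y := RInt (fun t => energy_density b c (H (polar s t)) (g (polar s t))) 0 (2 * PI)) in *.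
  apply Rminus_le.
  apply (nonpos_of_small_exp_bound (Y - 2 * A) K d s); auto. intros sm Hsm Hd'.
  assert (Inc := energy_increment sm s ltac:(lra) Hs). fold Y in Inc.
  assert (T := HS sm ltac:(lra) Hd').
  assert (E2 : RInt (fun s => RInt (fun t => 2 * area_density b c (H (polar s t)) (g (polar s t)))
    0 (2 * PI)) sm s = 2 * RInt (fun s => RInt (fun t =>
    area_density b c (H (polar s t)) (g (polar s t))) 0 (2 * PI)) sm s).
  { transitivity (RInt (fun s => scal 2 (RInt (fun t =>
      area_density b c (H (polar s t)) (g (polar s t))) 0 (2 * PI))) sm s).
    - apply RInt_ext. intros x Hx. rewrite Rmax_right in Hx by lra.
      apply (RInt_scal (V := R_CompleteNormedModule)).
      apply ex_RInt_everywhere_continuous. intros y.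
      apply (continuity_2d_pt_section_r
        (fun x y => area_density b c (H (polar x y)) (g (polar x y)))).
      apply continuity_2d_area_density. lra.
    - apply (RInt_scal (V := R_CompleteNormedModule)).
      apply (ex_RInt_continuous (V := R_CompleteNormedModule)). intros x Hx.
      rewrite Rmax_right in Hx by lra.
      apply (continuous_RInt_param_left
        (fun x y => area_density b c (H (polar x y)) (g (polar x y)))); try lra.
      intros. now apply continuity_2d_area_density. }
  rewrite E2 in Inc. assert (HA' := HA sm ltac:(lra)).
  apply Rabs_le_between in T. lra.
Qed.

End energy.

(** * The spherical metric and its total mass *)

Definition sqmod (z : C) : R := fst z * fst z + snd z * snd z.

Lemma sqmod_Cmod (z : C) : sqmod z = Cmod z ^ 2.
Proof. unfold sqmod, Cmod. rewrite pow2_sqrt; [ring|]. nra. Qed.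

Definition spherical_density (tau u v : R) : R := tau / (tau + (u * u + v * v)) ^ 2.

Lemma continuity_2d_spherical_density (tau u v : R) : 0 < tau ->
  continuity_2d_pt (spherical_density tau) u v.
Proof.
  intros Ht. unfold spherical_density. apply continuity_2d_pt_mult; [apply continuity_2d_pt_const|].
  apply continuity_2d_pt_inv.
  - simpl. repeat (apply continuity_2d_pt_plus || apply continuity_2d_pt_mult ||
      apply continuity_2d_pt_id1 || apply continuity_2d_pt_id2 || apply continuity_2d_pt_const).
  - apply pow_nonzero. nra.
Qed.

Lemma atan_lower (y : R) : 0 <= y -> y / (1 + y ^ 2) <= atan y.
Proof.
  intros Hy. destruct (Req_dec y 0) as [->|Hn]; [rewrite atan_0; right; field; lra|].
  destruct (MVT_gen atan 0 y (fun x => / (1 + x ^ 2))) as (x & Hx & E).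
  - intros x _. auto_derive; [exact I|]. unfold Rsqr. field. nra.
  - intros x _. apply derivable_continuous_pt, derivable_pt_atan.
  - rewrite Rmin_left, Rmax_right in Hx by lra. rewrite atan_0, !Rminus_0_r in E. rewrite E.
    unfold Rdiv. rewrite Rmult_comm. apply Rmult_le_compat_r; [lra|].
    apply Rinv_le_contravar; nra.
Qed.

(** The left side is the primitive of 2 / (1 + x^2)^2 and tends to [PI / 2]; [atan_lower] at [/ x]
    gives the bound for each finite [x]. *)
Lemma atan_upper (x : R) : 0 < x -> x / (1 + x ^ 2) + atan x <= PI / 2.
Proof.
  intros Hx. generalize (atan_lower (/ x) ltac:(left; now apply Rinv_0_lt_compat)).
  rewrite atan_inv by auto.
  replace (/ x / (1 + (/ x) ^ 2)) with (x / (1 + x ^ 2)); [lra|]. field. split; nra.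
Qed.

(** The right side is the integral over the whole line. *)
Lemma spherical_inner_bound (tau u N : R) : 0 < tau -> 0 < N ->
  RInt (spherical_density tau u) (- N) N <= PI / 2 * tau / ((tau + u * u) * sqrt (tau + u * u)).
Proof.
  intros Ht HN. assert (HA : 0 < tau + u * u) by nra.
  set (A := sqrt (tau + u * u)). assert (PA : 0 < A) by now apply sqrt_lt_R0.
  assert (EA : tau + u * u = A * A) by (unfold A; now rewrite sqrt_sqrt by lra).
  rewrite EA.
  set (F := fun v => tau * (v / (2 * (A * A) * (A * A + v * v)) + atan (v / A) / (2 * (A * A * A)))).
  assert (E : RInt (spherical_density tau u) (- N) N = F N - F (- N)).
  { apply (is_RInt_unique (V := R_CompleteNormedModule)).
    apply (is_RInt_derive F (spherical_density tau u)).
    - intros v _. unfold F, spherical_density. rewrite <- Rplus_assoc, EA. auto_derive.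
      + repeat split; nra.
      + field. repeat split; nra.
    - intros v _. apply continuity_2d_pt_section_r. now apply continuity_2d_spherical_density. }
  rewrite E. unfold F.
  replace (- N / A) with (- (N / A)) by (field; lra). rewrite atan_opp.
  assert (U := atan_upper (N / A) ltac:(apply Rdiv_lt_0_compat; lra)).
  assert (P3 : 0 < tau / (A * A * A)) by (apply Rdiv_lt_0_compat; nra).
  apply Rmult_le_compat_l with (r := tau / (A * A * A)) in U; [|lra].
  eapply Rle_trans; [|eapply Rle_trans; [exact U|]]; right; field; repeat split; nra.
Qed.

(** [PI] is the mass of the whole plane for each [tau]. The bound is uniform in [N], so the box of
    the double count may be chosen as large as the image requires. *)
Lemma spherical_mass (tau N : R) : 0 < tau -> 0 < N ->
  RInt (fun u => RInt (spherical_density tau u) (- N) N) (- N) N <= PI.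
Proof.
  intros Ht HN. assert (PI0 := PI_RGT_0).
  set (G := fun u => PI / 2 * (u / sqrt (tau + u * u))).
  set (g := fun u => PI / 2 * tau / ((tau + u * u) * sqrt (tau + u * u))).
  assert (Dg : forall u, is_derive G u (g u)).
  { intros u. assert (HA : 0 < tau + u * u) by nra.
    assert (PA : 0 < sqrt (tau + u * u)) by now apply sqrt_lt_R0.
    assert (EA := sqrt_sqrt (tau + u * u) ltac:(lra)).
    unfold G, g. auto_derive; [repeat split; lra|].
    set (A := sqrt (tau + u * u)) in *.
    assert (E2 : tau = A * A - u * u) by lra.
    rewrite <- EA. field_simplify; [|lra|lra]. rewrite E2. field. lra. }
  assert (Cg : forall u, continuous g u).
  { intros u. apply (ex_derive_continuous (V := R_NormedModule) g).
    assert (HA : 0 < tau + u * u) by nra.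
    assert (PA : 0 < sqrt (tau + u * u)) by now apply sqrt_lt_R0.
    unfold g. auto_derive. repeat split; nra. }
  assert (E : RInt g (- N) N = G N - G (- N)).
  { apply (is_RInt_unique (V := R_CompleteNormedModule)).
    apply (is_RInt_derive G g); intros; [apply Dg|apply Cg]. }
  eapply Rle_trans; [apply (RInt_le _ g)|].
  - lra.
  - apply ex_RInt_everywhere_continuous. intros u.
    apply continuous_RInt_param_everywhere; [|lra].
    intros; now apply continuity_2d_spherical_density.
  - now apply ex_RInt_everywhere_continuous.
  - intros u _. now apply spherical_inner_bound.
  - rewrite E. unfold G. replace (- N * - N) with (N * N) by ring.
    assert (PA : 0 < sqrt (tau + N * N)) by (apply sqrt_lt_R0; nra).
    assert (Q : N / sqrt (tau + N * N) <= 1).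
    { apply Rmult_le_reg_r with (sqrt (tau + N * N)); auto.
      unfold Rdiv. rewrite Rmult_assoc, Rinv_l, Rmult_1_l, Rmult_1_r by lra.
      rewrite <- (sqrt_square N) at 1 by lra. apply sqrt_le_1; nra. }
    replace (- N / sqrt (tau + N * N)) with (- (N / sqrt (tau + N * N))) by (field; lra).
    nra.
Qed.

Lemma Cmod_lt_sq (x y r : R) : 0 < r -> x ^ 2 + y ^ 2 < r ^ 2 -> Cmod (x, y) < r.
Proof.
  intros Hr H. unfold Cmod; simpl fst; simpl snd.
  rewrite <- (sqrt_pow2 r) by lra. apply sqrt_lt_1; nra.
Qed.

Lemma sq_lt_Cmod (x y r : R) : Cmod (x, y) < r -> x ^ 2 + y ^ 2 < r ^ 2.
Proof.
  intros H. assert (P := Cmod_ge_0 (x, y)).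
  assert (E := sqmod_Cmod (x, y)). unfold sqmod in E; simpl fst in E; simpl snd in E. nra.
Qed.

Lemma spherical_density_perturb (tau d : R) (w z : C) : 0 < tau -> 0 < d <= 1 ->
  Cmod (w - z) < d ->
  spherical_density tau (fst z) (snd z) <=
  (1 + (1 + 2 / tau) * d) ^ 2 * spherical_density tau (fst w) (snd w).
Proof.
  intros Ht Hd Hwz. unfold spherical_density.
  change (fst z * fst z + snd z * snd z) with (sqmod z).
  change (fst w * fst w + snd w * snd w) with (sqmod w). rewrite !sqmod_Cmod.
  assert (Pw := Cmod_ge_0 w). assert (Pz := Cmod_ge_0 z).
  assert (T : Cmod w <= Cmod z + d).
  { replace w with (z + (w - z))%C by ring.
    eapply Rle_trans; [apply Cmod_triangle|]. lra. }
  set (x := Cmod z) in *. set (y := Cmod w) in *.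
  assert (P2 : 0 < 2 / tau) by (apply Rdiv_lt_0_compat; lra).
  (* From 2 x d <= (1 + x^2) d and d^2 <= d follows y^2 <= x^2 + d x^2 + 2 d. The term d x^2
     accounts for the 1 in the coefficient of [d], and the term 2 d for [2 / tau]. *)
  set (k := 1 + (1 + 2 / tau) * d).
  assert (Hk : tau + y ^ 2 <= k * (tau + x ^ 2)).
  { assert (y ^ 2 <= x ^ 2 * (1 + d) + 2 * d).
    { assert (y ^ 2 <= (x + d) ^ 2) by (apply pow_incr; lra).
      assert (2 * x * d <= (1 + x ^ 2) * d) by (apply Rmult_le_compat_r; generalize (pow2_ge_0 (x - 1)); lra).
      assert (d ^ 2 <= d) by nra. assert ((x + d) ^ 2 = x ^ 2 + 2 * x * d + d ^ 2) by ring. lra. }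
    unfold k.
    replace ((1 + (1 + 2 / tau) * d) * (tau + x ^ 2))
      with (tau + x ^ 2 + d * tau + d * x ^ 2 + 2 * d + 2 / tau * d * x ^ 2) by (field; lra).
    assert (0 <= 2 / tau * d * x ^ 2) by (apply Rmult_le_pos; [nra|apply pow2_ge_0]). nra. }
  assert (Hk0 : 0 < k) by (unfold k; nra).
  assert (Q1 : 0 < tau + x ^ 2) by nra. assert (Q2 : 0 < tau + y ^ 2) by nra.
  apply Rmult_le_reg_r with ((tau + x ^ 2) ^ 2 * (tau + y ^ 2) ^ 2); [apply Rmult_lt_0_compat; now apply pow_lt|].
  replace (tau / (tau + x ^ 2) ^ 2 * ((tau + x ^ 2) ^ 2 * (tau + y ^ 2) ^ 2))
    with (tau * (tau + y ^ 2) ^ 2) by (field; lra).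
  replace (k ^ 2 * (tau / (tau + y ^ 2) ^ 2) * ((tau + x ^ 2) ^ 2 * (tau + y ^ 2) ^ 2))
    with (tau * (k * (tau + x ^ 2)) ^ 2) by (field; lra).
  apply Rmult_le_compat_l; [lra|]. apply pow_incr. lra.
Qed.

(** A convex function lies below its chord on [0, 1], and 63 = 2^6 - 1. The sixth power is the loss
    factor of the packing. *)
Lemma pow6_linear_bound (t : R) : 0 <= t <= 1 -> (1 + t) ^ 6 <= 1 + 63 * t.
Proof.
  intros Ht. assert (A : (1 + t) ^ 2 <= 1 + 3 * t) by nra.
  assert (B : ((1 + t) ^ 2) ^ 3 <= (1 + 3 * t) ^ 3) by (apply pow_incr; split; [apply pow2_ge_0|exact A]).
  assert (D : (1 + 3 * t) ^ 3 <= 1 + 63 * t).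
  { assert (t ^ 2 <= t) by nra. assert (t ^ 3 <= t) by nra. nra. }
  rewrite <- pow_mult in B. simpl Nat.mul in B. lra.
Qed.

(* Subtracting [alpha ^ 2] confines the packing to points where [q'] is bounded
   away from [0], so that no information on the zeros of [q'] is required. *)
Definition truncated_area_density (tau alpha : R) (q q' : C) : R :=
  Rmax (sqmod q' - alpha ^ 2) 0 * spherical_density tau (fst q) (snd q).

Lemma continuity_2d_Rmax0 (f : R -> R -> R) (x y : R) :
  continuity_2d_pt f x y -> continuity_2d_pt (fun u v => Rmax (f u v) 0) x y.
Proof.
  intros Hf eps. destruct (Hf eps) as [del Hdel]. exists del. intros u v Hu Hv.
  eapply Rle_lt_trans; [|apply (Hdel u v Hu Hv)].
  unfold Rmax. destruct (Rle_dec (f u v) 0), (Rle_dec (f x y) 0);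
    unfold Rabs; repeat destruct Rcase_abs; lra.
Qed.

Lemma continuity_2d_truncated_area_density (q q' : R -> R -> C) (tau alpha x y : R) : 0 < tau ->
  continuity_2d_pt (fun x y => fst (q x y)) x y -> continuity_2d_pt (fun x y => snd (q x y)) x y ->
  continuity_2d_pt (fun x y => fst (q' x y)) x y -> continuity_2d_pt (fun x y => snd (q' x y)) x y ->
  continuity_2d_pt (fun x y => truncated_area_density tau alpha (q x y) (q' x y)) x y.
Proof.
  intros Ht A1 A2 B1 B2. apply continuity_2d_pt_mult.
  - apply (continuity_2d_Rmax0 (fun x y => sqmod (q' x y) - alpha ^ 2)).
    apply continuity_2d_pt_minus; [|apply continuity_2d_pt_const].
    apply continuity_2d_pt_plus; apply continuity_2d_pt_mult; assumption.
  - unfold spherical_density. apply continuity_2d_pt_mult; [apply continuity_2d_pt_const|].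
    apply continuity_2d_pt_inv.
    + simpl. repeat (apply continuity_2d_pt_plus || apply continuity_2d_pt_mult ||
        apply continuity_2d_pt_const); assumption.
    + apply pow_nonzero. nra.
Qed.

(** * Packing: the mass of an injective image *)

Section packing.
Variables (q q' : R -> R -> C) (a b c d L : R).
Hypothesis Hab : a < b.
Hypothesis Hcd : c < d.
Hypothesis HL : 0 < L.
Hypothesis Cq1 : forall x y, continuity_2d_pt (fun x y => fst (q x y)) x y.
Hypothesis Cq2 : forall x y, continuity_2d_pt (fun x y => snd (q x y)) x y.
Hypothesis Cp1 : forall x y, continuity_2d_pt (fun x y => fst (q' x y)) x y.
Hypothesis Cp2 : forall x y, continuity_2d_pt (fun x y => snd (q' x y)) x y.

Let Q (x y : R) := a <= x <= b /\ c <= y <= d.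

Hypothesis Taylor : forall x y u v, Q x y -> Q u v ->
  Cmod (q x y - q u v - q' u v * ((x - u)%R, (y - v)%R)) <= L * Cmod ((x - u)%R, (y - v)%R) ^ 2.
Hypothesis Lip : forall x y u v, Q x y -> Q u v ->
  Cmod (q' x y - q' u v) <= L * Cmod ((x - u)%R, (y - v)%R).
Hypothesis Inj : forall x y u v, Q x y -> Q u v -> q x y = q u v -> x = u /\ y = v.

Lemma packing_bounded : exists B, 0 < B /\ forall x y, Q x y -> Cmod (q x y) <= B.
Proof.
  set (D := (b - a) + (d - c)).
  assert (P1 := Cmod_ge_0 (q a c)). assert (P2 := Cmod_ge_0 (q' a c)).
  assert (HD : 0 < D) by (unfold D; lra).
  exists (Cmod (q a c) + Cmod (q' a c) * D + L * D ^ 2). split; [|].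
  { assert (0 < L * D ^ 2) by (apply Rmult_lt_0_compat; [auto|nra]). nra. }
  intros x y HQ. assert (Qa : Q a c) by (unfold Q; lra).
  assert (T := Taylor x y a c HQ Qa).
  set (h := ((x - a)%R, (y - c)%R)) in *.
  assert (Hh : Cmod h <= D).
  { eapply Rle_trans; [apply Cmod_le_sum|]. unfold h; simpl. unfold Q in HQ.
    rewrite !Rabs_pos_eq by lra. unfold D. lra. }
  assert (Ph := Cmod_ge_0 h).
  replace (q x y) with ((q x y - q a c - q' a c * h) + (q a c + q' a c * h))%C by ring.
  eapply Rle_trans; [apply Cmod_triangle|].
  assert (T2 := Cmod_triangle (q a c) (q' a c * h)). rewrite Cmod_mult in T2.
  assert (Cmod h ^ 2 <= D ^ 2) by (apply pow_incr; lra). nra.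
Qed.

(* The points of the rectangle sent into a disc of radius [del] lie in a single
   disc of radius about [del / |q'|]: injectivity and compactness bring them
   together, Taylor's formula gives the radius. *)
Lemma packing_local (tau alpha : R) : 0 < tau -> 0 < alpha ->
  exists K d0, 0 < K /\ 0 < d0 <= 1 /\ forall del u v, 0 < del < d0 ->
  exists j r x1 y1, 0 <= j /\ 0 < r /\
    j * r ^ 2 <= del ^ 2 * (1 + K * del) ^ 6 * spherical_density tau u v /\
    forall x y, a <= x <= b -> c <= y <= d -> 0 < sqmod (q' x y) - alpha ^ 2 ->
      (u - fst (q x y)) ^ 2 + (v - snd (q x y)) ^ 2 < del ^ 2 ->
      (x - x1) ^ 2 + (y - y1) ^ 2 < r ^ 2 /\
      truncated_area_density tau alpha (q x y) (q' x y) <= j.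
Proof.
  intros Ht Ha.
  (* Within distance [e0] the quadratic Taylor remainder is at most half the linear term, whose
     coefficient exceeds [alpha] in modulus. *)
  set (e0 := alpha / (2 * L)). assert (He0 : 0 < e0) by (apply Rdiv_lt_0_compat; lra).
  destruct (@Lebesgue.injective_separated_R (fun x y => fst (q x y)) (fun x y => snd (q x y)) a b c d (e0 ^ 2))
    as (m & Hm & Sep); auto.
  { now apply pow_lt. }
  { intros x y u v H1 H2 H3 H4 E1 E2. apply Inj; unfold Q; auto.
    destruct (q x y), (q u v); simpl in *; congruence. }
  assert (Pt : 0 < 2 / tau) by (apply Rdiv_lt_0_compat; lra).
  assert (PL : 0 < 16 * L / alpha ^ 2) by (apply Rdiv_lt_0_compat; [lra|now apply pow_lt]).
  set (K := 16 * L / alpha ^ 2 + (1 + 2 / tau)).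
  (* Two points sent within [del] of the same [w] have images closer than [2 * del]. This bound on
     [del] puts that below [sqrt m], so that [Sep] forces the points within [e0] of each other. *)
  exists K, (Rmin 1 (sqrt m / 2)).
  assert (Psm : 0 < sqrt m) by now apply sqrt_lt_R0.
  split; [unfold K; lra|]. split; [split; [apply Rmin_glb_lt; lra|apply Rmin_l]|].
  intros del u v Hdel.
  assert (D1 : del < 1) by (eapply Rlt_le_trans; [apply Hdel|apply Rmin_l]).
  assert (D2 : del < sqrt m / 2) by (eapply Rlt_le_trans; [apply Hdel|apply Rmin_r]).
  assert (D3 : (2 * del) ^ 2 < m).
  { rewrite <- (sqrt_sqrt m) by lra. nra. }
  assert (chi0 : 0 < spherical_density tau u v).
  { unfold spherical_density. apply Rdiv_lt_0_compat; auto. apply pow_lt. nra. }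
  assert (PK : 0 <= del ^ 2 * (1 + K * del) ^ 6).
  { apply Rmult_le_pos; [apply pow2_ge_0|]. apply pow_le. unfold K. nra. }
  (* If no admissible point is sent near [(u, v)], the weight [j = 0] serves; otherwise any such
     point fixes the centre and the scale of the disc. *)
  destruct (classic (exists x y, Q x y /\ 0 < sqmod (q' x y) - alpha ^ 2 /\
    (u - fst (q x y)) ^ 2 + (v - snd (q x y)) ^ 2 < del ^ 2)) as [(x0 & y0 & HQ0 & Hg0 & Hd0)|Hno].
  2:{ exists 0, 1, 0, 0. split; [lra|]. split; [lra|]. split; [nra|].
      intros x y Hx Hy Hg Hd'. exfalso. apply Hno. exists x, y. unfold Q. auto. }
  set (w := (u, v) : C).
  assert (close : forall x y, (u - fst (q x y)) ^ 2 + (v - snd (q x y)) ^ 2 < del ^ 2 ->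
    Cmod (w - q x y) < del).
  { intros x y H. assert (T := Cmod_lt_sq _ _ del ltac:(lra) H).
    replace (w - q x y)%C with ((u - fst (q x y))%R, (v - snd (q x y))%R); auto. }
  assert (Hw0 := close x0 y0 Hd0).
  set (A := Cmod (q' x0 y0)). assert (PA0 := Cmod_ge_0 (q' x0 y0)). fold A in PA0.
  assert (HA : alpha < A).
  { rewrite sqmod_Cmod in Hg0. fold A in Hg0. nra. }
  assert (Hn : q' x0 y0 <> 0) by (apply Cmod_gt_0; fold A; lra).
  (* [k1] absorbs both the Taylor remainder in the radius and the variation of [q']; [k2] absorbs
     the variation of the density. The radius enters squared, hence the total loss
     [k1 ^ 4 * k2 ^ 2]. *)
  set (k1 := 1 + 16 * L / alpha ^ 2 * del). set (k2 := 1 + (1 + 2 / tau) * del).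
  assert (Hk1 : 1 <= k1 <= 1 + K * del) by (unfold k1, K; split; nra).
  assert (Hk2 : 1 <= k2 <= 1 + K * del) by (unfold k2, K; split; nra).
  (* The preimage of [w] under the linearisation of [q] at the chosen point, that is, one Newton
     step. *)
  set (p1 := ((x0, y0) + (w - q x0 y0) / q' x0 y0)%C).
  exists (A ^ 2 * k1 ^ 2 * k2 ^ 2 * spherical_density tau u v), (del * k1 / A), (fst p1), (snd p1).
  split.
  { apply Rmult_le_pos; [|lra]. repeat apply Rmult_le_pos; lra. }
  split; [apply Rdiv_lt_0_compat; [apply Rmult_lt_0_compat; lra|lra]|].
  split.
  { replace (A ^ 2 * k1 ^ 2 * k2 ^ 2 * spherical_density tau u v * (del * k1 / A) ^ 2)
      with (del ^ 2 * (k1 ^ 4 * k2 ^ 2) * spherical_density tau u v) by (field; lra).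
    apply Rmult_le_compat_r; [lra|]. apply Rmult_le_compat_l; [apply pow2_ge_0|].
    replace ((1 + K * del) ^ 6) with ((1 + K * del) ^ 4 * (1 + K * del) ^ 2) by ring.
    apply Rmult_le_compat; try (apply pow_le; lra); apply pow_incr; lra. }
  intros x y Hx Hy Hg Hd'. assert (HQ : Q x y) by (unfold Q; auto).
  assert (Hw := close x y Hd').
  set (h := ((x - x0)%R, (y - y0)%R) : C). assert (Ph := Cmod_ge_0 h).
  assert (Hqq : Cmod (q x y - q x0 y0) < 2 * del).
  { replace (q x y - q x0 y0)%C with ((w - q x0 y0) - (w - q x y))%C by ring.
    eapply Rle_lt_trans; [apply Cmod_minus_triangle|]. lra. }
  assert (Hh1 : Cmod h < e0).
  { apply Rnot_le_lt. intros Hge.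
    assert (S' := Sep x y x0 y0 Hx Hy (proj1 HQ0) (proj2 HQ0)). simpl in S'.
    assert (E1 : e0 ^ 2 <= (x - x0) ^ 2 + (y - y0) ^ 2).
    { assert (E := sqmod_Cmod h). unfold sqmod, h in E; simpl fst in E; simpl snd in E.
      assert (e0 ^ 2 <= Cmod h ^ 2) by (apply pow_incr; lra).
      fold h in E. lra. }
    specialize (S' ltac:(simpl in E1; exact E1)).
    assert (E := sqmod_Cmod (q x y - q x0 y0)). unfold sqmod in E.
    assert (P := Cmod_ge_0 (q x y - q x0 y0)).
    assert (Cmod (q x y - q x0 y0) ^ 2 < (2 * del) ^ 2) by (simpl; nra).
    simpl in E, S'. nra. }
  assert (T := Taylor x y x0 y0 HQ HQ0). fold h in T.
  set (e := (q x y - q x0 y0 - q' x0 y0 * h)%C) in *.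
  assert (LH : L * Cmod h <= A / 2).
  { assert (L * e0 = alpha / 2) by (unfold e0; field; lra). nra. }
  assert (Hh2 : A * Cmod h <= 4 * del).
  { assert (Cmod (q' x0 y0 * h) <= Cmod (q x y - q x0 y0) + Cmod e).
    { replace (q' x0 y0 * h)%C with ((q x y - q x0 y0) - e)%C by (unfold e; ring).
      apply Cmod_minus_triangle. }
    rewrite Cmod_mult in H. fold A in H.
    assert (L * Cmod h ^ 2 <= A / 2 * Cmod h) by nra. nra. }
  assert (Hh3 : Cmod h <= 4 * del / A).
  { apply Rmult_le_reg_l with A; [lra|]. replace (A * (4 * del / A)) with (4 * del) by (field; lra). lra. }
  assert (Ia : / A < / alpha) by (apply Rinv_lt_contravar; nra).
  assert (IA : 0 < / A) by (apply Rinv_0_lt_compat; lra).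
  assert (Iaa : / A ^ 2 <= / alpha ^ 2).
  { apply Rinv_le_contravar; [now apply pow_lt|]. apply pow_incr; lra. }
  assert (He : Cmod e <= 16 * L / alpha ^ 2 * del * del).
  { eapply Rle_trans; [exact T|].
    apply Rle_trans with (L * (4 * del / A) ^ 2).
    - apply Rmult_le_compat_l; [lra|]. apply pow_incr; lra.
    - replace (L * (4 * del / A) ^ 2) with (16 * L * del * del * / A ^ 2) by (field; lra).
      replace (16 * L / alpha ^ 2 * del * del) with (16 * L * del * del * / alpha ^ 2) by (field; lra).
      apply Rmult_le_compat_l; [|exact Iaa]. repeat apply Rmult_le_pos; lra. }
  split.
  - apply sq_lt_Cmod.
    replace ((x - fst p1)%R, (y - snd p1)%R) with ((q x y - w - e) / q' x0 y0)%C.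
    + rewrite Cmod_div by auto. fold A. unfold Rdiv. apply Rmult_lt_compat_r; auto.
      eapply Rle_lt_trans; [apply Cmod_minus_triangle|].
      replace (q x y - w)%C with (- (w - q x y))%C by ring. rewrite Cmod_opp.
      unfold k1. nra.
    + transitivity ((x, y) - p1)%C; [|reflexivity].
      replace (x, y) with ((x0, y0) + h)%C
        by (unfold h, Cplus; simpl; f_equal; ring).
      unfold p1, e. field. exact Hn.
  - unfold truncated_area_density.
    assert (Hq' : Cmod (q' x y) <= A * k1).
    { replace (q' x y) with (q' x0 y0 + (q' x y - q' x0 y0))%C by ring.
      eapply Rle_trans; [apply Cmod_triangle|]. fold A.
      assert (T2 := Lip x y x0 y0 HQ HQ0). fold h in T2.
      assert (L * Cmod h <= L * (4 * del / A)) by (apply Rmult_le_compat_l; lra).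
      assert (L * (4 * del / A) <= A * (16 * L / alpha ^ 2 * del)).
      { replace (L * (4 * del / A)) with (A * (4 * L * del * / A ^ 2)) by (field; lra).
        replace (A * (16 * L / alpha ^ 2 * del)) with (A * (16 * L * del * / alpha ^ 2)) by (field; lra).
        apply Rmult_le_compat_l; [lra|]. apply Rmult_le_compat; try lra.
        - repeat apply Rmult_le_pos; lra.
        - left. apply Rinv_0_lt_compat, pow_lt. lra.
        - assert (0 < L * del) by nra. nra. }
      unfold k1. lra. }
    assert (Hs : spherical_density tau (fst (q x y)) (snd (q x y)) <=
      k2 ^ 2 * spherical_density tau u v).
    { apply (spherical_density_perturb tau del w (q x y)); auto. lra. }
    replace (A ^ 2 * k1 ^ 2 * k2 ^ 2 * spherical_density tau u v)
      with ((A * k1) ^ 2 * (k2 ^ 2 * spherical_density tau u v)) by ring.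
    apply Rmult_le_compat; auto.
    + apply Rmax_r.
    + unfold spherical_density. left. apply Rdiv_lt_0_compat; auto. apply pow_lt. nra.
    + rewrite sqmod_Cmod. apply Rmax_lub; [|apply pow2_ge_0].
      assert (Cmod (q' x y) ^ 2 <= (A * k1) ^ 2) by (apply pow_incr; split; [apply Cmod_ge_0|exact Hq']).
      assert (0 <= alpha ^ 2) by apply pow2_ge_0. lra.
Qed.

(** Both counts are proportional to [del ^ 2]; after division by it only the loss factor remains,
    and this tends to 1 with [del]. *)
Lemma packing_truncated (tau alpha : R) : 0 < tau -> 0 < alpha ->
  RInt (fun x => RInt (fun y => truncated_area_density tau alpha (q x y) (q' x y)) c d) a b <= PI.
Proof.
  intros Ht Ha. assert (PI0 := PI_RGT_0).
  destruct (packing_local tau alpha Ht Ha) as (K & d0 & HK & Hd0 & Loc).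
  destruct packing_bounded as (B & HB & HB').
  set (X := RInt (fun x => RInt (fun y => truncated_area_density tau alpha (q x y) (q' x y)) c d) a b).
  assert (Cg : forall x y, continuity_2d_pt (fun x y => sqmod (q' x y) - alpha ^ 2) x y).
  { intros x y. apply continuity_2d_pt_minus; [|apply continuity_2d_pt_const].
    apply continuity_2d_pt_plus; apply continuity_2d_pt_mult; auto. }
  assert (CJ : forall x y, continuity_2d_pt
    (fun x y => truncated_area_density tau alpha (q x y) (q' x y)) x y).
  { intros x y. now apply continuity_2d_truncated_area_density. }
  assert (sd0 : forall u v, 0 <= spherical_density tau u v).
  { intros u v. left. unfold spherical_density. apply Rdiv_lt_0_compat; auto. apply pow_lt. nra. }
  assert (Main : forall del, 0 < del < d0 -> X <= (1 + K * del) ^ 6 * PI).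
  { intros del Hdel.
    set (N := B + 1).
    assert (E := @Lebesgue.plane_double_counting_R (fun x y => fst (q x y)) (fun x y => snd (q x y))
      (fun x y => truncated_area_density tau alpha (q x y) (q' x y)) (spherical_density tau)
      (fun x y => sqmod (q' x y) - alpha ^ 2) a b c d N del (del ^ 2 * (1 + K * del) ^ 6)).
    assert (P6 : 0 <= (1 + K * del) ^ 6) by (apply pow_le; nra).
    assert (Pd : 0 < del ^ 2) by (apply pow_lt; lra).
    assert (E' : del ^ 2 * X <= del ^ 2 * (1 + K * del) ^ 6 *
      RInt (fun u => RInt (spherical_density tau u) (- N) N) (- N) N).
    { apply E; auto.
      - intros; now apply continuity_2d_spherical_density.
      - intros. apply Rmult_le_pos; [apply Rmax_r|apply sd0].
      - lra.
      - unfold N; lra.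
      - apply Rmult_le_pos; lra.
      - intros x y _ _ Hg. unfold truncated_area_density. rewrite Rmax_right by auto. ring.
      - intros x y Hx Hy. assert (T := HB' x y (conj Hx Hy)). unfold N.
        split; (eapply Rle_trans; [|eapply Rle_trans; [exact T|lra]]);
          [apply Rabs_fst_le_Cmod|apply Rabs_snd_le_Cmod]. }
    apply Rmult_le_reg_l with (del ^ 2); auto.
    eapply Rle_trans; [exact E'|]. rewrite Rmult_assoc.
    apply Rmult_le_compat_l; [lra|]. apply Rmult_le_compat_l; [exact P6|].
    apply spherical_mass; unfold N; lra. }
  assert (P1 : 0 < / K) by now apply Rinv_0_lt_compat.
  apply Rminus_le.
  apply (nonpos_of_small_linear_bound (X - PI) (63 * K * PI) (Rmin d0 (/ K))).
  - apply Rmult_le_pos; lra.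
  - apply Rmin_glb_lt; lra.
  - intros del Hdel. assert (Q1 := Rmin_l d0 (/ K)). assert (Q2 := Rmin_r d0 (/ K)).
    assert (L2 : K * del <= K * / K) by (apply Rmult_le_compat_l; lra).
    rewrite Rinv_r in L2 by lra.
    assert (T := Main del ltac:(lra)).
    assert (B6 := pow6_linear_bound (K * del) ltac:(split; [nra|lra])).
    apply Rmult_le_compat_r with (r := PI) in B6; lra.
Qed.
End packing.

(** * Estimates in polar coordinates *)

Lemma polar_plus (s s' t t' : R) : polar (s + s') (t + t') = (polar s t * polar s' t')%C.
Proof.
  unfold polar, Cmult. simpl. rewrite exp_plus, cos_plus, sin_plus. f_equal; ring.
Qed.

Lemma one_minus_cos (k : R) : 1 - cos k = 2 * sin (k / 2) ^ 2.
Proof.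
  replace (cos k) with (cos (2 * (k / 2))) by (f_equal; field).
  rewrite cos_2a_sin. ring.
Qed.

Lemma Rabs_sin_le (k : R) : Rabs (sin k) <= Rabs k.
Proof.
  assert (P : forall x, 0 <= x -> Rabs (sin x) <= x).
  { intros x Hx. destruct (Req_dec x 0) as [->|Hn]; [rewrite sin_0, Rabs_R0; lra|].
    destruct (Rle_lt_dec x 1) as [H1|H1].
    - rewrite Rabs_pos_eq; [left; apply sin_lt_x; lra|].
      apply sin_ge_0; [lra|]. assert (A := PI2_1). lra.
    - assert (B := SIN_bound x). apply Rabs_le. lra. }
  destruct (Rle_lt_dec 0 k) as [H|H].
  - rewrite (Rabs_pos_eq k) by auto. now apply P.
  - rewrite <- (Rabs_Ropp (sin k)), <- sin_neg, <- (Rabs_Ropp k), (Rabs_pos_eq (- k)) by lra.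
    apply P. lra.
Qed.

Lemma Rabs_cos_minus_1_sq (k : R) : Rabs (cos k - 1) <= k ^ 2 / 2.
Proof.
  rewrite <- Rabs_Ropp. replace (- (cos k - 1)) with (1 - cos k) by ring.
  rewrite one_minus_cos. assert (S := Rabs_sin_le (k / 2)).
  rewrite Rabs_pos_eq by (generalize (pow2_ge_0 (sin (k / 2))); lra).
  apply pow_maj_Rabs with (n := 2%nat) in S. rewrite pow2_abs in S.
  replace (k ^ 2 / 2) with (2 * (k / 2) ^ 2) by field. lra.
Qed.

Lemma Rabs_cos_minus_1 (k : R) : Rabs (cos k - 1) <= Rabs k.
Proof.
  rewrite <- Rabs_Ropp. replace (- (cos k - 1)) with (1 - cos k) by ring.
  rewrite one_minus_cos. assert (S := Rabs_sin_le (k / 2)).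
  assert (B := SIN_bound (k / 2)).
  rewrite Rabs_pos_eq by (generalize (pow2_ge_0 (sin (k / 2))); lra).
  assert (Rabs (sin (k / 2)) <= 1) by (apply Rabs_le; lra).
  replace (sin (k / 2) ^ 2) with (Rabs (sin (k / 2)) ^ 2) by apply pow2_abs.
  assert (P := Rabs_pos (sin (k / 2))).
  unfold Rdiv in S at 2. rewrite Rabs_mult, (Rabs_pos_eq (/ 2)) in S by lra. nra.
Qed.

Lemma Rabs_sin_minus_id (k : R) : Rabs (sin k - k) <= k ^ 2.
Proof.
  destruct (MVT_gen (fun x => sin x - x) 0 k (fun x => cos x - 1)) as (x & Hx & E).
  - intros x _. auto_derive; [exact I|ring].
  - intros x _. apply derivable_continuous_pt, derivable_pt_minus;
      [apply derivable_pt_sin|apply derivable_pt_id].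
  - rewrite sin_0, !Rminus_0_r in E. rewrite E, Rabs_mult.
    assert (Rabs x <= Rabs k).
    { unfold Rmin, Rmax in Hx. destruct (Rle_dec 0 k) in Hx;
        unfold Rabs; repeat destruct Rcase_abs; lra. }
    assert (A := Rabs_cos_minus_1 x). rewrite <- pow2_abs.
    assert (P := Rabs_pos k). assert (P2 := Rabs_pos (cos x - 1)). nra.
Qed.

Lemma exp_chord (x u : R) : exp x - exp u <= exp x * (x - u).
Proof.
  assert (E := exp_ineq1_le (u - x)).
  replace (exp u) with (exp x * exp (u - x)) by (rewrite <- exp_plus; f_equal; ring).
  assert (P := exp_pos x). nra.
Qed.

Lemma exp_lipschitz_neg (x u : R) : x <= 0 -> u <= 0 -> Rabs (exp x - exp u) <= Rabs (x - u).
Proof.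
  intros Hx Hu.
  assert (B : forall t, t <= 0 -> exp t <= 1).
  { intros t Ht. rewrite <- exp_0. destruct Ht as [Ht| ->]; [left; now apply exp_increasing|lra]. }
  assert (E1 := exp_chord x u). assert (E2 := exp_chord u x).
  assert (P1 := exp_pos x). assert (P2 := exp_pos u).
  assert (B1 := B x Hx). assert (B2 := B u Hu).
  unfold Rabs; destruct (Rcase_abs (exp x - exp u)), (Rcase_abs (x - u)); nra.
Qed.

(** The constants hold for increments of any size: the bounds on sine and cosine are global, and the
    exponentials are at most 1 on the half-plane that parametrises the disc. *)
Lemma polar_taylor (x y u v : R) : x <= 0 -> u <= 0 ->
  Cmod (polar x y - polar u v) <= 3 * Cmod ((x - u)%R, (y - v)%R) /\
  Cmod (polar x y - polar u v - polar u v * ((x - u)%R, (y - v)%R))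
    <= 3 * Cmod ((x - u)%R, (y - v)%R) ^ 2.
Proof.
  intros Hx Hu. set (p := x - u). set (k := y - v).
  assert (Ex : polar x y = (polar u v * polar p k)%C).
  { rewrite <- polar_plus. f_equal; unfold p, k; ring. }
  assert (Hh := sqmod_Cmod (p, k)). unfold sqmod in Hh; simpl fst in Hh; simpl snd in Hh.
  assert (Hp := Rabs_fst_le_Cmod (p, k)). assert (Hk := Rabs_snd_le_Cmod (p, k)).
  simpl fst in Hp; simpl snd in Hk.
  set (h := Cmod (p, k)) in *. assert (Ph : 0 <= h) by apply Cmod_ge_0.
  assert (L1 := exp_lipschitz_neg x u Hx Hu). fold p in L1.
  assert (Eu := exp_pos u). assert (Exx := exp_pos x).
  assert (B1 : exp x <= 1).
  { rewrite <- exp_0. destruct Hx as [Hx| ->]; [left; now apply exp_increasing|lra]. }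
  assert (Ee : exp u * exp p = exp x) by (rewrite <- exp_plus; f_equal; unfold p; ring).
  set (c1 := (cos k - 1, sin k) : C). set (c2 := (cos k - 1, sin k - k) : C).
  assert (Hc1 : Cmod c1 <= 2 * Rabs k).
  { eapply Rle_trans; [apply Cmod_le_sum|]. unfold c1; simpl.
    assert (A1 := Rabs_cos_minus_1 k). assert (A2 := Rabs_sin_le k). lra. }
  assert (Hc2 : Cmod c2 <= 3 / 2 * k ^ 2).
  { eapply Rle_trans; [apply Cmod_le_sum|]. unfold c2; simpl fst; simpl snd.
    assert (A1 := Rabs_cos_minus_1_sq k). assert (A2 := Rabs_sin_minus_id k). lra. }
  assert (Habs : Rabs (exp u * (exp p - 1)) <= Rabs p).
  { replace (exp u * (exp p - 1)) with (exp x - exp u) by (rewrite <- Ee; ring). exact L1. }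
  split.
  - replace (polar x y - polar u v)%C with
      (polar u v * RtoC (exp p) * c1 + polar u v * RtoC (exp p - 1))%C
      by (rewrite Ex; unfold polar, c1, Cminus, Cplus, Cmult, Copp, RtoC; simpl; f_equal; ring).
    eapply Rle_trans; [apply Cmod_triangle|].
    rewrite !Cmod_mult, !Cmod_R, Cmod_polar, (Rabs_pos_eq (exp p)) by (left; apply exp_pos).
    rewrite Ee. rewrite Rabs_mult, (Rabs_pos_eq (exp u)) in Habs by lra.
    assert (Pc := Cmod_ge_0 c1). nra.
  (* The remainder of exp (p + i k) is split so that each [exp p] meets the factor [exp u]; their
     product [exp x] is at most 1 even if [p] is large. *)
  - replace (polar x y - polar u v - polar u v * (p, k))%C with
      (polar u v * RtoC (exp p) * c2 + polar u v * RtoC (exp p - 1) * (0, k) +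
       polar u v * RtoC (exp p - 1 - p))%C
      by (rewrite Ex; unfold polar, c2, Cminus, Cplus, Cmult, Copp, RtoC; simpl; f_equal; ring).
    eapply Rle_trans; [apply Cmod_triangle|].
    eapply Rle_trans; [apply Rplus_le_compat_r, Cmod_triangle|].
    rewrite !Cmod_mult, !Cmod_R, Cmod_polar, (Rabs_pos_eq (exp p)) by (left; apply exp_pos).
    rewrite Ee. rewrite Rabs_mult, (Rabs_pos_eq (exp u)) in Habs by lra.
    assert (T2 : Cmod (0, k) <= Rabs k).
    { eapply Rle_trans; [apply Cmod_le_sum|]. simpl. rewrite Rabs_R0. lra. }
    assert (T3 : exp u * Rabs (exp p - 1 - p) <= p ^ 2).
    { rewrite Rabs_pos_eq by (generalize (exp_ineq1_le p); lra).
      replace (exp u * (exp p - 1 - p)) with (exp x - exp u - exp u * p) by (rewrite <- Ee; ring).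
      assert (A := exp_chord x u). fold p in A.
      apply Rle_trans with ((exp x - exp u) * p); [nra|].
      rewrite <- pow2_abs. eapply Rle_trans; [apply Rle_abs|]. rewrite Rabs_mult.
      assert (P := Rabs_pos p). simpl. nra. }
    assert (T4 : exp u * Rabs (exp p - 1) * Cmod (0, k) <= Rabs p * Rabs k).
    { apply Rmult_le_compat; auto using Cmod_ge_0. apply Rmult_le_pos; [lra|apply Rabs_pos]. }
    assert (T5 : exp x * Cmod c2 <= 3 / 2 * k ^ 2).
    { assert (Pc := Cmod_ge_0 c2). nra. }
    assert (T6 : Rabs p * Rabs k <= h * h)
      by (apply Rmult_le_compat; auto using Rabs_pos).
    assert (h ^ 2 = p * p + k * k) by (symmetry; exact Hh).
    simpl in *. nra.
Qed.

Lemma polar_injective (x y u v : R) : polar x y = polar u v -> Rabs (y - v) < 2 * PI ->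
  x = u /\ y = v.
Proof.
  intros E Hyv. assert (Ex : exp x = exp u) by (rewrite <- (Cmod_polar x y), E; apply Cmod_polar).
  assert (Hxu : x = u) by now apply exp_inv. split; auto. subst u.
  unfold polar in E. injection E. intros E2 E1. assert (P := exp_pos x).
  apply Rmult_eq_reg_l in E1; [|lra]. apply Rmult_eq_reg_l in E2; [|lra].
  assert (C1 : cos (y - v) = 1).
  { rewrite cos_minus, E1, E2. generalize (sin2_cos2 v). unfold Rsqr. lra. }
  assert (S0 : sin ((y - v) / 2) = 0).
  { assert (A := one_minus_cos (y - v)). rewrite C1 in A. nra. }
  apply Rabs_def2 in Hyv.
  destruct (Rtotal_order (y - v) 0) as [H|[H|H]]; [|lra|].
  - assert (0 < sin (- ((y - v) / 2))) by (apply sin_gt_0; lra).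
    rewrite sin_neg in H0. lra.
  - assert (0 < sin ((y - v) / 2)) by (apply sin_gt_0; lra). lra.
Qed.

Lemma continuity_2d_clamp (f : R -> R -> R) (s x y : R) :
  continuity_2d_pt f (Rmin x s) y -> continuity_2d_pt (fun x y => f (Rmin x s) y) x y.
Proof.
  intros H eps. destruct (H eps) as [del Hdel]. exists del. intros u v Hu Hv.
  apply Hdel; auto. eapply Rle_lt_trans; [|exact Hu].
  unfold Rmin. destruct (Rle_dec u s), (Rle_dec x s); unfold Rabs; repeat destruct Rcase_abs; lra.
Qed.

Lemma ps_nmul (a : nat -> C) (z : C) : disk_seq a -> Cmod z < 1 ->
  ps (nmul a) z = (z * ps (cderive_seq a) z)%C.
Proof.
  intros H Hz. rewrite ps_unfold; auto using disk_seq_nmul.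
  unfold nmul at 1. simpl INR. unfold cderive_seq. ring.
Qed.

Lemma Dlog_ps_nmul (a : nat -> C) : disk_seq a -> Dlog (ps a) (ps (nmul a)).
Proof.
  intros H z Hz. exists (ps (cderive_seq a) z). split; [now apply ps_cderiv|now apply ps_nmul].
Qed.

(** * The mass of the image of a disc under a univalent function *)

Section univalent.
Variable a : nat -> C.
Hypothesis Ha : disk_seq a.
Hypothesis Uni : forall z w, Cmod z < 1 -> Cmod w < 1 -> ps a z = ps a w -> z = w.

(** The angle stops at [T < 2 * PI] because [polar] identifies the two sides of the full closed
    rectangle, which would spoil injectivity. *)
Lemma univalent_truncated (s0 s1 T tau alpha : R) :
  s0 < s1 -> s1 < 0 -> 0 < T < 2 * PI -> 0 < tau -> 0 < alpha ->
  RInt (fun s => RInt (fun t =>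
    truncated_area_density tau alpha (ps a (polar s t)) (ps (nmul a) (polar s t))) 0 T) s0 s1 <= PI.
Proof.
  intros H01 H1 HT Ht Hal.
  assert (Hn := disk_seq_nmul a Ha).
  set (r := exp s1).
  assert (Hr : 0 < r < 1) by (unfold r; split; [apply exp_pos|rewrite <- exp_0; now apply exp_increasing]).
  assert (Pr : forall x y, x <= s1 -> Cmod (polar x y) <= r).
  { intros x y Hx. rewrite Cmod_polar. unfold r.
    destruct Hx as [Hx| ->]; [left; now apply exp_increasing|lra]. }
  destruct (ps_taylor a r Ha Hr) as (L1 & HL1 & T1).
  destruct (ps_bound (cderive_seq a) r (disk_seq_derive a Ha)) as (B & HB & HB'); [lra|].
  destruct (ps_lipschitz (nmul a) r Hn Hr) as (L2 & HL2 & T2).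
  (* The 3, and the 9 as its square, come from [polar_taylor]; the [+ 1] makes [L] positive. *)
  set (L := L1 * 9 + B * 3 + L2 * 3 + 1).
  (* Clamping [x] at [s1] makes the maps continuous on the whole plane. *)
  assert (E := packing_truncated
    (fun x y => ps a (polar (Rmin x s1) y)) (fun x y => ps (nmul a) (polar (Rmin x s1) y))
    s0 s1 0 T L H01 (proj1 HT)).
  assert (Hm : forall x, Rmin x s1 < 0) by (intros x; generalize (Rmin_r x s1); lra).
  eapply Rle_trans; [|apply (fun h1 h2 h3 h4 h5 h6 h7 h8 => E h1 h2 h3 h4 h5 h6 h7 h8 tau alpha Ht Hal)].
  - right. apply RInt_ext. intros x Hx. rewrite Rmax_right in Hx by lra.
    apply RInt_ext. intros y _. now rewrite Rmin_left by lra.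
  - unfold L. lra.
  - intros x y. apply (continuity_2d_clamp (fun x y => fst (ps a (polar x y)))).
    now apply (Dlog_continuity_2d _ _ _ _ (Dlog_ps_nmul a Ha)).
  - intros x y. apply (continuity_2d_clamp (fun x y => snd (ps a (polar x y)))).
    now apply (Dlog_continuity_2d _ _ _ _ (Dlog_ps_nmul a Ha)).
  - intros x y. apply (continuity_2d_clamp (fun x y => fst (ps (nmul a) (polar x y)))).
    now apply (Dlog_continuity_2d _ _ _ _ (Dlog_ps_nmul _ Hn)).
  - intros x y. apply (continuity_2d_clamp (fun x y => snd (ps (nmul a) (polar x y)))).
    now apply (Dlog_continuity_2d _ _ _ _ (Dlog_ps_nmul _ Hn)).
  - intros x y u v [Hx Hy] [Hu Hv]. rewrite !Rmin_left by lra.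
    destruct (polar_taylor x y u v) as [P1 P2]; [lra|lra|].
    set (h := ((x - u)%R, (y - v)%R) : C) in *. assert (Ph := Cmod_ge_0 h).
    assert (Q1 := T1 (polar u v) (polar x y) (Pr u v ltac:(lra)) (Pr x y ltac:(lra))).
    assert (Q2 := HB' (polar u v) (Pr u v ltac:(lra))).
    rewrite ps_nmul by (auto; apply Cmod_polar_lt1; lra).
    replace (ps a (polar x y) - ps a (polar u v) - polar u v * ps (cderive_seq a) (polar u v) * h)%C
      with ((ps a (polar x y) - ps a (polar u v) - ps (cderive_seq a) (polar u v) * (polar x y - polar u v))
        + ps (cderive_seq a) (polar u v) * (polar x y - polar u v - polar u v * h))%C by ring.
    eapply Rle_trans; [apply Cmod_triangle|]. rewrite Cmod_mult.
    assert (Pd := Cmod_ge_0 (polar x y - polar u v)).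
    assert (Cmod (polar x y - polar u v) ^ 2 <= (3 * Cmod h) ^ 2) by (apply pow_incr; lra).
    assert (A1 : L1 * Cmod (polar x y - polar u v) ^ 2 <= L1 * (3 * Cmod h) ^ 2)
      by (apply Rmult_le_compat_l; lra).
    assert (A2 : Cmod (ps (cderive_seq a) (polar u v)) * Cmod (polar x y - polar u v - polar u v * h)
      <= B * (3 * Cmod h ^ 2)) by (apply Rmult_le_compat; auto using Cmod_ge_0).
    assert (A3 : 0 <= (L2 * 3 + 1) * Cmod h ^ 2) by (apply Rmult_le_pos; [lra|apply pow2_ge_0]).
    unfold L. nra.
  - intros x y u v [Hx Hy] [Hu Hv]. rewrite !Rmin_left by lra.
    destruct (polar_taylor x y u v) as [P1 P2]; [lra|lra|].
    set (h := ((x - u)%R, (y - v)%R) : C) in *. assert (Ph := Cmod_ge_0 h).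
    assert (Q1 := T2 (polar u v) (polar x y) (Pr u v ltac:(lra)) (Pr x y ltac:(lra))).
    eapply Rle_trans; [exact Q1|].
    apply Rle_trans with (L2 * (3 * Cmod h)); [apply Rmult_le_compat_l; lra|].
    unfold L. nra.
  - intros x y u v [Hx Hy] [Hu Hv] Eq. rewrite !Rmin_left in Eq by lra.
    apply polar_injective.
    + apply Uni; auto; apply Cmod_polar_lt1; lra.
    + apply Rabs_def1; lra.
Qed.

(** Removes the truncation and closes the annulus. A single [eta] is both the truncation level,
    which costs at most [eta ^ 2 * / tau] pointwise, and the width of the omitted sector, on which
    the integrand is bounded. *)
Lemma univalent_area_bound (s0 s1 tau : R) : s0 < s1 -> s1 < 0 -> 0 < tau ->
  RInt (fun s => RInt (fun t =>
    area_density tau 1 (ps a (polar s t)) (ps (nmul a) (polar s t))) 0 (2 * PI)) s0 s1 <= PI.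
Proof.
  intros H01 H1 Ht. assert (PI0 := PI_RGT_0).
  assert (Hn := disk_seq_nmul a Ha).
  set (r := exp s1).
  assert (Hr : 0 < r < 1) by (unfold r; split; [apply exp_pos|rewrite <- exp_0; now apply exp_increasing]).
  destruct (ps_bound (nmul a) r Hn) as (B & HB & HB'); [lra|].
  set (F := fun s t => area_density tau 1 (ps a (polar s t)) (ps (nmul a) (polar s t))).
  assert (CF : forall x y, x < 0 -> continuity_2d_pt F x y).
  { intros x y Hx. unfold F.
    apply (continuity_2d_area_density _ _ _ (Dlog_ps_nmul a Ha) (Dlog_ps_nmul _ Hn)); auto; lra. }
  set (J := fun al s t => truncated_area_density tau al (ps a (polar s t)) (ps (nmul a) (polar s t))).
  assert (CJ : forall al x y, x < 0 -> continuity_2d_pt (J al) x y).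
  { intros al x y Hx.
    destruct (Dlog_continuity_2d _ _ x y (Dlog_ps_nmul a Ha) Hx) as [A1 A2].
    destruct (Dlog_continuity_2d _ _ x y (Dlog_ps_nmul _ Hn) Hx) as [B1 B2].
    now apply (continuity_2d_truncated_area_density (fun s t => ps a (polar s t))
      (fun s t => ps (nmul a) (polar s t))). }
  assert (sd : forall u v, 0 <= spherical_density tau u v <= / tau).
  { intros u v. unfold spherical_density. assert (0 <= u * u + v * v) by nra. split.
    - left. apply Rdiv_lt_0_compat; auto. apply pow_lt. lra.
    - replace (/ tau) with (tau / tau ^ 2) by (field; lra).
      apply Rmult_le_compat_l; [lra|]. apply Rinv_le_contravar; [now apply pow_lt|].
      apply pow_incr. lra. }
  assert (FE : forall s t, F s t = sqmod (ps (nmul a) (polar s t)) *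
    spherical_density tau (fst (ps a (polar s t))) (snd (ps a (polar s t)))).
  { intros s t. unfold F, area_density, spherical_density, sqmod, Rdiv. rewrite Rmult_1_l. ring. }
  assert (FJ : forall al s t, F s t <= J al s t + al ^ 2 * / tau).
  { intros al s t. rewrite FE. unfold J, truncated_area_density.
    set (m := sqmod (ps (nmul a) (polar s t))).
    destruct (sd (fst (ps a (polar s t))) (snd (ps a (polar s t)))) as [S1 S2].
    assert (M1 := Rmax_l (m - al ^ 2) 0). assert (P := pow2_ge_0 al). nra. }
  assert (FB : forall s t, s <= s1 -> F s t <= B ^ 2 * / tau).
  { intros s t Hs. rewrite FE. apply Rmult_le_compat; try apply sd.
    - rewrite sqmod_Cmod. apply pow2_ge_0.
    - rewrite sqmod_Cmod. apply pow_incr. split; [apply Cmod_ge_0|]. apply HB'.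
      rewrite Cmod_polar. unfold r. destruct Hs as [Hs| ->]; [left; now apply exp_increasing|lra]. }
  assert (Main : forall eta, 0 < eta < 1 -> RInt (fun s => RInt (F s) 0 (2 * PI)) s0 s1 <=
    PI + (s1 - s0) * (2 * PI * / tau + B ^ 2 * / tau) * eta).
  { intros eta Heta. set (T := 2 * PI - eta). assert (P1 := PI2_1).
    assert (HT : 0 < T < 2 * PI) by (unfold T; lra).
    assert (U := univalent_truncated s0 s1 T tau eta H01 H1 HT Ht (proj1 Heta)).
    assert (Inner : forall s, s0 < s < s1 -> RInt (F s) 0 (2 * PI) <=
      RInt (J eta s) 0 T + (2 * PI * / tau + B ^ 2 * / tau) * eta).
    { intros s Hs.
      assert (XF : forall u v, ex_RInt (F s) u v).
      { intros u v. apply ex_RInt_everywhere_continuous. intros y.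
        apply continuity_2d_pt_section_r, CF. lra. }
      assert (XJ : forall u v, ex_RInt (J eta s) u v).
      { intros u v. apply ex_RInt_everywhere_continuous. intros y.
        apply continuity_2d_pt_section_r, CJ. lra. }
      assert (Ch := RInt_Chasles (V := R_CompleteNormedModule) (F s) 0 T (2 * PI) (XF _ _) (XF _ _)).
      unfold plus in Ch; simpl in Ch. rewrite <- Ch.
      assert (I1 : RInt (F s) 0 T <= RInt (fun t => J eta s t + eta ^ 2 * / tau) 0 T).
      { apply RInt_le; [lra|apply XF| |intros; apply FJ].
        apply (ex_RInt_plus (V := R_NormedModule) (J eta s)); [apply XJ|apply ex_RInt_const]. }
      assert (I2 : RInt (fun t => J eta s t + eta ^ 2 * / tau) 0 T =
        RInt (J eta s) 0 T + T * (eta ^ 2 * / tau)).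
      { etransitivity; [apply (RInt_plus (V := R_CompleteNormedModule) (J eta s)); [apply XJ|apply ex_RInt_const]|].
        rewrite RInt_const. unfold plus, scal; simpl; unfold mult; simpl. ring. }
      assert (I3 : RInt (F s) T (2 * PI) <= RInt (fun _ => B ^ 2 * / tau) T (2 * PI)).
      { apply RInt_le; [lra|apply XF|apply ex_RInt_const|]. intros. apply FB. lra. }
      rewrite RInt_const in I3. unfold scal in I3; simpl in I3; unfold mult in I3; simpl in I3.
      replace (2 * PI - T) with eta in I3 by (unfold T; ring).
      assert (it : 0 < / tau) by now apply Rinv_0_lt_compat.
      assert (T * (eta ^ 2 * / tau) <= 2 * PI * / tau * eta).
      { replace (T * (eta ^ 2 * / tau)) with (T * eta * (eta * / tau)) by ring.
        replace (2 * PI * / tau * eta) with (2 * PI * (eta * / tau)) by ring.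
        apply Rmult_le_compat_r; [|nra]. apply Rmult_le_pos; lra. }
      simpl in *. lra. }
    assert (XI : forall f T', (forall x y, x < 0 -> continuity_2d_pt f x y) -> 0 <= T' ->
      ex_RInt (fun s => RInt (f s) 0 T') s0 s1).
    { intros f T' Cf HT'. apply (ex_RInt_continuous (V := R_CompleteNormedModule)). intros x Hx.
      rewrite Rmax_right in Hx by lra. apply continuous_RInt_param_left; auto; lra. }
    eapply Rle_trans; [apply RInt_le; [lra|apply XI; [exact CF|lra]| |exact Inner]|].
    { apply (ex_RInt_plus (V := R_NormedModule) (fun s => RInt (J eta s) 0 T));
        [apply XI; [apply CJ|lra]|apply ex_RInt_const]. }
    eapply Rle_trans.
    - right. apply (RInt_plus (V := R_CompleteNormedModule) (fun s => RInt (J eta s) 0 T));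
        [apply XI; [apply CJ|lra]|apply ex_RInt_const].
    - rewrite RInt_const. unfold plus, scal; simpl; unfold mult; simpl.
      unfold J. simpl in *. lra. }
  assert (it : 0 < / tau) by now apply Rinv_0_lt_compat.
  apply Rminus_le, (nonpos_of_small_linear_bound _
    ((s1 - s0) * (2 * PI * / tau + B ^ 2 * / tau)) 1); [|lra|].
  - apply Rmult_le_pos; [lra|]. generalize (pow2_ge_0 B). nra.
  - intros eta Heta. assert (T := Main eta Heta). unfold F in T. lra.
Qed.
End univalent.

(** * Uniqueness of derivatives, and Laurent polynomials on a circle *)

Lemma cderiv_unique (f : C -> C) (z l m : C) : cderiv f z l -> cderiv f z m -> l = m.
Proof.
  intros (K & d & HK & Hd & H) (K' & d' & HK' & Hd' & H').
  assert (M : Cmod (l - m) = 0).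
  { apply Rle_antisym; [|apply Cmod_ge_0].
    apply (nonpos_of_small_linear_bound _ (K + K') (Rmin d d')); [lra|apply Rmin_glb_lt; lra|].
    intros t Ht. assert (Q3 := Rmin_l d d'). assert (Q4 := Rmin_r d d').
    assert (Hc : Cmod (RtoC t) = t) by (rewrite Cmod_R; apply Rabs_pos_eq; lra).
    assert (A1 := H (RtoC t)). assert (A2 := H' (RtoC t)). rewrite Hc in A1, A2.
    specialize (A1 ltac:(lra)). specialize (A2 ltac:(lra)).
    assert (A3 : Cmod (l - m) * t <= (K + K') * t ^ 2).
    { rewrite <- Hc at 1. rewrite <- Cmod_mult.
      replace ((l - m) * RtoC t)%C with
        ((f (z + RtoC t) - f z - m * RtoC t) - (f (z + RtoC t) - f z - l * RtoC t))%C by ring.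
      eapply Rle_trans; [apply Cmod_minus_triangle|]. lra. }
    apply Rmult_le_reg_r with t; lra. }
  apply Cmod_eq_0 in M. replace l with (m + (l - m))%C by ring. rewrite M. ring.
Qed.

Lemma Dlog_unique (f f2 g g2 : C -> C) (z : C) : Dlog f g -> Dlog f2 g2 ->
  (forall x, Cmod x < 1 -> f x = f2 x) -> Cmod z < 1 -> g z = g2 z.
Proof.
  intros H1 H2 E Hz. destruct (H1 z Hz) as (l & Hl & ->). destruct (H2 z Hz) as (m & Hm & ->).
  f_equal. apply (cderiv_unique f2 z); auto. now apply cderiv_ext_disk with f.
Qed.

Lemma Dlog_ext (f g g2 : C -> C) : Dlog f g ->
  (forall z, Cmod z < 1 -> g z = g2 z) -> Dlog f g2.
Proof.
  intros H E z Hz. destruct (H z Hz) as (l & Hl & G). exists l. split; auto.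
  now rewrite <- E.
Qed.

Definition cdot (u v : C) : R := fst u * fst v + snd u * snd v.

Lemma cdot_conj (u v : C) : cdot u v = fst (Cconj u * v)%C.
Proof. unfold cdot. simpl. ring. Qed.

(** The expansion of 1/f through z^3; [laurent_T'] is z d/dz of it. *)
Definition laurent_T (b1 b2 b3 z : C) : C := (/ z + b1 * z + b2 * (z * z) + b3 * (z * z * z))%C.
Definition laurent_T' (b1 b2 b3 z : C) : C :=
  (- / z + b1 * z + RtoC 2 * b2 * (z * z) + RtoC 3 * b3 * (z * z * z))%C.

(* On the circle |z|^2 = rho, conjugation acts as z |-> rho / z; this turns every
   mixed term of the inner product into a polynomial without constant term. *)
Definition cross_terms (rho : R) (b1 b2 b3 z th ka : C) : C :=
  (z * (b2 * (z * z) / RtoC rho + RtoC 2 * b3 * (z * z * z) / RtoC rho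
    + RtoC 3 * Cconj b1 * b2 * RtoC rho + RtoC 4 * Cconj b1 * b3 * RtoC rho * z
    + RtoC 5 * Cconj b2 * b3 * (RtoC rho * RtoC rho)
    + ka * (z * z * z * z / RtoC rho + Cconj b1 * RtoC rho * (z * z)
        + Cconj b2 * (RtoC rho * RtoC rho) * z + Cconj b3 * (RtoC rho * RtoC rho * RtoC rho))
    + th * (- (z * z * z * z) / RtoC rho + Cconj b1 * RtoC rho * (z * z)
        + RtoC 2 * Cconj b2 * (RtoC rho * RtoC rho) * z
        + RtoC 3 * Cconj b3 * (RtoC rho * RtoC rho * RtoC rho))))%C.

Lemma Cconj_RtoC (x : R) : Cconj (RtoC x) = RtoC x.
Proof. unfold Cconj, RtoC; simpl. f_equal; ring. Qed.

Lemma fst_plus (u v : C) : fst (u + v)%C = fst u + fst v.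
Proof. reflexivity. Qed.

Lemma fst_conj (u : C) : fst (Cconj u) = fst u.
Proof. reflexivity. Qed.

(** The diagonal products give the constant. The tails start at z^4, beyond the z^-3 that
    conjugating the Laurent part can produce, so their products with it are polynomials vanishing at
    0. The product of the two tails is kept apart, for its mean has a sign. *)
Lemma laurent_inner_product (rho : R) (b1 b2 b3 z th ka : C) : 0 < rho ->
  (z * Cconj z)%C = RtoC rho ->
  cdot (laurent_T b1 b2 b3 z + z * z * z * z * th) (laurent_T' b1 b2 b3 z + z * z * z * z * ka)
  = (- / rho + cdot b1 b1 * rho + 2 * cdot b2 b2 * rho ^ 2 + 3 * cdot b3 b3 * rho ^ 3)
    + fst (cross_terms rho b1 b2 b3 z th ka)
    + cdot (z * z * z * z * th) (z * z * z * z * ka).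
Proof.
  intros HR Hz.
  assert (HRn : RtoC rho <> 0) by (intros E; injection E; lra).
  assert (Hzn : z <> 0) by (intros ->; apply HRn; rewrite <- Hz; ring).
  assert (Ez : Cconj z = (RtoC rho / z)%C) by (rewrite <- Hz; field; exact Hzn).
  set (T := laurent_T b1 b2 b3 z). set (T' := laurent_T' b1 b2 b3 z).
  set (G := (z * z * z * z * th)%C). set (K := (z * z * z * z * ka)%C).
  assert (Bil : cdot (T + G) (T' + K) = cdot T T' + cdot T K + cdot T' G + cdot G K)
    by (unfold cdot; simpl; ring).
  assert (ET : Cconj T = (z / RtoC rho + Cconj b1 * (RtoC rho / z) + Cconj b2 * (RtoC rho / z * (RtoC rho / z))
    + Cconj b3 * (RtoC rho / z * (RtoC rho / z) * (RtoC rho / z)))%C).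
  { unfold T, laurent_T. rewrite !Cplus_conj, !Cmult_conj, Cinv_conj, Ez by exact Hzn.
    field. split; assumption. }
  assert (ET' : Cconj T' = (- (z / RtoC rho) + Cconj b1 * (RtoC rho / z)
    + RtoC 2 * Cconj b2 * (RtoC rho / z * (RtoC rho / z))
    + RtoC 3 * Cconj b3 * (RtoC rho / z * (RtoC rho / z) * (RtoC rho / z)))%C).
  { unfold T', laurent_T'. rewrite !Cplus_conj, !Cmult_conj, Copp_conj, Cinv_conj, !Cconj_RtoC, Ez by exact Hzn.
    field. split; assumption. }
  rewrite Bil, (cdot_conj T T'), (cdot_conj T K), (cdot_conj T' G), ET, ET'.
  (* The positive powers in the product of conj T and T' form [P]. The negative ones form the
     conjugate of [Q], which has the same real part as the polynomial [Q]. *)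
  set (P := (b1 * (z * z) / RtoC rho + RtoC 2 * b2 * (z * z * z) / RtoC rho
    + RtoC 3 * b3 * (z * z * z * z) / RtoC rho + RtoC 2 * Cconj b1 * b2 * RtoC rho * z
    + RtoC 3 * Cconj b1 * b3 * RtoC rho * (z * z) + RtoC 3 * Cconj b2 * b3 * (RtoC rho * RtoC rho) * z)%C).
  set (Q := (- (b1 * (z * z) / RtoC rho) - b2 * (z * z * z) / RtoC rho - b3 * (z * z * z * z) / RtoC rho
    + b2 * Cconj b1 * RtoC rho * z + b3 * Cconj b1 * RtoC rho * (z * z)
    + RtoC 2 * b3 * Cconj b2 * (RtoC rho * RtoC rho) * z)%C).
  set (c0 := (- / RtoC rho + Cconj b1 * b1 * RtoC rho + RtoC 2 * (Cconj b2 * b2) * (RtoC rho * RtoC rho)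
    + RtoC 3 * (Cconj b3 * b3) * (RtoC rho * RtoC rho * RtoC rho))%C).
  assert (EQ : Cconj Q = (- (Cconj b1 * RtoC rho / (z * z)) - Cconj b2 * (RtoC rho * RtoC rho) / (z * z * z)
    - Cconj b3 * (RtoC rho * RtoC rho * RtoC rho) / (z * z * z * z)
    + Cconj b2 * b1 * (RtoC rho * RtoC rho) / z + Cconj b3 * b1 * (RtoC rho * RtoC rho * RtoC rho) / (z * z)
    + RtoC 2 * Cconj b3 * b2 * (RtoC rho * RtoC rho * RtoC rho) / z)%C).
  { unfold Q. rewrite !Cplus_conj, !Cminus_conj, !Copp_conj, !Cdiv_conj, !Cmult_conj, !Cconj_RtoC,
      !Cconj_conj, Ez by exact HRn. field. split; assumption. }
  assert (E0 : fst c0 = - / rho + cdot b1 b1 * rho + 2 * cdot b2 b2 * rho ^ 2 + 3 * cdot b3 b3 * rho ^ 3).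
  { unfold c0. rewrite <- RtoC_inv by lra. unfold cdot. simpl. ring. }
  assert (E1 : ((z / RtoC rho + Cconj b1 * (RtoC rho / z) + Cconj b2 * (RtoC rho / z * (RtoC rho / z))
    + Cconj b3 * (RtoC rho / z * (RtoC rho / z) * (RtoC rho / z))) * T')%C = (c0 + P + Cconj Q)%C).
  { rewrite EQ. unfold c0, P, T', laurent_T'. field. split; assumption. }
  rewrite E1, !fst_plus, fst_conj, E0.
  assert (E2 : cross_terms rho b1 b2 b3 z th ka = (P + Q +
    (z / RtoC rho + Cconj b1 * (RtoC rho / z) + Cconj b2 * (RtoC rho / z * (RtoC rho / z))
      + Cconj b3 * (RtoC rho / z * (RtoC rho / z) * (RtoC rho / z))) * K +
    (- (z / RtoC rho) + Cconj b1 * (RtoC rho / z) + RtoC 2 * Cconj b2 * (RtoC rho / z * (RtoC rho / z))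
      + RtoC 3 * Cconj b3 * (RtoC rho / z * (RtoC rho / z) * (RtoC rho / z))) * G)%C).
  { unfold cross_terms, P, Q, K, G. field. split; assumption. }
  rewrite E2, !fst_plus. ring.
Qed.

(** * The area theorem *)

Section area_theorem.
Variable a : nat -> C.
Hypothesis Ha : disk_seq a.
Hypothesis Uni : forall z w, Cmod z < 1 -> Cmod w < 1 -> ps a z = ps a w -> z = w.
Hypothesis a0 : a 0%nat = RtoC 0.
Hypothesis a1 : a 1%nat = RtoC 1.
Hypothesis a2 : a 2%nat = RtoC 0.

Let phi := ps (cshift a).
Let phi5 := ps (Nat.iter 5 cshift (cshift a)).
Let c2 := a 3%nat.
Let c3 := a 4%nat.
Let c4 := a 5%nat.
Let b1 := (- c2)%C.
Let b2 := (- c3)%C.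
Let b3 := (c2 * c2 - c4)%C.

Lemma phi_expand (z : C) : Cmod z < 1 ->
  phi z = (1 + z * (z * (c2 + z * (c3 + z * (c4 + z * phi5 z)))))%C.
Proof.
  intros Hz.
  transitivity (a 1%nat + z * (a 2%nat + z * (c2 + z * (c3 + z * (c4 + z * phi5 z)))))%C.
  - exact (ps_expand5 _ z (disk_seq_shift _ Ha) Hz).
  - rewrite a1, a2. ring.
Qed.

Lemma ps_factor (z : C) : Cmod z < 1 -> ps a z = (z * phi z)%C.
Proof. intros Hz. rewrite ps_unfold by assumption. rewrite a0. unfold phi. ring. Qed.

Lemma phi_at_0 : phi (RtoC 0) = RtoC 1.
Proof.
  unfold phi. rewrite ps_unfold; [|now apply disk_seq_shift|rewrite Cmod_0; lra].
  unfold cshift at 1. rewrite a1. ring.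
Qed.

Lemma phi_neq_0 (z : C) : Cmod z < 1 -> phi z <> 0.
Proof.
  intros Hz E. destruct (Ceq_dec z 0) as [->|Hn].
  - rewrite phi_at_0 in E. injection E. lra.
  - apply Hn. apply Uni; auto; [rewrite Cmod_0; lra|].
    rewrite !ps_factor by (auto; rewrite Cmod_0; lra). rewrite E. ring.
Qed.

(** [Bp] is z / f(z) through z^4, and [eta] is built so that phi Bp + z^5 eta = 1. Hence 1 / phi =
    Bp + z^5 [theta] exactly. This closed form makes the tail holomorphic by the closure properties
    of [holo], with no inversion of power series. *)
Let Bp (z : C) := (1 + b1 * (z * z) + b2 * (z * (z * z)) + b3 * ((z * z) * (z * z)))%C.
Let eta (z : C) := (- (1) * ((c2 * b2 + c3 * b1) + (c2 * b3 + c4 * b1 + c3 * b2) * z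
  + (c3 * b3 + c4 * b2) * (z * z) + c4 * b3 * (z * (z * z)) + phi5 z * Bp z))%C.
Let theta (z : C) := (eta z * / phi z)%C.

Ltac holo_tac := repeat (first [apply holo_plus | apply holo_mult | apply holo_const | apply holo_id]).

Lemma holo_theta (n : nat) : holo n theta.
Proof.
  unfold theta, eta, Bp. apply holo_mult.
  - apply (holo_mult n (fun _ => (- (1))%C)); [apply holo_const|].
    holo_tac. apply holo_ps. now do 6 apply disk_seq_shift.
  - apply holo_inv; [apply phi_neq_0|]. apply holo_ps. now apply disk_seq_shift.
Qed.

(** Free of division by [z], so that the identity holds at the origin too and can be differentiated
    on the whole disc. *)
Lemma ps_mul_reciprocal (z : C) : Cmod z < 1 ->
  (ps a z * (Bp z + z * (z * z * z * z * theta z)))%C = z.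
Proof.
  intros Hz. rewrite ps_factor by assumption. assert (Hn := phi_neq_0 z Hz).
  assert (E : (phi z * Bp z + z * z * z * z * z * eta z)%C = RtoC 1).
  { rewrite phi_expand by assumption. unfold eta, Bp, b3, b2, b1. ring. }
  unfold theta.
  replace (z * phi z * (Bp z + z * (z * z * z * z * (eta z * / phi z))))%C
    with (z * (phi z * Bp z + z * z * z * z * z * eta z))%C by (field; exact Hn).
  rewrite E. ring.
Qed.

Section with_derivative.
Variables theta' theta'' theta3 : C -> C.
Hypothesis Dth : Dlog theta theta'.
Hypothesis Dth' : Dlog theta' theta''.
Hypothesis Dth'' : Dlog theta'' theta3.

Let G (z : C) := (z * z * z * z * theta z)%C.
Let kappa (z : C) := (RtoC 4 * theta z + theta' z)%C.
Let K (z : C) := (z * z * z * z * kappa z)%C.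

Lemma Dlog_pow4_mult (h h' : C -> C) : Dlog h h' ->
  Dlog (fun z => z * z * z * z * h z)%C (fun z => z * z * z * z * (RtoC 4 * h z + h' z))%C.
Proof.
  intros Hh.
  assert (D2 := Dlog_mult _ _ _ _ Dlog_id Dlog_id).
  assert (D3 := Dlog_mult _ _ _ _ D2 Dlog_id).
  assert (D4 := Dlog_mult _ _ _ _ D3 Dlog_id).
  eapply Dlog_ext; [exact (Dlog_mult _ _ _ _ D4 Hh)|].
  intros z _. simpl. ring.
Qed.

Lemma Dlog_G : Dlog G K.
Proof. exact (Dlog_pow4_mult theta theta' Dth). Qed.

(** The energy of the tail [G] involves three successive derivatives of [G]; hence the three
    derivatives of [theta]. *)
Lemma Dlog_K : exists K', Dlog K K' /\ exists K'', Dlog K' K''.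
Proof.
  assert (Dk : Dlog kappa (fun z => RtoC 4 * theta' z + theta'' z)%C).
  { eapply Dlog_ext; [exact (Dlog_plus _ _ _ _ (Dlog_mult _ _ _ _ (Dlog_const (RtoC 4)) Dth) Dth')|].
    intros z _. simpl. ring. }
  assert (Dk' : Dlog (fun z => RtoC 4 * theta' z + theta'' z)%C (fun z => RtoC 4 * theta'' z + theta3 z)%C).
  { eapply Dlog_ext; [exact (Dlog_plus _ _ _ _ (Dlog_mult _ _ _ _ (Dlog_const (RtoC 4)) Dth') Dth'')|].
    intros z _. simpl. ring. }
  eexists. split; [exact (Dlog_pow4_mult _ _ Dk)|].
  eexists.
  apply (Dlog_pow4_mult (fun z => RtoC 4 * kappa z + (RtoC 4 * theta' z + theta'' z))%C).
  exact (Dlog_plus _ _ _ _ (Dlog_mult _ _ _ _ (Dlog_const (RtoC 4)) Dk) Dk').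
Qed.

(** 1/f has a pole at 0, whereas [Dlog] speaks of the whole disc. The derivative is therefore
    obtained by differentiating [ps_mul_reciprocal] as a product and dividing afterwards. *)
Lemma reciprocal_expansion (z : C) : Cmod z < 1 -> z <> 0 ->
  (/ ps a z)%C = (laurent_T b1 b2 b3 z + G z)%C /\
  (- (ps (nmul a) z / (ps a z * ps a z)))%C = (laurent_T' b1 b2 b3 z + K z)%C.
Proof.
  intros Hz Hzn.
  assert (Hf : ps a z <> 0).
  { rewrite ps_factor by assumption. apply Cmult_neq_0; auto. now apply phi_neq_0. }
  assert (EU := ps_mul_reciprocal z Hz). fold (G z) in EU.
  assert (D2 := Dlog_mult _ _ _ _ Dlog_id Dlog_id).
  assert (D3 := Dlog_mult _ _ _ _ Dlog_id D2).
  assert (D4 := Dlog_mult _ _ _ _ D2 D2).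
  assert (DB := Dlog_plus _ _ _ _ (Dlog_plus _ _ _ _ (Dlog_plus _ _ _ _ (Dlog_const (RtoC 1))
    (Dlog_mult _ _ _ _ (Dlog_const b1) D2)) (Dlog_mult _ _ _ _ (Dlog_const b2) D3))
    (Dlog_mult _ _ _ _ (Dlog_const b3) D4)).
  assert (DU := Dlog_plus _ _ _ _ DB (Dlog_mult _ _ _ _ Dlog_id Dlog_G)).
  assert (DfU := Dlog_mult _ _ _ _ (Dlog_ps_nmul a Ha) DU).
  assert (E' := Dlog_unique _ _ _ _ z DfU Dlog_id ps_mul_reciprocal Hz). cbv beta in E'.
  fold (Bp z) in E'.
  assert (EU3 : (Bp z + z * G z)%C = (z / ps a z)%C).
  { transitivity (ps a z * (Bp z + z * G z) / ps a z)%C; [field; exact Hf|now rewrite EU]. }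
  assert (EF : (/ ps a z)%C = (laurent_T b1 b2 b3 z + G z)%C).
  { transitivity ((Bp z + z * G z) / z)%C.
    - rewrite EU3. field. split; assumption.
    - unfold Bp, laurent_T. field. exact Hzn. }
  split; [exact EF|].
  set (f := ps a z) in *. set (g := ps (nmul a) z) in *.
  rewrite EU3 in E'.
  assert (EM : (z - g * (z / f))%C = (f * (RtoC 2 * b1 * (z * z) + RtoC 3 * b2 * (z * (z * z))
    + RtoC 4 * b3 * (z * z * (z * z)) + z * G z + z * K z))%C).
  { match type of E' with ?l = _ => transitivity (l - g * (z / f))%C end.
    - now rewrite E'.
    - ring. }
  transitivity ((z - g * (z / f)) / (f * z) - / f)%C; [field; split; assumption|].
  rewrite EM, EF. unfold laurent_T, laurent_T'. field. split; assumption.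
Qed.

(** Here [exp (2 * s)] is |z|^2. The circle mean of Re (F' conj F) for F = 1/f is the left side plus
    the mean of [cdot] of the tails [G] and [K]. The whole is nonpositive by the mass bound and the
    tail part is nonnegative. *)
Lemma area_inequality_circle (s : R) : s < 0 ->
  - / exp (2 * s) + cdot b1 b1 * exp (2 * s) + 2 * cdot b2 b2 * exp (2 * s) ^ 2
    + 3 * cdot b3 b3 * exp (2 * s) ^ 3 <= 0.
Proof.
  intros Hs. assert (PI0 := PI_RGT_0). set (rho := exp (2 * s)).
  assert (HR : 0 < rho) by apply exp_pos.
  assert (HRn : RtoC rho <> 0) by (intros E; injection E; lra).
  set (c0 := - / rho + cdot b1 b1 * rho + 2 * cdot b2 b2 * rho ^ 2 + 3 * cdot b3 b3 * rho ^ 3).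
  assert (Hn := disk_seq_nmul a Ha). assert (Hnn := disk_seq_nmul _ Hn).
  set (q := fun x y => ps a (polar x y)). set (q' := fun x y => ps (nmul a) (polar x y)).
  assert (Hz : forall x y, x < 0 -> Cmod (polar x y) < 1) by (intros; now apply Cmod_polar_lt1).
  assert (Hzn : forall x y, polar x y <> 0).
  { intros x y. apply Cmod_gt_0. rewrite Cmod_polar. apply exp_pos. }
  assert (Hq : forall x y, x < 0 -> q x y <> 0).
  { intros x y Hx. unfold q. rewrite ps_factor by auto. apply Cmult_neq_0; auto. apply phi_neq_0; auto. }
  assert (Hsq : forall x y, x < 0 -> 0 < sqmod (q x y)).
  { intros x y Hx. rewrite sqmod_Cmod. apply pow_lt. apply Cmod_gt_0. auto. }
  assert (Cqq : forall x y, x < 0 -> continuity_2d_pt (fun x y => cdot (q x y) (q' x y)) x y).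
  { intros x y Hx. destruct (Dlog_continuity_2d _ _ x y (Dlog_ps_nmul a Ha) Hx) as [A1 A2].
    destruct (Dlog_continuity_2d _ _ x y (Dlog_ps_nmul _ Hn) Hx) as [B1 B2].
    apply continuity_2d_pt_plus; apply continuity_2d_pt_mult; assumption. }
  assert (Csq : forall x y, x < 0 -> continuity_2d_pt (fun x y => sqmod (q x y)) x y).
  { intros x y Hx. destruct (Dlog_continuity_2d _ _ x y (Dlog_ps_nmul a Ha) Hx) as [A1 A2].
    apply continuity_2d_pt_plus; apply continuity_2d_pt_mult; assumption. }
  (* [A] is [- Re (F' conj F)]. [m] dominates the error of order [tau ^ 2]: with d =
     [cdot (q x y) (q' x y)], the continuous 1 + d^2 replaces |d|. *)
  set (A := fun x y => cdot (q x y) (q' x y) * / (sqmod (q x y) * sqmod (q x y))).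
  set (m := fun x y => (1 + cdot (q x y) (q' x y) * cdot (q x y) (q' x y)) *
    / (sqmod (q x y) * sqmod (q x y) * sqmod (q x y))).
  assert (CA : forall y, continuous (A s) y).
  { intros y. apply continuity_2d_pt_section_r. apply continuity_2d_pt_mult; auto.
    apply continuity_2d_pt_inv; [apply continuity_2d_pt_mult; auto|].
    assert (P := Hsq s y Hs). nra. }
  assert (Cm : forall y, continuous (m s) y).
  { intros y. apply continuity_2d_pt_section_r. apply continuity_2d_pt_mult.
    - apply continuity_2d_pt_plus; [apply continuity_2d_pt_const|]. apply continuity_2d_pt_mult; auto.
    - apply continuity_2d_pt_inv.
      + apply continuity_2d_pt_mult; auto. apply continuity_2d_pt_mult; auto.
      + assert (P := Hsq s y Hs). apply Rgt_not_eq. repeat apply Rmult_lt_0_compat; auto. }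
  (* The mean of [Re (z f'(z) / f(z))] is [1]: the argument principle. *)
  set (H := fun z => (ps (cderive_seq a) z * / phi z)%C).
  assert (holoH : forall n, holo n H).
  { intros n. apply holo_mult.
    - apply holo_ps. now apply disk_seq_derive.
    - apply holo_inv; [apply phi_neq_0|]. apply holo_ps. now apply disk_seq_shift. }
  assert (IH : RInt (fun t => fst (H (polar s t))) 0 (2 * PI) = 2 * PI).
  { rewrite (mean_value_Re H s (holoH 2%nat) Hs). unfold H. rewrite phi_at_0.
    rewrite ps_unfold; [|now apply disk_seq_derive|rewrite Cmod_0; lra].
    unfold cderive_seq, cshift, nmul at 1. rewrite a1. simpl. field. }
  assert (EH : forall t, fst (H (polar s t)) = cdot (q s t) (q' s t) / sqmod (q s t)).
  { intros t. assert (E : q' s t = (q s t * H (polar s t))%C).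
    { unfold q', q, H. rewrite ps_nmul, ps_factor by auto. field. apply phi_neq_0; auto. }
    assert (P := Hsq s t Hs). rewrite E.
    transitivity (fst (H (polar s t)) * sqmod (q s t) / sqmod (q s t)); [field; lra|].
    f_equal. unfold cdot, sqmod. simpl. ring. }
  assert (CH : forall t, continuous (fun t => fst (H (polar s t))) t).
  { intros t. destruct (holoH 1%nat) as (h & Dh & _).
    apply (continuity_2d_pt_section_r (fun x y => fst (H (polar x y)))).
    now apply (Dlog_continuity_2d H h). }
  (* [tau -> 0] in the spherical area bound gives: the area
     [- 1/2 * RInt (cdot (1 / f) (d(1 / f)/ds))] enclosed by the image of the
     circle under [1 / f] is nonnegative. *)
  assert (PosA : 0 <= RInt (A s) 0 (2 * PI)).
  { assert (Main : forall tau, 0 < tau ->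
      0 <= tau * RInt (A s) 0 (2 * PI) + tau ^ 2 * RInt (m s) 0 (2 * PI)).
    { intros tau Ht.
      set (ed := fun t => energy_density tau 1 (q s t) (q' s t)).
      assert (Up : RInt ed 0 (2 * PI) <= 2 * PI).
      { refine (energy_upper _ _ _ _ (Dlog_ps_nmul a Ha) (Dlog_ps_nmul _ Hn) (Dlog_ps_nmul _ Hnn)
          tau 1 Ht Rle_0_1 s PI Hs _).
        intros s0 Hs0. exact (univalent_area_bound a Ha Uni s0 s tau Hs0 Hs Ht). }
      assert (Ced : forall t, continuous ed t).
      { intros t. exact (continuity_2d_pt_section_r (fun x y => energy_density tau 1 (q x y) (q' x y)) s t
          (continuity_2d_energy_density _ _ _ (Dlog_ps_nmul a Ha) (Dlog_ps_nmul _ Hn)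
            tau 1 Ht Rle_0_1 s t Hs)). }
      assert (E1 : RInt (fun t => fst (H (polar s t)) - ed t) 0 (2 * PI) = 2 * PI - RInt ed 0 (2 * PI)).
      { rewrite <- IH at 2. apply (RInt_minus (V := R_CompleteNormedModule));
          now apply ex_RInt_everywhere_continuous. }
      assert (E2 : RInt (fun t => tau * A s t + tau ^ 2 * m s t) 0 (2 * PI) =
        tau * RInt (A s) 0 (2 * PI) + tau ^ 2 * RInt (m s) 0 (2 * PI)).
      { assert (X1 : ex_RInt (A s) 0 (2 * PI)) by now apply ex_RInt_everywhere_continuous.
        assert (X2 : ex_RInt (m s) 0 (2 * PI)) by now apply ex_RInt_everywhere_continuous.
        transitivity (RInt (fun t => tau * A s t) 0 (2 * PI) + RInt (fun t => tau ^ 2 * m s t) 0 (2 * PI)).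
        - exact (RInt_plus (V := R_CompleteNormedModule) _ _ _ _
            (ex_RInt_scal (V := R_NormedModule) (A s) 0 (2 * PI) tau X1)
            (ex_RInt_scal (V := R_NormedModule) (m s) 0 (2 * PI) (tau ^ 2) X2)).
        - f_equal.
          + exact (RInt_scal (V := R_CompleteNormedModule) (A s) 0 (2 * PI) tau X1).
          + exact (RInt_scal (V := R_CompleteNormedModule) (m s) 0 (2 * PI) (tau ^ 2) X2). }
      rewrite <- E2. apply Rle_trans with (RInt (fun t => fst (H (polar s t)) - ed t) 0 (2 * PI)).
      { rewrite E1. lra. }
      apply RInt_le; [lra| | |].
      - apply ex_RInt_everywhere_continuous. intros t.
        apply (continuous_minus (V := R_NormedModule)); auto.
      - apply ex_RInt_everywhere_continuous. intros t.
        apply (continuous_plus (V := R_NormedModule) (fun t => tau * A s t) (fun t => tau ^ 2 * m s t)).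
        + apply (continuous_scal_r (V := R_NormedModule) tau (A s)). apply CA.
        + apply (continuous_scal_r (V := R_NormedModule) (tau ^ 2) (m s)). apply Cm.
      - intros t _. rewrite EH. unfold ed, energy_density, A, m.
        fold (cdot (q s t) (q' s t)). fold (sqmod (q s t)). rewrite Rmult_1_l.
        assert (P := Hsq s t Hs). set (N := sqmod (q s t)) in *. set (d := cdot (q s t) (q' s t)).
        assert (Q : 0 <= (1 + d * d) * / (N * N * N) + d * / (N * N * (tau + N))).
        { apply Rle_trans with ((1 + d * d + d) * / (N * N * (tau + N))).
          - apply Rmult_le_pos; [nra|]. left. apply Rinv_0_lt_compat. repeat apply Rmult_lt_0_compat; lra.
          - rewrite Rmult_plus_distr_r. apply Rplus_le_compat_r. apply Rmult_le_compat_l; [nra|].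
            apply Rinv_le_contravar; [repeat apply Rmult_lt_0_compat; lra|].
            apply Rmult_le_compat_l; nra. }
        replace (d / N - d / (tau + N)) with
          (tau * (d * / (N * N)) - tau ^ 2 * (d * / (N * N * (tau + N)))) by (field; lra).
        assert (tau ^ 2 * (- (d * / (N * N * (tau + N)))) <= tau ^ 2 * ((1 + d * d) * / (N * N * N))).
        { apply Rmult_le_compat_l; [apply pow2_ge_0|]. lra. }
        lra. }
    assert (M0 : 0 <= RInt (m s) 0 (2 * PI)).
    { apply RInt_ge_0; [lra|now apply ex_RInt_everywhere_continuous|].
      intros t _. unfold m. assert (P := Hsq s t Hs). apply Rmult_le_pos; [nra|].
      left. apply Rinv_0_lt_compat. repeat apply Rmult_lt_0_compat; auto. }
    apply Rnot_lt_le. intros Hneg.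
    set (x := RInt (A s) 0 (2 * PI)) in *. set (y := RInt (m s) 0 (2 * PI)) in *.
    (* For this [tau] the product [tau * y] is below [- x / 2], so that [x + tau * y] would be
       negative. *)
    assert (T := Main (- x / (2 * (y + 1))) ltac:(apply Rdiv_lt_0_compat; lra)).
    set (tau := - x / (2 * (y + 1))) in *.
    assert (Ht : 0 < tau) by (apply Rdiv_lt_0_compat; lra).
    assert (Et : tau * (2 * (y + 1)) = - x) by (unfold tau; field; lra).
    assert (x + tau * y < 0) by nra. nra. }
  set (E := fun z => cross_terms rho b1 b2 b3 z (theta z) (kappa z)).
  assert (holoE : holo 2 E).
  { assert (Hth : holo 2 theta) by apply holo_theta.
    assert (Hka : holo 2 kappa).
    { apply holo_plus; [apply holo_mult; [apply holo_const|exact Hth]|].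
      exists theta''. split; [exact Dth'|]. exists theta3. split; [exact Dth''|exact I]. }
    unfold E, cross_terms, Cdiv.
    (* The opposite is not among the closure rules of [holo]; it is handled as multiplication by
       -1. *)
    assert (Hop : holo 2 (fun z => (- (z * z * z * z))%C)).
    { assert (X : holo 2 (fun z => (- (1)) * (z * z * z * z))%C) by holo_tac.
      destruct X as (g1 & D1 & X). exists g1. split; [|exact X].
      intros z Hz1. destruct (D1 z Hz1) as (l & Hl & El). exists l. split; auto.
      apply cderiv_ext_disk with (fun z => (- (1)) * (z * z * z * z))%C; auto. intros; ring. }
    repeat (first [exact Hth | exact Hka | exact Hop | apply holo_plus | apply holo_mult | apply holo_const | apply holo_id]). }
  assert (IE : RInt (fun t => fst (E (polar s t))) 0 (2 * PI) = 0).
  { rewrite (mean_value_Re E s holoE Hs).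
    replace (E (RtoC 0)) with (RtoC 0) by (unfold E, cross_terms; field; exact HRn).
    simpl. ring. }
  assert (EA : forall t, A s t = - (c0 + fst (E (polar s t)) + cdot (G (polar s t)) (K (polar s t)))).
  { intros t. set (z := polar s t).
    assert (Ezz : (z * Cconj z)%C = RtoC rho).
    { unfold z, rho, polar, Cmult, Cconj, RtoC; simpl. replace (2 * s) with (s + s) by ring.
      rewrite exp_plus. f_equal; [|ring].
      replace (exp s * cos t * (exp s * cos t) - exp s * sin t * - (exp s * sin t))
        with (exp s * exp s * (Rsqr (sin t) + Rsqr (cos t))) by (unfold Rsqr; ring).
      rewrite sin2_cos2. ring. }
    destruct (reciprocal_expansion z (Hz s t Hs) (Hzn s t)) as [F1 F2].
    unfold c0, E. unfold G at 1, K at 1.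
    rewrite <- (laurent_inner_product rho b1 b2 b3 z (theta z) (kappa z) HR Ezz).
    fold (G z) (K z). rewrite <- F1, <- F2.
    unfold A. change (ps a z) with (q s t). change (ps (nmul a) z) with (q' s t).
    assert (P := Hsq s t Hs). unfold sqmod in *. destruct (q s t) as [x y], (q' s t) as [u v].
    unfold cdot. simpl in *. field. nra. }
  destruct Dlog_K as (K' & DK & K'' & DK').
  (* With [b = 1] and [c = 0] the energy density is [cdot] of [G] and [K]. *)
  assert (PG := energy_nonneg G K K' K'' Dlog_G DK DK' 1 0 ltac:(lra) ltac:(lra) s Hs).
  assert (CGK : forall t, continuous (fun t => energy_density 1 0 (G (polar s t)) (K (polar s t))) t).
  { intros t.
    exact (continuity_2d_pt_section_r (fun x y => energy_density 1 0 (G (polar x y)) (K (polar x y))) s t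
      (continuity_2d_energy_density _ _ _ Dlog_G DK 1 0 Rlt_0_1 (Rle_refl 0) s t Hs)). }
  assert (CE : forall t, continuous (fun t => fst (E (polar s t))) t).
  { intros t. destruct holoE as (h & Dh & _).
    apply (continuity_2d_pt_section_r (fun x y => fst (E (polar x y)))).
    now apply (Dlog_continuity_2d E h). }
  assert (IA : RInt (A s) 0 (2 * PI) = - (2 * PI * c0 + 0 +
    RInt (fun t => energy_density 1 0 (G (polar s t)) (K (polar s t))) 0 (2 * PI))).
  { transitivity (RInt (fun t => opp (plus (plus c0 (fst (E (polar s t))))
      (energy_density 1 0 (G (polar s t)) (K (polar s t))))) 0 (2 * PI)).
    - apply RInt_ext. intros t _. rewrite EA. unfold opp, plus; simpl.
      f_equal. f_equal. unfold energy_density, cdot. field.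
    - assert (X1 : ex_RInt (V := R_NormedModule) (fun _ => c0) 0 (2 * PI)) by apply ex_RInt_const.
      assert (X2 : ex_RInt (fun t => fst (E (polar s t))) 0 (2 * PI)) by now apply ex_RInt_everywhere_continuous.
      assert (X3 : ex_RInt (fun t => energy_density 1 0 (G (polar s t)) (K (polar s t))) 0 (2 * PI))
        by now apply ex_RInt_everywhere_continuous.
      assert (X4 := ex_RInt_plus (V := R_NormedModule) _ _ _ _ X1 X2).
      assert (X5 := ex_RInt_plus (V := R_NormedModule) _ _ _ _ X4 X3).
      etransitivity; [exact (RInt_opp (V := R_CompleteNormedModule) _ _ _ X5)|].
      change (@opp R_CompleteNormedModule) with Ropp. f_equal.
      etransitivity; [exact (RInt_plus (V := R_CompleteNormedModule) _ _ _ _ X4 X3)|].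
      change (@plus R_CompleteNormedModule) with Rplus. f_equal.
      etransitivity; [exact (RInt_plus (V := R_CompleteNormedModule) _ _ _ _ X1 X2)|].
      change (@plus R_CompleteNormedModule) with Rplus. rewrite IE. f_equal.
      rewrite RInt_const. unfold scal; simpl; unfold mult; simpl. ring. }
  rewrite IA in PosA. nra.
Qed.
End with_derivative.

Theorem area_theorem : cdot (a 3%nat) (a 3%nat) + 2 * cdot (a 4%nat) (a 4%nat)
  + 3 * cdot (a 3%nat * a 3%nat - a 5%nat)%C (a 3%nat * a 3%nat - a 5%nat)%C <= 1.
Proof.
  destruct (holo_theta 3) as (t1 & D1 & t2 & D2 & t3 & D3 & _).
  assert (Main := area_inequality_circle t1 t2 t3 D1 D2 D3).
  assert (P : forall u, 0 <= cdot u u) by (intros u; unfold cdot; nra).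
  assert (E1 : cdot b1 b1 = cdot (a 3%nat) (a 3%nat)) by (unfold b1, c2, cdot; simpl; ring).
  assert (E2 : cdot b2 b2 = cdot (a 4%nat) (a 4%nat)) by (unfold b2, c3, cdot; simpl; ring).
  change (a 3%nat * a 3%nat - a 5%nat)%C with b3. rewrite <- E1, <- E2.
  assert (P1 := P b1). assert (P2 := P b2). assert (P3 := P b3).
  set (S := cdot b1 b1 + 2 * cdot b2 b2 + 3 * cdot b3 b3).
  apply Rnot_lt_le. intros HS. change (1 < S) in HS.
  (* Then rho^4 = S^(-1/2), so S rho^4 = S^(1/2) > 1. The circle inequality multiplied by [rho],
     with every power lowered to rho^4, gives S rho^4 <= 1. *)
  set (s := - ln S / 16).
  assert (LS : 0 < ln S) by (rewrite <- ln_1; apply ln_increasing; lra).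
  assert (Hs : s < 0) by (unfold s; lra).
  assert (T := Main s Hs). set (rho := exp (2 * s)) in *.
  assert (HR : 0 < rho < 1).
  { split; [apply exp_pos|]. unfold rho. rewrite <- exp_0. apply exp_increasing. lra. }
  assert (R4 : S * rho ^ 4 <= 1).
  { apply Rmult_le_compat_l with (r := rho) in T; [|lra].
    replace (rho * (- / rho + cdot b1 b1 * rho + 2 * cdot b2 b2 * rho ^ 2 + 3 * cdot b3 b3 * rho ^ 3))
      with (- 1 + cdot b1 b1 * rho ^ 2 + 2 * cdot b2 b2 * rho ^ 3 + 3 * cdot b3 b3 * rho ^ 4) in T by (field; lra).
    assert (Q0 : 0 < rho ^ 3) by (apply pow_lt; lra).
    assert (Q2 : rho ^ 4 <= rho ^ 3) by (change (rho ^ 4) with (rho * rho ^ 3); nra).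
    assert (Q1 : rho ^ 4 <= rho ^ 2).
    { apply Rle_trans with (rho ^ 3); auto. change (rho ^ 3) with (rho * rho ^ 2).
      generalize (pow2_ge_0 rho). nra. }
    assert (cdot b1 b1 * rho ^ 4 <= cdot b1 b1 * rho ^ 2) by (apply Rmult_le_compat_l; lra).
    assert (cdot b2 b2 * rho ^ 4 <= cdot b2 b2 * rho ^ 3) by (apply Rmult_le_compat_l; lra).
    unfold S. lra. }
  assert (E8 : rho ^ 4 = exp (- (ln S / 2))).
  { unfold rho. simpl. rewrite Rmult_1_r, <- !exp_plus. f_equal. unfold s. field. }
  assert (E9 : S * exp (- (ln S / 2)) = exp (ln S / 2)).
  { rewrite <- (exp_ln S) at 1 by lra. rewrite <- exp_plus. f_equal. field. }
  rewrite E8, E9 in R4. assert (exp 0 < exp (ln S / 2)) by (apply exp_increasing; lra).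
  rewrite exp_0 in *. lra.
Qed.
End area_theorem.

(** * Orders of vanishing at the origin and the coefficients of the inverse *)

Definition bigO (n : nat) (h : C -> C) : Prop :=
  exists K d, 0 <= K /\ 0 < d <= 1 /\ forall w, 0 < Cmod w < d -> Cmod (h w) <= K * Cmod w ^ n.

Lemma bigO_ext (n : nat) (h k : C -> C) (d0 : R) : 0 < d0 ->
  (forall w, 0 < Cmod w < d0 -> h w = k w) -> bigO n h -> bigO n k.
Proof.
  intros Hd0 E (K & d & HK & Hd & H). exists K, (Rmin d d0). split; auto.
  assert (Q1 := Rmin_l d d0). assert (Q2 := Rmin_r d d0).
  split; [split; [apply Rmin_glb_lt; lra|lra]|].
  intros w Hw. rewrite <- E by lra. apply H. lra.
Qed.

Lemma bigO_plus (n : nat) (h k : C -> C) : bigO n h -> bigO n k -> bigO n (fun w => h w + k w)%C.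
Proof.
  intros (K & d & HK & Hd & H) (K' & d' & HK' & Hd' & H').
  exists (K + K'), (Rmin d d'). split; [lra|].
  assert (Q1 := Rmin_l d d'). assert (Q2 := Rmin_r d d').
  split; [split; [apply Rmin_glb_lt; lra|lra]|].
  intros w Hw. eapply Rle_trans; [apply Cmod_triangle|].
  generalize (H w ltac:(lra)) (H' w ltac:(lra)). lra.
Qed.

Lemma bigO_mult (n m : nat) (h k : C -> C) : bigO n h -> bigO m k -> bigO (n + m) (fun w => h w * k w)%C.
Proof.
  intros (K & d & HK & Hd & H) (K' & d' & HK' & Hd' & H').
  exists (K * K'), (Rmin d d'). split; [now apply Rmult_le_pos|].
  assert (Q1 := Rmin_l d d'). assert (Q2 := Rmin_r d d').
  split; [split; [apply Rmin_glb_lt; lra|lra]|].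
  intros w Hw. rewrite Cmod_mult, pow_add.
  replace (K * K' * (Cmod w ^ n * Cmod w ^ m)) with (K * Cmod w ^ n * (K' * Cmod w ^ m)) by ring.
  apply Rmult_le_compat; try apply Cmod_ge_0; [apply H|apply H']; lra.
Qed.

Lemma bigO_weaken (n m : nat) (h : C -> C) : (m <= n)%nat -> bigO n h -> bigO m h.
Proof.
  intros Hm (K & d & HK & Hd & H). exists K, d. split; auto. split; auto.
  intros w Hw. eapply Rle_trans; [now apply H|]. apply Rmult_le_compat_l; auto.
  replace n with (m + (n - m))%nat by lia. rewrite pow_add.
  assert (0 <= Cmod w ^ m) by (apply pow_le, Cmod_ge_0).
  assert (Cmod w ^ (n - m) <= 1).
  { rewrite <- (pow1 (n - m)). apply pow_incr. lra. }
  assert (0 <= Cmod w ^ (n - m)) by (apply pow_le, Cmod_ge_0). nra.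
Qed.

Lemma bigO_const (c : C) : bigO 0 (fun _ => c).
Proof.
  exists (Cmod c), 1. split; [apply Cmod_ge_0|]. split; [lra|]. intros w _. simpl. lra.
Qed.

Lemma bigO_id : bigO 1 (fun w => w).
Proof. exists 1, 1. split; [lra|]. split; [lra|]. intros w _. simpl. lra. Qed.

Lemma bigO_scal (n : nat) (c : C) (h : C -> C) : bigO n h -> bigO n (fun w => c * h w)%C.
Proof. intros H. exact (bigO_mult 0 n _ _ (bigO_const c) H). Qed.

(** Letting w -> 0 yields [c], and dividing by [w] yields the rest. The division explains why [bigO]
    ignores the point 0. Iterated, this reads off Taylor coefficients one at a time. *)
Lemma bigO_peel (n : nat) (c : C) (h : C -> C) : bigO (S n) (fun w => c + w * h w)%C -> bigO 0 h ->
  c = RtoC 0 /\ bigO n h.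
Proof.
  intros H H0.
  assert (Ec : c = RtoC 0).
  { destruct (bigO_weaken (S n) 1 _ ltac:(lia) H) as (K & d & HK & Hd & B).
    destruct H0 as (K' & d' & HK' & Hd' & B').
    apply Cmod_eq_0. apply Rle_antisym; [|apply Cmod_ge_0].
    apply (nonpos_of_small_linear_bound _ (K + K') (Rmin d d')); [lra|apply Rmin_glb_lt; lra|].
    intros t Ht. assert (Q3 := Rmin_l d d'). assert (Q4 := Rmin_r d d').
    assert (Hc : Cmod (RtoC t) = t) by (rewrite Cmod_R; apply Rabs_pos_eq; lra).
    assert (A1 := B (RtoC t)). assert (A2 := B' (RtoC t)). rewrite Hc in A1, A2.
    specialize (A1 ltac:(lra)). specialize (A2 ltac:(lra)).
    simpl in A2. rewrite Rmult_1_r in A2. rewrite pow_1 in A1.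
    replace c with ((c + RtoC t * h (RtoC t)) - RtoC t * h (RtoC t))%C by ring.
    eapply Rle_trans; [apply Cmod_minus_triangle|]. rewrite Cmod_mult, Hc. nra. }
  split; auto. destruct H as (K & d & HK & Hd & B). exists K, d. split; auto. split; auto.
  intros w Hw. assert (T := B w Hw). rewrite Ec, Cplus_0_l, Cmod_mult in T.
  apply Rmult_le_reg_l with (Cmod w); [lra|]. simpl in T. lra.
Qed.

Lemma ps_bigO (a : nat -> C) : disk_seq a -> bigO 0 (ps a).
Proof.
  intros H. destruct (ps_bound a (1 / 2) H) as (B & HB & HB'); [lra|].
  exists B, (1 / 2). split; auto. split; [lra|]. intros w Hw. simpl. rewrite Rmult_1_r.
  apply HB'. lra.
Qed.

Lemma bigO_compose_bounded (h g : C -> C) : bigO 0 h -> bigO 1 g ->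
  (exists d, 0 < d /\ forall w, 0 < Cmod w < d -> g w <> 0) -> bigO 0 (fun w => h (g w)).
Proof.
  intros (K & d & HK & Hd & H) (K' & d' & HK' & Hd' & H') (d2 & Hd2 & Hn).
  assert (P : 0 < d / (K' + 1)) by (apply Rdiv_lt_0_compat; lra).
  exists K, (Rmin (Rmin d' d2) (d / (K' + 1))). split; auto.
  assert (Q1 := Rmin_l (Rmin d' d2) (d / (K' + 1))). assert (Q2 := Rmin_r (Rmin d' d2) (d / (K' + 1))).
  assert (Q3 := Rmin_l d' d2). assert (Q4 := Rmin_r d' d2).
  split; [split; [repeat apply Rmin_glb_lt; lra|lra]|].
  intros w Hw. simpl. apply (H (g w)). split.
  - apply Cmod_gt_0. apply Hn. lra.
  - eapply Rle_lt_trans; [apply H'; lra|]. rewrite pow_1.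
    assert (A : Cmod w < d / (K' + 1)) by lra.
    apply Rmult_lt_compat_r with (r := K' + 1) in A; [|lra].
    replace (d / (K' + 1) * (K' + 1)) with d in A by (field; lra). nra.
Qed.

(** The functional equation [ps a (g w) = w] determines [g] up to order 6, and comparison with the
    given series identifies the coefficients; no composition of power series is formed. *)
Lemma inverse_coefficients (a A : nat -> C) :
  a 0%nat = RtoC 0 -> a 1%nat = RtoC 1 -> a 2%nat = RtoC 0 -> disk_seq a ->
  (forall z w, Cmod z < 1 -> Cmod w < 1 -> ps a z = ps a w -> z = w) ->
  is_inverse_expansion a A ->
  A 3%nat = (- a 3%nat)%C /\ A 4%nat = (- a 4%nat)%C /\
  A 5%nat = (RtoC 3 * (a 3%nat * a 3%nat) - a 5%nat)%C.
Proof.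
  intros a0 a1 a2 Ha Uni (r & Hr & Inv).
  assert (Hrn : RtoC r <> 0) by (intros E; injection E; lra).
  (* Rescaling by [r] turns the disc of the inverse into the unit disc, where the theory of [ps]
     applies. *)
  set (A' := fun n => (A n * RtoC r ^ n)%C).
  assert (HA' : disk_seq A').
  { apply analytic_disk_seq. intros z Hz.
    destruct (Inv (RtoC r * z)%C) as (gw & H1 & _).
    { rewrite Cmod_mult, Cmod_R, Rabs_pos_eq by lra. unfold in_unit_disk in Hz.
      assert (P := Cmod_ge_0 z). nra. }
    exists gw. unfold pseries_sum in *.
    eapply is_series_ext; [|exact H1]. intros n. unfold A'. simpl.
    rewrite Cpow_mult_l. ring. }
  set (g := fun w => ps A' (w / RtoC r)%C).
  assert (Hx : forall w, Cmod w < r -> Cmod (w / RtoC r) < 1).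
  { intros w Hw. rewrite Cmod_div, Cmod_R, Rabs_pos_eq by (auto; lra).
    apply Rmult_lt_reg_r with r; auto. unfold Rdiv. rewrite Rmult_assoc, Rinv_l; lra. }
  assert (Hg : forall w, Cmod w < r -> Cmod (g w) < 1 /\ ps a (g w) = w).
  { intros w Hw. destruct (Inv w Hw) as (gw & H1 & H2 & H3).
    assert (E : gw = g w).
    { unfold g, ps. apply csum_unique. eapply is_series_ext; [|exact H1].
      intros n. unfold A'. simpl. unfold Cdiv. rewrite Cpow_mult_l.
      transitivity (A n * (w ^ n * (RtoC r ^ n * (/ RtoC r) ^ n)))%C; [|simpl; ring].
      rewrite <- Cpow_mult_l, Cinv_r, Cpow_1_l by exact Hrn. simpl. ring. }
    rewrite <- E. split; [exact H2|]. symmetry. now apply csum_unique. }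
  assert (Hg0 : forall w, 0 < Cmod w < r -> g w <> 0).
  { intros w Hw E. destruct (Hg w) as [_ E2]; [lra|].
    rewrite E, ps_unfold, a0 in E2 by (auto; rewrite Cmod_0; lra).
    assert (W0 : w = RtoC 0) by (rewrite <- E2; ring). rewrite W0, Cmod_0 in Hw. lra. }
  assert (S1 := disk_seq_shift _ HA').
  set (t6 := ps (Nat.iter 5 cshift (cshift A'))).
  assert (T6 : bigO 0 (fun w => / RtoC r ^ 6 * t6 (w / RtoC r))%C).
  { apply bigO_scal. apply (bigO_compose_bounded t6 (fun w => w / RtoC r)%C).
    - apply ps_bigO. now do 5 apply disk_seq_shift.
    - apply (bigO_ext 1 (fun w => / RtoC r * w)%C _ 1); [lra|intros; unfold Cdiv; ring|].
      apply bigO_scal, bigO_id.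
    - exists 1. split; [lra|]. intros w Hw E. assert (W0 : w = RtoC 0).
      { replace w with (RtoC r * (w / RtoC r))%C by (field; exact Hrn). rewrite E. ring. }
      rewrite W0, Cmod_0 in Hw. lra. }
  set (u6 := fun w => (/ RtoC r ^ 6 * t6 (w / RtoC r))%C) in *.
  assert (EG : forall w, Cmod w < r -> g w = (A 0%nat + w * (A 1%nat + w * (A 2%nat + w * (A 3%nat
    + w * (A 4%nat + w * (A 5%nat + w * u6 w))))))%C).
  { intros w Hw. specialize (Hx w Hw). unfold g, u6. set (x := (w / RtoC r)%C) in *.
    rewrite (ps_unfold A'), (ps_expand5 (cshift A')) by assumption.
    fold t6. unfold cshift, A'. simpl Cpow.
    replace w with (RtoC r * x)%C by (unfold x; field; exact Hrn). field. exact Hrn. }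
  (* [A 0] is the value of the inverse at 0; [ps a] sends both it and 0 to 0, and univalence
     identifies them. *)
  assert (A00 : A 0%nat = RtoC 0).
  { destruct (Hg (RtoC 0)) as [H1 H2]; [rewrite Cmod_0; lra|].
    rewrite EG in H1, H2 by (rewrite Cmod_0; lra).
    replace (A 0%nat + 0 * _)%C with (A 0%nat) in H1, H2 by ring.
    apply Uni; auto; [rewrite Cmod_0; lra|]. rewrite H2.
    rewrite ps_unfold, a0 by (auto; rewrite Cmod_0; lra). ring. }
  set (v1 := fun w => (A 1%nat + w * (A 2%nat + w * (A 3%nat + w * (A 4%nat + w * (A 5%nat + w * u6 w)))))%C).
  assert (Step : forall c h, bigO 0 h -> bigO 0 (fun w => c + w * h w)%C).
  { intros c h Hh. apply bigO_plus; [apply bigO_const|].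
    apply (bigO_weaken 1 0); [lia|]. exact (bigO_mult 1 0 _ _ bigO_id Hh). }
  assert (Bg1 : bigO 1 g).
  { apply (bigO_ext 1 (fun w => w * v1 w)%C _ r); auto.
    - intros w Hw. rewrite EG, A00 by lra. unfold v1. ring.
    - apply (bigO_mult 1 0); [apply bigO_id|]. unfold v1. repeat apply Step. exact T6. }
  set (phi5 := ps (Nat.iter 5 cshift (cshift a))).
  set (c2 := a 3%nat). set (c3 := a 4%nat). set (c4 := a 5%nat).
  assert (Bphi : bigO 0 (fun w => phi5 (g w))).
  { apply bigO_compose_bounded; auto.
    - apply ps_bigO. now do 6 apply disk_seq_shift.
    - exists r. split; auto. }
  assert (Eq : forall w, Cmod w < r -> w = (g w + c2 * (g w * g w * g w) + c3 * (g w * g w * g w * g w)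
    + c4 * (g w * g w * g w * g w * g w) + (g w * g w * g w * g w * g w * g w) * phi5 (g w))%C).
  { intros w Hw. destruct (Hg w Hw) as [H1 H2]. rewrite <- H2 at 1.
    rewrite (ps_factor a Ha a0) by auto. rewrite (phi_expand a Ha a1 a2) by auto.
    fold c2 c3 c4 phi5. ring. }
  assert (Em : forall w, Cmod w < r -> (g w - w)%C = (- (c2 * (g w * g w * g w) + c3 * (g w * g w * g w * g w)
    + c4 * (g w * g w * g w * g w * g w) + (g w * g w * g w * g w * g w * g w) * phi5 (g w)))%C).
  { intros w Hw. etransitivity; [exact (f_equal (fun x => (g w - x)%C) (Eq w Hw))|]. simpl. ring. }
  assert (Bg2 := bigO_mult 1 1 _ _ Bg1 Bg1). assert (Bg3 := bigO_mult 2 1 _ _ Bg2 Bg1).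
  assert (Bg4 := bigO_mult 3 1 _ _ Bg3 Bg1). assert (Bg5 := bigO_mult 4 1 _ _ Bg4 Bg1).
  assert (Bg6 := bigO_mult 5 1 _ _ Bg5 Bg1). assert (Bg6p := bigO_mult 6 0 _ _ Bg6 Bphi).
  simpl Nat.add in *.
  assert (W1 := bigO_id). assert (W2 := bigO_mult 1 1 _ _ W1 W1). assert (W3 := bigO_mult 2 1 _ _ W2 W1).
  assert (W4 := bigO_mult 3 1 _ _ W3 W1). simpl Nat.add in *.
  (* Bootstrapping in g = w - c2 g^3 - c3 g^4 - c4 g^5 - ...: every estimate of [e] sharpens those
     of the powers of [g], which in turn sharpen the expansion of [g], from order 3 through 4 to
     6. *)
  set (e := fun w => (g w - w)%C).
  assert (Be3 : bigO 3 e).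
  { apply (bigO_ext 3 (fun w => (- (1)) * (c2 * (g w * g w * g w) + c3 * (g w * g w * g w * g w)
      + c4 * (g w * g w * g w * g w * g w) + (g w * g w * g w * g w * g w * g w) * phi5 (g w)))%C _ r); auto.
    - intros w Hw. unfold e. rewrite Em by lra. ring.
    - apply bigO_scal. repeat apply bigO_plus; try apply bigO_scal.
      + exact Bg3.
      + apply (bigO_weaken 4); [lia|exact Bg4].
      + apply (bigO_weaken 5); [lia|exact Bg5].
      + apply (bigO_weaken 6); [lia|exact Bg6p]. }
  assert (D3 : bigO 5 (fun w => g w * g w * g w - w * w * w)%C).
  { apply (bigO_ext 5 (fun w => e w * (g w * g w + g w * w + w * w))%C _ 1); [lra|intros; unfold e; ring|].
    apply (bigO_mult 3 2); auto. repeat apply bigO_plus; auto. exact (bigO_mult 1 1 _ _ Bg1 W1). }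
  assert (D4 : bigO 6 (fun w => g w * g w * g w * g w - w * w * w * w)%C).
  { apply (bigO_ext 6 (fun w => e w * (g w * g w * g w + g w * g w * w + g w * (w * w) + w * w * w))%C _ 1);
      [lra|intros; unfold e; ring|].
    apply (bigO_mult 3 3); auto. repeat apply bigO_plus; auto.
    - exact (bigO_mult 2 1 _ _ Bg2 W1).
    - exact (bigO_mult 1 2 _ _ Bg1 W2). }
  assert (D5 : bigO 6 (fun w => g w * g w * g w * g w * g w - w * w * w * w * w)%C).
  { apply (bigO_ext 6 (fun w => (g w * g w * g w * g w - w * w * w * w) * g w + e w * (w * w * w * w))%C _ 1);
      [lra|intros; unfold e; ring|].
    apply bigO_plus.
    - apply (bigO_weaken 7); [lia|]. exact (bigO_mult 6 1 _ _ D4 Bg1).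
    - apply (bigO_weaken 7); [lia|]. exact (bigO_mult 3 4 _ _ Be3 W4). }
  assert (Be4 : bigO 4 (fun w => e w + c2 * (w * w * w))%C).
  { apply (bigO_ext 4 (fun w => (- (1)) * (c2 * (g w * g w * g w - w * w * w) + c3 * (g w * g w * g w * g w)
      + c4 * (g w * g w * g w * g w * g w) + (g w * g w * g w * g w * g w * g w) * phi5 (g w)))%C _ r); auto.
    - intros w Hw. unfold e. rewrite Em by lra. ring.
    - apply bigO_scal. repeat apply bigO_plus; try apply bigO_scal.
      + apply (bigO_weaken 5); [lia|exact D3].
      + exact Bg4.
      + apply (bigO_weaken 5); [lia|exact Bg5].
      + apply (bigO_weaken 6); [lia|exact Bg6p]. }
  (* In g^3 - w^3 = 3 w^2 e + 3 w e^2 + e^3 only 3 w^2 e matters, with e close to -c2 w^3.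
     Multiplied by -c2 this becomes the term 3 c2^2 of [A 5]. *)
  assert (D3' : bigO 6 (fun w => g w * g w * g w - w * w * w + RtoC 3 * c2 * (w * w * w * w * w))%C).
  { apply (bigO_ext 6 (fun w => RtoC 3 * (w * w * (e w + c2 * (w * w * w)))
      + (RtoC 3 * (w * (e w * e w)) + e w * (e w * e w)))%C _ 1); [lra|intros; unfold e; ring|].
    apply bigO_plus; [apply bigO_scal; exact (bigO_mult 2 4 _ _ W2 Be4)|].
    assert (E2 := bigO_mult 3 3 _ _ Be3 Be3). simpl Nat.add in E2.
    apply bigO_plus.
    - apply bigO_scal. apply (bigO_weaken 7); [lia|]. exact (bigO_mult 1 6 _ _ W1 E2).
    - apply (bigO_weaken 9); [lia|]. exact (bigO_mult 3 6 _ _ Be3 E2). }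
  assert (Final : bigO 6 (fun w => g w - (w - c2 * (w * w * w) - c3 * (w * w * w * w)
    + (RtoC 3 * (c2 * c2) - c4) * (w * w * w * w * w)))%C).
  { apply (bigO_ext 6 (fun w => (- (1)) * (c2 * (g w * g w * g w - w * w * w + RtoC 3 * c2 * (w * w * w * w * w))
      + c3 * (g w * g w * g w * g w - w * w * w * w)
      + c4 * (g w * g w * g w * g w * g w - w * w * w * w * w)
      + (g w * g w * g w * g w * g w * g w) * phi5 (g w)))%C _ r); auto.
    - intros w Hw.
      transitivity ((g w - w) + c2 * (w * w * w) + c3 * (w * w * w * w)
        - (RtoC 3 * (c2 * c2) - c4) * (w * w * w * w * w))%C; [|ring].
      rewrite Em by lra. ring.
    - apply bigO_scal. repeat apply bigO_plus; try apply bigO_scal; auto. }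
  assert (Poly : bigO 6 (fun w => RtoC 0 + w * ((A 1%nat - RtoC 1) + w * (A 2%nat + w * ((A 3%nat + c2)
    + w * ((A 4%nat + c3) + w * ((A 5%nat - (RtoC 3 * (c2 * c2) - c4)) + w * u6 w))))))%C).
  { apply (bigO_ext 6 _ _ r Hr) with (2 := Final). intros w Hw. rewrite EG, A00 by lra. ring. }
  assert (U0 : bigO 0 u6) by exact T6.
  assert (V5 := Step (A 5%nat - (RtoC 3 * (c2 * c2) - c4))%C _ U0).
  assert (V4 := Step (A 4%nat + c3)%C _ V5). assert (V3 := Step (A 3%nat + c2)%C _ V4).
  assert (V2 := Step (A 2%nat) _ V3). assert (V1 := Step (A 1%nat - RtoC 1)%C _ V2).
  destruct (bigO_peel 5 _ _ Poly V1) as [_ P1]. destruct (bigO_peel 4 _ _ P1 V2) as [_ P2].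
  destruct (bigO_peel 3 _ _ P2 V3) as [_ P3]. destruct (bigO_peel 2 _ _ P3 V4) as [R3 P4].
  destruct (bigO_peel 1 _ _ P4 V5) as [R4 P5]. destruct (bigO_peel 0 _ _ P5 U0) as [R5 _].
  assert (Solve : forall x y : C, (x - y)%C = RtoC 0 -> x = y).
  { intros x y E. replace x with (y + (x - y))%C by ring. rewrite E. ring. }
  split; [|split]; apply Solve.
  - rewrite <- R3. unfold c2. ring.
  - rewrite <- R4. unfold c3. ring.
  - exact R5.
Qed.

(** * The bound for the Hankel determinant *)

Lemma cdot_self (z : C) : cdot z z = Cmod z ^ 2.
Proof. exact (sqmod_Cmod z). Qed.

Theorem theorem2 (a A : nat -> C) :
  a 0%nat = RtoC 0 -> a 1%nat = RtoC 1 -> a 2%nat = RtoC 0 ->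
  analytic_in_disk a -> univalent_in_disk a ->
  is_inverse_expansion a A ->
  Cmod (A 3%nat * A 5%nat - A 4%nat * A 4%nat)%C
    <= sqrt 3 / (6 * sqrt 7) + 2 * sqrt 3.
Proof.
  intros a0 a1 a2 Han Huni Hinv.
  assert (Ha := analytic_disk_seq a Han).
  assert (Uni : forall z w, Cmod z < 1 -> Cmod w < 1 -> ps a z = ps a w -> z = w).
  { intros z w Hz Hw E.
    apply (Huni z w (ps a z) (ps a w)); auto; now apply ps_correct. }
  destruct (inverse_coefficients a A a0 a1 a2 Ha Uni Hinv) as (E3 & E4 & E5).
  assert (Area := area_theorem a Ha Uni a0 a1 a2). rewrite !cdot_self in Area.
  rewrite E3, E4, E5.
  set (x := a 3%nat) in *. set (y := a 4%nat) in *. set (b := (x * x - a 5%nat)%C) in *.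
  replace (- x * (RtoC 3 * (x * x) - a 5%nat) - - y * - y)%C
    with (- (x * b + RtoC 2 * (x * x * x) + y * y))%C by (unfold b; ring).
  rewrite Cmod_opp.
  assert (T1 := Cmod_triangle (x * b + RtoC 2 * (x * x * x)) (y * y)).
  assert (T2 := Cmod_triangle (x * b) (RtoC 2 * (x * x * x))).
  rewrite Cmod_mult in T1. rewrite !Cmod_mult, Cmod_R, Rabs_pos_eq in T2 by lra.
  assert (Px := Cmod_ge_0 x). assert (Py := Cmod_ge_0 y). assert (Pb := Cmod_ge_0 b).
  assert (X1 : Cmod x <= 1) by nra.
  assert (X3 : Cmod x * Cmod x * Cmod x <= 1) by nra.
  (* Enough for 5/2 <= 2 sqrt 3; the other summand only has to be positive. *)
  assert (S3 : 17 / 10 <= sqrt 3).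
  { rewrite <- (sqrt_square (17 / 10)) by lra. apply sqrt_le_1; lra. }
  assert (S7 : 0 < sqrt 7) by (apply sqrt_lt_R0; lra).
  assert (0 < sqrt 3 / (6 * sqrt 7)) by (apply Rdiv_lt_0_compat; lra).
  (* Half of the area inequality then bounds this term together with |y|^2 by 1/2, and 2 |x|^3 is at
     most 2. *)
  assert (Cmod x * Cmod b <= (Cmod x ^ 2 + Cmod b ^ 2) / 2).
  { generalize (pow2_ge_0 (Cmod x - Cmod b)). lra. }
  nra.
Qed.
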